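(* Let $p,m$ be positive integers, $F$ a field, and $V$ an $F$-vector space with $\dim_F(V)=pm+1$. Let $\mathsf T\subset \mathrm{SL}(V)\simeq \mathrm{SL}_{pm+1}$ be a maximal torus over $F$, possibly nonsplit, and consider the resulting action of $\mathsf T$ on $\mathrm{Gr}(p,V)$. Choose a subspace $W\subset V$ with $$\dim_F(W)=(p-1)m+1$$ that is transverse to $\mathsf T$ in the sense that $\mathrm{Gr}(p,W)\subset\mathrm{Gr}(p,V)$ meets some stable $\mathsf T$-orbit properly. Then $\mathrm{Gr}(p,W)$ is a rational section of the quotient map $$\mathrm{Gr}(p,V)\dashrightarrow \mathrm{Gr}(p,V)/\mathsf T .$$ Thus if $\mathrm{Gr}(p,W)$ is rational, linearizable, or stably linearizable, then the same holds true of the quotient $\mathrm{Gr}(p,V)/\mathsf T$.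
   Context: $\mathrm{Gr}(p,V)$ is the Grassmannian of $p$-dimensional subspaces of $V$. Stability is in the sense of Geometric Invariant Theory for the $\mathsf T$-action on $\mathrm{Gr}(p,V)$ in its Plücker embedding, and $\mathrm{Gr}(p,V)/\mathsf T$ is the quotient, defined on the stable locus. ''Meets properly'' means that the intersection with the orbit is nonempty and has the expected dimension, which is zero here since $\mathrm{codim}(\mathrm{Gr}(p,W)\subset\mathrm{Gr}(p,V))=pm=\dim\mathsf T$. ''Rational section'' means that the quotient map restricts to a birational map from $\mathrm{Gr}(p,W)$ to the quotient. Rationality is over $F$. The words ''linearizable'' and ''stably linearizable'' refer to the equivariant situation, in which a finite group $G$ acts compatibly (linearly on $V$, normalizing $\mathsf T$ and preserving $W$): a generically free $G$-action on a variety $X$ is linearizable if $X$ is $G$-equivariantly birational to $\mathbb{P}(V')$ for a linear representation $V'$ of $G$, and stably linearizable if $X\times\mathbb{P}^r$, with trivial action on the second factor, is linearizable for some $r$. *)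

(* Defs.v *)
From mathcomp Require Import all_boot all_order all_algebra all_fingroup.
From mathcomp Require Import mxrepresentation.
From mathcomp Require Import mpoly.
From mathcomp Require Import boolp classical_sets cardinality.

Set Implicit Arguments.
Unset Strict Implicit.
Unset Printing Implicit Defensive.

Import GRing.Theory.
Local Open Scope ring_scope.
Local Open Scope classical_set_scope.

(* Conventions.  [iota : F -> K] is a field embedding, K algebraically closed
   (an algebraic closure of F in the theorem).  A reduced quasi-projective
   F-scheme is given by its K-points: a subset of P^(N-1)(K) that is locally
   closed for the Zariski topology defined by polynomials over F, with maps and
   functions that are locally given by polynomials over F.  Taking
   [iota := idfun] gives the classical notions over K.  A point of P^(N-1)(K)
   is a nonzero row vector, up to the relation [peq]; a subset of P^(N-1)(K) is
   a set of nonzero row vectors stable under scaling.  Groups act on row vectors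
   on the right, as in mxrepresentation. *)

Definition proj_space (K : fieldType) (N : nat) : set 'rV[K]_N :=
  [set v | v != 0].

Definition peq (K : fieldType) (N : nat) (v w : 'rV[K]_N) : Prop :=
  exists2 c : K, c != 0 & w = c *: v.

Section Zariski.

Variables (F K : fieldType) (iota : {rmorphism F -> K}).

Definition feval N (f : {mpoly F[N]}) (v : 'rV[K]_N) : K :=
  mmap iota (fun j => v 0 j) f.

Definition zariski_open N (X U : set 'rV[K]_N) : Prop :=
  exists S : set {mpoly F[N]},
    (forall f, S f -> exists d, f \is d.-homog) /\
    U = X `&` [set v | exists2 f, S f & feval f v != 0].

Definition zariski_closed N (X Z : set 'rV[K]_N) : Prop :=
  Z `<=` X /\ zariski_open X (X `\` Z).

Definition quasi_projective N (X : set 'rV[K]_N) : Prop :=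
  exists2 Z, zariski_closed (@proj_space K N) Z & zariski_open Z X.

Definition dense_open N (X U : set 'rV[K]_N) : Prop :=
  zariski_open X U /\
  forall O, zariski_open X O -> O !=set0 -> (O `&` U) !=set0.

Definition irreducible_set N (Z : set 'rV[K]_N) : Prop :=
  Z !=set0 /\
  forall O O', zariski_open Z O -> zariski_open Z O' ->
    O !=set0 -> O' !=set0 -> (O `&` O') !=set0.

Definition irreducible_chain N (X : set 'rV[K]_N) (e : nat) : Prop :=
  exists Z : nat -> set 'rV[K]_N,
    (forall i, (i <= e)%N -> zariski_closed X (Z i) /\ irreducible_set (Z i)) /\
    (forall i, (i < e)%N -> Z i `<` Z i.+1).

Definition zariski_dim N (X : set 'rV[K]_N) (d : nat) : Prop :=
  irreducible_chain X d /\
  forall e, irreducible_chain X e -> (e <= d)%N.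

(* The local condition forces f to be compatible with peq on X. *)
Definition regular_map N M (X : set 'rV[K]_N) (Y : set 'rV[K]_M)
    (f : 'rV[K]_N -> 'rV[K]_M) : Prop :=
  forall v, X v -> Y (f v) /\
    exists (d : nat) (s : 'I_M -> {mpoly F[N]}),
      let ev w : 'rV[K]_M := \row_j feval (s j) w in
      [/\ forall j, s j \is d.-homog, ev v != 0
        & forall w, X w -> ev w != 0 -> peq (ev w) (f w)].

Definition regular_function N (X : set 'rV[K]_N) (h : 'rV[K]_N -> K) : Prop :=
  forall v, X v ->
    exists (d : nat) (a b : {mpoly F[N]}),
      [/\ a \is d.-homog, b \is d.-homog, feval b v != 0
        & forall w, X w -> feval b w != 0 -> h w = feval a w / feval b w].

Definition birational_between N M (X U : set 'rV[K]_N) (Y U' : set 'rV[K]_M)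
    (f : 'rV[K]_N -> 'rV[K]_M) (g : 'rV[K]_M -> 'rV[K]_N) : Prop :=
  [/\ dense_open X U /\ dense_open Y U',
      regular_map U U' f, regular_map U' U g,
      forall x, U x -> peq (g (f x)) x
    & forall y, U' y -> peq (f (g y)) y].

Definition birational_map N M (X : set 'rV[K]_N) (Y : set 'rV[K]_M) f : Prop :=
  exists U U' g, birational_between X U Y U' f g.

Definition birational N M (X : set 'rV[K]_N) (Y : set 'rV[K]_M) : Prop :=
  exists f, birational_map X Y f.

Definition rational N (X : set 'rV[K]_N) : Prop :=
  exists d, birational X (@proj_space K d.+1).

End Zariski.

Section Actions.

Variables (F K : fieldType) (iota : {rmorphism F -> K}).
Variables (gT : finGroupType) (G : {group gT}).

Definition variety_action N (X : set 'rV[K]_N)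
    (act : gT -> 'rV[K]_N -> 'rV[K]_N) : Prop :=
  [/\ forall g, g \in G -> regular_map iota X X (act g),
      forall x, X x -> peq (act 1%g x) x
    & forall g h x, g \in G -> h \in G -> X x ->
        peq (act (g * h)%g x) (act h (act g x))].

Definition generically_free N (X : set 'rV[K]_N)
    (act : gT -> 'rV[K]_N -> 'rV[K]_N) : Prop :=
  exists2 U, dense_open iota X U &
    forall g x, g \in G -> U x -> peq (act g x) x -> g = 1%g.

(* Equivariance of a map defined on U, which need not be G-stable. *)
Definition equivariant_on N M (U : set 'rV[K]_N)
    (actX : gT -> 'rV[K]_N -> 'rV[K]_N) (actY : gT -> 'rV[K]_M -> 'rV[K]_M)
    (f : 'rV[K]_N -> 'rV[K]_M) : Prop :=
  forall g x, g \in G -> U x -> U (actX g x) ->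
    peq (f (actX g x)) (actY g (f x)).

Definition equivariantly_birational N M
    (X : set 'rV[K]_N) (actX : gT -> 'rV[K]_N -> 'rV[K]_N)
    (Y : set 'rV[K]_M) (actY : gT -> 'rV[K]_M -> 'rV[K]_M) : Prop :=
  exists U U' f g,
    birational_between iota X U Y U' f g /\ equivariant_on U actX actY f.

Definition rep_act n (rG : mx_representation F G n) (g : gT) (v : 'rV[K]_n) :
    'rV[K]_n :=
  v *m map_mx iota (rG g).

Definition linearizable N (X : set 'rV[K]_N)
    (act : gT -> 'rV[K]_N -> 'rV[K]_N) : Prop :=
  [/\ variety_action X act, generically_free X act
    & exists (d : nat) (rV : mx_representation F G d.+1),
        equivariantly_birational X act (@proj_space K d.+1) (rep_act rV)].

(* X * P^r, in the Segre embedding (v, w) |-> v^T w. *)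
Definition segre N r (X : set 'rV[K]_N) : set 'rV[K]_(N * r.+1) :=
  [set z | exists v w, [/\ X v, @proj_space K r.+1 w & z = mxvec (v^T *m w)]].

(* The action on the first factor: [xget] recovers a pair (v, w) from its image,
   which determines v and w up to peq. *)
Definition segre_act N r (X : set 'rV[K]_N)
    (act : gT -> 'rV[K]_N -> 'rV[K]_N) (g : gT) (z : 'rV[K]_(N * r.+1)) :
    'rV[K]_(N * r.+1) :=
  let vw := xget (0, 0) [set vw : 'rV[K]_N * 'rV[K]_r.+1 |
    [/\ X vw.1, proj_space vw.2 & z = mxvec (vw.1^T *m vw.2)]] in
  mxvec ((act g vw.1)^T *m vw.2).

Definition stably_linearizable N (X : set 'rV[K]_N)
    (act : gT -> 'rV[K]_N -> 'rV[K]_N) : Prop :=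
  exists r, linearizable (@segre N r X) (@segre_act N r X act).

End Actions.

Section Tori.

Variables (K : fieldType) (n : nat).
Implicit Type T : set 'M[K]_n.

Definition vanishing (F : fieldType) (iota : {rmorphism F -> K}) T :
    set {mpoly F[n * n]} :=
  [set f | forall t, T t -> feval iota f (mxvec t) = 0].

Definition closed_subgroup_SL T : Prop :=
  [/\ forall t, T t -> \det t = 1,
      T 1%:M,
      forall t u, T t -> T u -> T (t *m u),
      forall t, T t -> T (invmx t)
    & forall t, (forall f, vanishing idfun T f -> feval idfun f (mxvec t) = 0)
        -> T t].

(* T is isomorphic, as an algebraic group, to (G_m)^r; regular functions on
   (G_m)^r are polynomials in the coordinates and their inverses. *)
Definition is_torus T : Prop :=
  exists (r : nat) (phi : 'I_n -> 'I_n -> {mpoly K[r + r]})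
         (chi : 'I_r -> {mpoly K[n * n]}),
    let Gm := [set s : 'rV[K]_r | forall k, s 0 k != 0] in
    let Phi s : 'M[K]_n :=
      \matrix_(i, j) feval idfun (phi i j) (row_mx s (map_mx GRing.inv s)) in
    let Chi t : 'rV[K]_r := \row_k feval idfun (chi k) (mxvec t) in
    [/\ forall s, Gm s -> T (Phi s) /\ Chi (Phi s) = s,
        forall t, T t -> Gm (Chi t) /\ Phi (Chi t) = t
      & forall s s', Gm s -> Gm s' ->
          Phi (\row_k (s 0 k * s' 0 k)) = Phi s *m Phi s'].

(* The ideal of T in K[x_ij] is generated by polynomials over F. *)
Definition defined_over (F : fieldType) (iota : {rmorphism F -> K}) T : Prop :=
  forall h, vanishing idfun T h ->
    exists s : seq (K * {mpoly F[n * n]}),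
      (forall cf, cf \in s -> vanishing iota T cf.2) /\
      h = \sum_(cf <- s) cf.1 *: map_mpoly iota cf.2.

(* T = the K-points of a maximal torus over F of SL_n (possibly nonsplit);
   maximality is tested over K. *)
Definition maximal_torus_SL (F : fieldType) (iota : {rmorphism F -> K}) T :
    Prop :=
  [/\ closed_subgroup_SL T, is_torus T, defined_over iota T
    & forall T', closed_subgroup_SL T' -> is_torus T' -> T `<=` T' -> T' = T].

End Tori.

Section Grassmannian.

Variables (K : fieldType) (p n : nat).

Definition incr : {set {ffun 'I_p -> 'I_n}} :=
  [set h : {ffun 'I_p -> 'I_n} |
    [forall i : 'I_p, forall j : 'I_p, (i < j)%N ==> (h i < h j)%N]]%SET.

Definition incr_fun (k : 'I_#|incr|) : {ffun 'I_p -> 'I_n} := enum_val k.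

(* Plucker coordinates of the row space of A *)
Definition plucker (A : 'M[K]_(p, n)) : 'rV[K]_#|incr| :=
  \row_(k < #|incr|) \det (colsub (incr_fun k) A).

(* The p-th exterior power of t, in the basis of the e_h(0) /\ ... /\ e_h(p-1),
   for h in incr. *)
Definition ext_mx (t : 'M[K]_n) : 'M[K]_#|incr| :=
  \matrix_(k < #|incr|) plucker (rowsub (incr_fun k) t).

Definition gr_act (t : 'M[K]_n) (v : 'rV[K]_#|incr|) : 'rV[K]_#|incr| :=
  v *m ext_mx t.

(* The Grassmannian of p-dimensional subspaces of the row space of W, in the
   Plucker embedding of Gr(p, n).  For p > 0 this set is stable under scaling. *)
Definition Gr (W : 'M[K]_n) : set 'rV[K]_#|incr| :=
  [set v | exists A : 'M[K]_(p, n), [/\ row_free A, (A <= W)%MS & v = plucker A]].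

Definition GrV : set 'rV[K]_#|incr| := Gr 1%:M.

Definition orbit_set (T : set 'M[K]_n) (x : 'rV[K]_#|incr|) :
    set 'rV[K]_#|incr| :=
  [set y | exists2 t, T t & peq (gr_act t x) y].

(* The (properly) stable points for the action of T linearized on O(1): there is
   an invariant section f of O(d), d > 0, over F, with f(x) <> 0, such that the
   T-orbits in the (affine) locus where f does not vanish are closed there, and x
   has finite stabilizer.  Sections of O(d) on Gr(p, V) are the restrictions of
   homogeneous polynomials of degree d in the Plucker coordinates. *)
Definition stable_locus (F : fieldType) (iota : {rmorphism F -> K})
    (T : set 'M[K]_n) : set 'rV[K]_#|incr| :=
  [set x | GrV x /\
    exists (d : nat) (f : {mpoly F[#|incr|]}),
      let D := [set y | GrV y /\ feval iota f y != 0] in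
      [/\ (0 < d)%N /\ f \is d.-homog,
          forall t y, T t -> GrV y -> feval iota f (gr_act t y) = feval iota f y,
          feval iota f x != 0,
          forall y, D y -> zariski_closed idfun D (orbit_set T y)
        & finite_set [set t | T t /\ peq (gr_act t x) x]]].

(* pi : X -> Q is a geometric quotient by T, over F. *)
Definition geometric_quotient (F : fieldType) (iota : {rmorphism F -> K})
    (T : set 'M[K]_n) (X : set 'rV[K]_#|incr|) M (Q : set 'rV[K]_M)
    (pi : 'rV[K]_#|incr| -> 'rV[K]_M) : Prop :=
  let preim (B : set 'rV[K]_M) := [set x | X x /\ exists2 y, B y & peq (pi x) y] in
  [/\ regular_map iota X Q pi,
      forall y, Q y -> exists2 x, X x & peq (pi x) y,
      forall x x', X x -> X x' -> (peq (pi x) (pi x') <-> orbit_set T x x'),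
      forall B, B `<=` Q -> (forall y y', B y -> peq y y' -> B y') ->
        (zariski_open iota Q B <-> zariski_open iota X (preim B))
    & forall B h, zariski_open iota Q B ->
        regular_function iota (preim B) h ->
        (forall t x, T t -> preim B x -> h (gr_act t x) = h x) ->
        exists2 h', regular_function iota B h' &
          forall x, X x -> B (pi x) -> h x = h' (pi x)].

(* Gr(p, W) meets some stable T-orbit properly: codim Gr(p, W) = dim T, so the
   expected dimension of the intersection is 0. *)
Definition transverse (F : fieldType) (iota : {rmorphism F -> K})
    (T : set 'M[K]_n) (W : 'M[K]_n) : Prop :=
  exists x, [/\ stable_locus iota T x, (Gr W `&` orbit_set T x) !=set0
    & zariski_dim idfun (Gr W `&` orbit_set T x) 0].

(* pi, defined on X, restricts to a birational map from Z to Q. *)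
Definition rational_section (F : fieldType) (iota : {rmorphism F -> K}) N
    (X Z : set 'rV[K]_N) M (Q : set 'rV[K]_M) (pi : 'rV[K]_N -> 'rV[K]_M) :
    Prop :=
  exists Z0, [/\ dense_open iota Z Z0, Z0 `<=` X & birational_map iota Z0 Q pi].

End Grassmannian.

Arguments Gr {K} p {n} W _.
Arguments GrV {K} p n _.
Arguments gr_act {K} p {n} t v.
Arguments stable_locus {K} p {n F} iota T _.
Arguments transverse {K} p {n F} iota T W.

(* Main.v *)
(* Over K the torus T is conjugate to the diagonal torus, so t in T runs through the
   invertible elements (up to scaling) of an algebra E of dimension n = pm + 1, which is
   defined over F.  For a p-dimensional subspace with basis the rows of A, the condition
   that A t lies in W is a system of pm linear equations in the pm + 1 coordinates of
   t in E.  Its solution is given by the signed maximal minors, which are forms over F in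
   the Plucker coordinates of A; when this solution t(A) is invertible, A t(A) is the only
   point of Gr(p, W) in the T-orbit of A.  By transversality t(A) is invertible for some
   stable A in Gr(p, W): otherwise a second solution u would give a curve A (1 + s u) in
   the intersection of Gr(p, W) with the orbit.  The map A |-> A t(A) is constant
   on orbits, so it descends to the quotient and inverts pi on Gr(p, W). *)

Require Import Defs.
From mathcomp Require Import all_boot all_order all_algebra all_fingroup.
From mathcomp Require Import mxrepresentation.
From mathcomp Require Import mpoly.
From mathcomp Require Import boolp classical_sets cardinality.
From mathcomp Require Import ring.

Set Implicit Arguments.
Unset Strict Implicit.
Unset Printing Implicit Defensive.

Import GRing.Theory.
Local Open Scope ring_scope.
Local Open Scope classical_set_scope.

(** * Forms as functions *)

(** [P] diagonalizes [T] over [K] only, while the equations for [t] need coefficients in [F]. The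
    algebra is the [K]-span of [T], so a linear form vanishing on one vanishes on the other; the
    ideal of [T] being generated over [F], such a form is a combination of linear forms over [F].
    This gives the algebra a basis [e] over [F]. The curve [A (1 + s u)] could collapse to a point.
    This is excluded by the finite stabilizer of a stable point: for nonscalar [u] the matrices
    [1 + s u] are pairwise not proportional. The inverse of [pi] lives over the points where [t(A)]
    is invertible and where one invariant form, taken from the stability of the chosen orbit, does
    not vanish. All of them are stable: closedness of orbits is inherited with the form, and
    uniqueness of [t(A)] leaves only roots of unity in the stabilizer. The quotient is known only
    through open sets and invariant functions, so a map descends through the ratios of its
    coordinates. Equivariance is stated on a domain that [G] may not preserve; freeness and
    linearizations are transported on the intersection of its translates. *)

Section Evaluation.

Variables (F K : fieldType) (iota : {rmorphism F -> K}).

Lemma fevalE N (f : {mpoly F[N]}) (v : 'rV[K]_N) :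
  feval iota f v = \sum_(m <- msupp f) iota f@_m * \prod_i v 0 i ^+ m i.
Proof. by []. Qed.

Lemma feval_homogZ N d (f : {mpoly F[N]}) c (v : 'rV[K]_N) :
  f \is d.-homog -> feval iota f (c *: v) = c ^+ d * feval iota f v.
Proof.
move=> /dhomogP hf; rewrite !fevalE mulr_sumr big_seq [RHS]big_seq.
apply: eq_bigr => m /hf /= <-.
rewrite mulrCA; congr (_ * _).
rewrite (eq_bigr (fun i => c ^+ m i * v 0 i ^+ m i)); last first.
  by move=> i _; rewrite mxE exprMn.
by rewrite big_split /= prodrXr mdegE.
Qed.

Section FunctionRing.

Variables (A : Type) (C : (A -> K) -> Prop).
Hypothesis Ccst : forall c, C (fun=> c).
Hypothesis CD : forall f g, C f -> C g -> C (fun a => f a + g a).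
Hypothesis CM : forall f g, C f -> C g -> C (fun a => f a * g a).

(** [C] is any class of functions containing the constants and closed under sums and products. The
    instances used later are polynomials in one parameter, Laurent polynomials away from 0, and
    polynomial functions on row vectors. *)
Lemma funring_sum (I : Type) (r : seq I) (P : pred I) (f : I -> A -> K) :
  (forall i, C (f i)) -> C (fun a => \sum_(i <- r | P i) f i a).
Proof.
move=> Cf; elim: r => [|i r IH].
  rewrite (_ : (fun _ => _) = fun=> 0); first exact: Ccst.
  by apply: funext => a; rewrite big_nil.
case Pi: (P i).
  rewrite (_ : (fun _ => _) = fun a => f i a + \sum_(i <- r | P i) f i a).
    exact: CD.
  by apply: funext => a; rewrite big_cons Pi.
rewrite (_ : (fun _ => _) = fun a => \sum_(i <- r | P i) f i a) //.
by apply: funext => a; rewrite big_cons Pi.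
Qed.

Lemma funring_prod (I : Type) (r : seq I) (P : pred I) (f : I -> A -> K) :
  (forall i, C (f i)) -> C (fun a => \prod_(i <- r | P i) f i a).
Proof.
move=> Cf; elim: r => [|i r IH].
  rewrite (_ : (fun _ => _) = fun=> 1); first exact: Ccst.
  by apply: funext => a; rewrite big_nil.
case Pi: (P i).
  rewrite (_ : (fun _ => _) = fun a => f i a * \prod_(i <- r | P i) f i a).
    exact: CM.
  by apply: funext => a; rewrite big_cons Pi.
rewrite (_ : (fun _ => _) = fun a => \prod_(i <- r | P i) f i a) //.
by apply: funext => a; rewrite big_cons Pi.
Qed.

Lemma funring_exp k (f : A -> K) : C f -> C (fun a => f a ^+ k).
Proof.
move=> Cf; elim: k => [|k IH].
  by rewrite (_ : (fun _ => _) = fun=> 1) //; apply: funext => a; rewrite expr0.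
rewrite (_ : (fun _ => _) = fun a => f a * f a ^+ k); first exact: CM.
by apply: funext => a; rewrite exprS.
Qed.

Lemma funring_feval N (f : {mpoly F[N]}) (v : A -> 'rV[K]_N) :
  (forall i, C (fun a => v a 0 i)) -> C (fun a => feval iota f (v a)).
Proof.
move=> Cv; apply: funring_sum => m; apply: CM => //.
by apply: funring_prod => i; apply: funring_exp.
Qed.

Lemma funring_det n (M : A -> 'M[K]_n) :
  (forall i j, C (fun a => M a i j)) -> C (fun a => \det (M a)).
Proof.
move=> CMM; rewrite /determinant; apply: funring_sum => s; apply: CM => //.
by apply: funring_prod => i.
Qed.

Lemma funring_mulmx m n q (M : A -> 'M[K]_(m, n)) (M' : A -> 'M[K]_(n, q)) :
  (forall i j, C (fun a => M a i j)) -> (forall i j, C (fun a => M' a i j)) ->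
  forall i j, C (fun a => (M a *m M' a) i j).
Proof.
move=> CMM CM' i j.
rewrite (_ : (fun _ => _) = fun a => \sum_k M a i k * M' a k j).
  by apply: funring_sum => k; apply: CM.
by apply: funext => a; rewrite mxE.
Qed.

End FunctionRing.

(** Forms enter as functions on [K]-points, so that determinants, matrix products and compositions
    are forms by closure properties, with no explicit polynomial. The coefficients stay in [F], as
    the Zariski topology over [F] requires. *)
Definition formfun N d (phi : 'rV[K]_N -> K) : Prop :=
  exists2 f : {mpoly F[N]}, f \is d.-homog & feval iota f =1 phi.

Section FormFun.

Variable N : nat.
Implicit Types (phi psi : 'rV[K]_N -> K).

Lemma formfun_ext d phi psi : phi =1 psi -> formfun d phi -> formfun d psi.
Proof. by move=> e [f hf ef]; exists f => // v; rewrite ef e. Qed.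

Lemma formfun_feval d (f : {mpoly F[N]}) :
  f \is d.-homog -> formfun d (feval iota f).
Proof. by exists f. Qed.

Lemma formfun_cst c : formfun 0 (fun _ : 'rV[K]_N => iota c).
Proof.
exists (c%:MP); last by move=> v; rewrite /feval mmapC.
by rewrite -[c%:MP]mulr1 mul_mpolyC dhomogZ ?dhomog1.
Qed.

Lemma formfun0 d : formfun d (fun _ : 'rV[K]_N => 0).
Proof. by exists 0; [exact: dhomog0 | move=> v; rewrite /feval mmap0]. Qed.

Lemma formfun1 : formfun 0 (fun _ : 'rV[K]_N => 1).
Proof. by apply: formfun_ext (formfun_cst 1) => v; rewrite rmorph1. Qed.

Lemma formfun_coord j : formfun 1 (fun v : 'rV[K]_N => v 0 j).
Proof.
exists 'X_j; first by rewrite dhomogX /= mdeg1.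
by move=> v; rewrite /feval mmapX mmap1U.
Qed.

Lemma formfunD d phi psi :
  formfun d phi -> formfun d psi -> formfun d (fun v => phi v + psi v).
Proof.
move=> [f hf ef] [g hg eg]; exists (f + g); first exact: dhomogD.
by move=> v; rewrite /feval mmapD -ef -eg.
Qed.

Lemma formfunM d e phi psi :
  formfun d phi -> formfun e psi -> formfun (d + e) (fun v => phi v * psi v).
Proof.
move=> [f hf ef] [g hg eg]; exists (f * g); first exact: dhomogM.
by move=> v; rewrite /feval rmorphM -ef -eg.
Qed.

Lemma formfunZ d c phi : formfun d phi -> formfun d (fun v => iota c * phi v).
Proof. by move=> h; rewrite -(add0n d); apply: formfunM => //; exact: formfun_cst. Qed.

Lemma formfunN d phi : formfun d phi -> formfun d (fun v => - phi v).
Proof.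
move=> /(formfunZ (-1)); apply: formfun_ext => v.
by rewrite rmorphN rmorph1 mulN1r.
Qed.

Lemma formfun_sum d (I : eqType) (r : seq I) (P : pred I) (phi : I -> 'rV[K]_N -> K) :
  (forall i, i \in r -> P i -> formfun d (phi i)) ->
  formfun d (fun v => \sum_(i <- r | P i) phi i v).
Proof.
elim: r => [|i r IH] h.
  by apply: formfun_ext (formfun0 d) => v; rewrite big_nil.
have {}IH : formfun d (fun v => \sum_(i <- r | P i) phi i v).
  by apply: IH => j jr; apply: h; rewrite inE jr orbT.
case Pi: (P i).
  have := formfunD (h i (mem_head _ _) Pi) IH.
  by apply: formfun_ext => v; rewrite big_cons Pi.
by apply: formfun_ext IH => v; rewrite big_cons Pi.
Qed.

Lemma formfun_prod (I : Type) (r : seq I) (P : pred I) (d : I -> nat)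
    (phi : I -> 'rV[K]_N -> K) :
  (forall i, P i -> formfun (d i) (phi i)) ->
  formfun (\sum_(i <- r | P i) d i) (fun v => \prod_(i <- r | P i) phi i v).
Proof.
move=> h; elim: r => [|i r IH].
  by rewrite big_nil; apply: formfun_ext formfun1 => v; rewrite big_nil.
rewrite big_cons; case Pi: (P i).
  have := formfunM (h i Pi) IH.
  by apply: formfun_ext => v; rewrite big_cons Pi.
by apply: formfun_ext IH => v; rewrite big_cons Pi.
Qed.

Lemma formfun_exp d k phi : formfun d phi -> formfun (k * d) (fun v => phi v ^+ k).
Proof.
move=> h; elim: k => [|k IH].
  by apply: formfun_ext formfun1 => v; rewrite expr0.
rewrite mulSn; have := formfunM h IH.
by apply: formfun_ext => v; rewrite exprS.
Qed.

Lemma formfun_det d n (M : 'rV[K]_N -> 'M[K]_n) :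
  (forall i j, formfun d (fun v => M v i j)) -> formfun (n * d) (fun v => \det (M v)).
Proof.
move=> h; apply: formfun_sum => s _ _.
rewrite -[(n * d)%N]add0n; apply: formfunM.
  case: (odd_perm s); rewrite ?expr1 ?expr0; last exact: formfun1.
  exact/formfunN/formfun1.
have -> : (n * d = \sum_(i < n) d)%N by rewrite sum_nat_const card_ord.
by apply: formfun_prod => i _; apply: h.
Qed.

Lemma formfun_mulmx d e a b c (M : 'rV[K]_N -> 'M[K]_(a, b)) (M' : 'rV[K]_N -> 'M[K]_(b, c)) :
  (forall i j, formfun d (fun v => M v i j)) ->
  (forall i j, formfun e (fun v => M' v i j)) ->
  forall i j, formfun (d + e) (fun v => (M v *m M' v) i j).
Proof.
move=> hM hM' i j.
have : formfun (d + e) (fun v => \sum_k M v i k * M' v k j).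
  by apply: formfun_sum => k _ _; apply: formfunM.
by apply: formfun_ext => v; rewrite mxE.
Qed.

Lemma formfun_scale d phi c v : formfun d phi -> phi (c *: v) = c ^+ d * phi v.
Proof. by move=> [f hf ef]; rewrite -!ef (feval_homogZ _ _ hf). Qed.

End FormFun.

Lemma formfun_comp M N d e (phi : 'rV[K]_M -> K) (psi : 'rV[K]_N -> 'rV[K]_M) :
  formfun d phi -> (forall j, formfun e (fun v => psi v 0 j)) ->
  formfun (d * e) (fun v => phi (psi v)).
Proof.
move=> [f /dhomogP hf ef] hpsi.
have : formfun (d * e) (fun v => feval iota f (psi v)).
  apply: formfun_sum => m /hf /= <- _.
  rewrite mdegE big_distrl /=.
  apply: (@formfunM _ 0); first exact: formfun_cst.
  by apply: formfun_prod => i _; apply: formfun_exp.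
by apply: formfun_ext => v; rewrite ef.
Qed.

End Evaluation.

(** * Zariski topology and regular maps *)

Section ProjectiveEquality.

Variables (K : fieldType) (N : nat).
Implicit Types v w u : 'rV[K]_N.

Lemma peq_refl v : peq v v.
Proof. by exists 1; rewrite ?oner_eq0 ?scale1r. Qed.

Lemma peqZ c v : c != 0 -> peq v (c *: v).
Proof. by exists c. Qed.

Lemma peq_sym v w : peq v w -> peq w v.
Proof.
by move=> [c c0 ->]; exists c^-1; rewrite ?invr_eq0 // scalerA mulVf ?scale1r.
Qed.

Lemma peq_trans v w u : peq v w -> peq w u -> peq v u.
Proof.
by move=> [c c0 ->] [d d0 ->]; exists (d * c); rewrite ?mulf_neq0 // scalerA.
Qed.

Lemma peq_neq0 v w : peq v w -> v != 0 -> w != 0.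
Proof. by move=> [c c0 ->] v0; rewrite scaler_eq0 negb_or c0. Qed.

Lemma row_neq0_ex v : v != 0 -> exists j, v 0 j != 0.
Proof.
move=> v0; apply/existsP; apply: contraNT v0; rewrite negb_exists => /forallP h.
by apply/eqP/rowP => j; rewrite mxE; apply/eqP; rewrite -[_ == _]negbK.
Qed.

Lemma coord_neq0 v j : v 0 j != 0 -> v != 0.
Proof. by apply: contraNneq => ->; rewrite mxE. Qed.

Lemma peq_coord v w j : peq v w -> v 0 j != 0 -> w 0 j != 0.
Proof. by move=> [c c0 ->] v0; rewrite mxE mulf_neq0. Qed.

Lemma peq_minors v w : v != 0 -> w != 0 ->
  (forall i j, v 0 i * w 0 j = v 0 j * w 0 i) -> peq v w.
Proof.
move=> /row_neq0_ex[j vj] w0 h.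
have E : w = (w 0 j / v 0 j) *: v.
  by apply/rowP => i; rewrite mxE mulrAC [w 0 j * _]mulrC h mulrAC mulfV ?mul1r.
exists (w 0 j / v 0 j) => //.
by apply: contraNneq w0 => c0; rewrite E c0 scale0r.
Qed.

Definition cone (X : set 'rV[K]_N) : Prop :=
  (forall v, X v -> v != 0) /\ (forall v w, X v -> peq v w -> X w).

Lemma cone_proj_space : cone (@proj_space K N).
Proof. by split=> // v w v0 vw; apply: peq_neq0 vw v0. Qed.

End ProjectiveEquality.

Section Zariski.

Variables (F K : fieldType) (iota : {rmorphism F -> K}).

Local Notation zopen := (zariski_open iota).
Local Notation form := (formfun iota).

(** Around each point one form suffices. Conversely, the family [S] of the definition can be taken
    to be all forms whose nonvanishing locus in [X] lies in [U]. *)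
Lemma zopenP N (X U : set 'rV[K]_N) :
  zopen X U <->
  U `<=` X /\ forall x, U x -> exists d phi,
    [/\ form d phi, phi x != 0 & forall w, X w -> phi w != 0 -> U w].
Proof.
split=> [[S [hS ->]]|[UX hU]].
  split=> [x []//|x [Xx [f Sf fx]]].
  have [d hd] := hS _ Sf.
  exists d, (feval iota f); split=> //; first exact: formfun_feval.
  by move=> w Xw fw; split=> //; exists f.
exists [set f | (exists d, f \is d.-homog) /\
          forall w, X w -> feval iota f w != 0 -> U w]; split=> [f []//|].
apply/seteqP; split=> x /=.
  move=> Ux; split; first exact: UX.
  have [d [phi [[f hf ef] fx h]]] := hU x Ux.
  exists f; last by rewrite ef.
  by split; [exists d | move=> w Xw; rewrite ef; apply: h].
by move=> [Xx [f [_ hf] fx]]; apply: hf.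
Qed.

Lemma zopen_sub N (X U : set 'rV[K]_N) : zopen X U -> U `<=` X.
Proof. by case/zopenP. Qed.

Lemma zopen_cone N (X U : set 'rV[K]_N) : cone X -> zopen X U -> cone U.
Proof.
move=> [X0 cX] /zopenP [UX hU]; split=> [v /UX /X0 //|v w Uv vw].
have [d [phi [hphi pv h]]] := hU v Uv.
apply: h; first exact: cX (UX _ Uv) vw.
case: vw => c c0 ->; rewrite (formfun_scale _ _ hphi).
by rewrite mulf_neq0 // expf_neq0.
Qed.

Lemma zopen_full N (X : set 'rV[K]_N) : zopen X X.
Proof.
apply/zopenP; split=> // x Xx; exists 0%N, (fun=> 1).
by split=> //; [exact: formfun1 | exact: oner_neq0].
Qed.

Lemma zopen_form N (X : set 'rV[K]_N) d phi :
  form d phi -> zopen X [set x | X x /\ phi x != 0].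
Proof.
move=> h; apply/zopenP; split=> [x []//|x [Xx px]].
by exists d, phi; split.
Qed.

Lemma zopenI N (X U V : set 'rV[K]_N) : zopen X U -> zopen X V -> zopen X (U `&` V).
Proof.
move=> /zopenP[UX hU] /zopenP[VX hV]; apply/zopenP; split=> [x [/UX]//|x [Ux Vx]].
have [d [phi [h1 h2 h3]]] := hU x Ux; have [e [psi [k1 k2 k3]]] := hV x Vx.
exists (d + e)%N, (fun w => phi w * psi w); split.
- exact: formfunM.
- by rewrite mulf_neq0.
- by move=> w Xw; rewrite mulf_eq0 negb_or => /andP[? ?]; split; auto.
Qed.

Lemma zopen_trans N (X U V : set 'rV[K]_N) : zopen X U -> zopen U V -> zopen X V.
Proof.
move=> /zopenP[UX hU] /zopenP[VU hV]; apply/zopenP; split=> [x /VU /UX//|x Vx].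
have [d [phi [h1 h2 h3]]] := hU x (VU _ Vx).
have [e [psi [k1 k2 k3]]] := hV x Vx.
exists (d + e)%N, (fun w => phi w * psi w); split.
- exact: formfunM.
- by rewrite mulf_neq0.
- by move=> w Xw; rewrite mulf_eq0 negb_or => /andP[? ?]; auto.
Qed.

Lemma zopen_restr N (X U V : set 'rV[K]_N) : U `<=` X -> zopen X V -> zopen U (U `&` V).
Proof.
move=> UX /zopenP[VX hV]; apply/zopenP; split=> [x []//|x [Ux Vx]].
have [e [psi [k1 k2 k3]]] := hV x Vx.
by exists e, psi; split=> // w Uw pw; split=> //; apply: k3 => //; apply: UX.
Qed.

Lemma dense_openI N (X U V : set 'rV[K]_N) :
  dense_open iota X U -> dense_open iota X V -> dense_open iota X (U `&` V).
Proof.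
move=> [oU dU] [oV dV]; split; first exact: zopenI.
move=> O oO /(dU O oO) OU; rewrite setIA; apply: dV => //; exact: zopenI.
Qed.

Lemma dense_open_full N (X : set 'rV[K]_N) : dense_open iota X X.
Proof.
by split=> [|O oO [x Ox]]; [exact: zopen_full | exists x; split=> //; exact: zopen_sub oO x Ox].
Qed.

Lemma dense_open_trans N (X U V : set 'rV[K]_N) :
  dense_open iota X U -> dense_open iota U V -> dense_open iota X V.
Proof.
move=> [oU dU] [oV dV]; split; first exact: zopen_trans oV.
move=> O oO /(dU O oO) OU.
have oUO : zopen U (U `&` O) by apply: zopen_restr oO; exact: zopen_sub oU.
have [|x [[Ux Ox] Vx]] := dV _ oUO; first by rewrite setIC.
by exists x.
Qed.

Lemma dense_open_bigcap N (X : set 'rV[K]_N) (I : finType) (U : I -> set 'rV[K]_N) :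
  (forall i, dense_open iota X (U i)) ->
  dense_open iota X [set x | X x /\ forall i, U i x].
Proof.
move=> dU.
suff h (s : seq I) : dense_open iota X [set x | X x /\ forall i, i \in s -> U i x].
  rewrite (_ : [set x | _] = [set x | X x /\ forall i, i \in enum I -> U i x]) //.
  apply/seteqP; split=> x [Xx h']; split=> // i.
  by apply: h'; rewrite mem_enum.
elim: s => [|i s IH].
  rewrite (_ : [set x | _] = X); first exact: dense_open_full.
  by apply/seteqP; split=> x //= [].
rewrite (_ : [set x | _] = U i `&` [set x | X x /\ forall i, i \in s -> U i x]).
  exact: dense_openI.
apply/seteqP; split=> x /=.
  move=> [Xx h]; split; first by apply: h; rewrite mem_head.
  by split=> // j js; apply: h; rewrite inE js orbT.
move=> [Ux [Xx h]]; split=> // j; rewrite inE => /orP[/eqP->//|]; exact: h.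
Qed.

Lemma regular_mapE N M (X : set 'rV[K]_N) (Y : set 'rV[K]_M) f :
  regular_map iota X Y f -> forall v, X v ->
  exists d (s : 'rV[K]_N -> 'rV[K]_M),
    [/\ forall j, form d (fun v => s v 0 j), s v != 0
      & forall w, X w -> s w != 0 -> peq (s w) (f w)].
Proof.
move=> hf v Xv; have [_ [d [s /= [h1 h2 h3]]]] := hf v Xv.
exists d, (fun w => \row_j feval iota (s j) w); split=> // j.
by apply: formfun_ext (formfun_feval iota (h1 j)) => w; rewrite mxE.
Qed.

(** [regular_map] demands agreement with [f] wherever the local forms do not all vanish. Multiplying
    [s] by a form [phi] shrinks that locus, so the formulas only have to be right where [phi] is
    nonzero. *)
Lemma regular_map_local N M (X : set 'rV[K]_N) (Y : set 'rV[K]_M) f :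
  (forall v, X v -> Y (f v)) ->
  (forall v, X v -> exists e phi d (s : 'rV[K]_N -> 'rV[K]_M),
    [/\ form e phi, forall j, form d (fun v => s v 0 j), phi v != 0
      & forall w, X w -> phi w != 0 -> s w != 0 /\ peq (s w) (f w)]) ->
  regular_map iota X Y f.
Proof.
move=> hY h v Xv; split; first exact: hY.
have [e [phi [d [s [h1 h2 h3 h4]]]]] := h v Xv.
have /choice[t ht] : forall j, exists g : {mpoly F[N]},
    g \is (e + d).-homog /\ feval iota g =1 (fun w => phi w * s w 0 j).
  by move=> j; have [g hg eg] := formfunM h1 (h2 j); exists g.
exists (e + d)%N, t => /=.
have E w : \row_j feval iota (t j) w = phi w *: s w.
  by apply/rowP => j; rewrite !mxE (ht j).2.
split=> [j||w Xw]; first exact: (ht j).1.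
  by rewrite E scaler_eq0 negb_or h3; case: (h4 v Xv h3).
rewrite E scaler_eq0 negb_or => /andP[p0 s0].
by apply: peq_trans (h4 w Xw p0).2; apply/peq_sym/peqZ.
Qed.

Lemma regular_map_in N M (X : set 'rV[K]_N) (Y : set 'rV[K]_M) f v :
  regular_map iota X Y f -> X v -> Y (f v).
Proof. by move=> h /h[]. Qed.

Lemma regular_map_neq0 N M (X : set 'rV[K]_N) (Y : set 'rV[K]_M) f v :
  regular_map iota X Y f -> X v -> f v != 0.
Proof.
move=> hf Xv; have [d [s [_ s0 h]]] := regular_mapE hf Xv.
exact: peq_neq0 (h v Xv s0) s0.
Qed.

Lemma regular_map_peq N M (X : set 'rV[K]_N) (Y : set 'rV[K]_M) f v w :
  cone X -> regular_map iota X Y f -> X v -> peq v w -> peq (f v) (f w).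
Proof.
move=> [_ cX] hf Xv vw; have [d [s [hs s0 h]]] := regular_mapE hf Xv.
have Xw := cX _ _ Xv vw.
have sw : peq (s v) (s w).
  case: vw => c c0 ->; exists (c ^+ d); first by rewrite expf_neq0.
  by apply/rowP => j; rewrite [RHS]mxE (formfun_scale _ _ (hs j)).
apply: peq_trans (peq_sym (h v Xv s0)) _.
by apply: (peq_trans sw); apply: h => //; apply: peq_neq0 s0.
Qed.

Lemma regular_map_restr N M (X X' : set 'rV[K]_N) (Y Y' : set 'rV[K]_M) f :
  regular_map iota X Y f -> X' `<=` X -> (forall v, X' v -> Y' (f v)) ->
  regular_map iota X' Y' f.
Proof.
move=> hf XX h v Xv; split; first exact: h.
have [_ [d [s [h1 h2 h3]]]] := hf v (XX _ Xv).
by exists d, s; split=> // w Xw; apply: h3; apply: XX.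
Qed.

Lemma regular_map_comp N M L (X : set 'rV[K]_N) (Y : set 'rV[K]_M) (Z : set 'rV[K]_L) f g :
  cone Y -> regular_map iota X Y f -> regular_map iota Y Z g ->
  regular_map iota X Z (g \o f).
Proof.
move=> cY hf hg; apply: regular_map_local => [v Xv|v Xv].
  exact/(regular_map_in hg)/(regular_map_in hf).
have Yf := regular_map_in hf Xv.
have [d [s [hs s0 h]]] := regular_mapE hf Xv.
have [e [t [ht t0 k]]] := regular_mapE hg Yf.
have [j sj] := row_neq0_ex s0.
have [i ti] := row_neq0_ex t0.
have E w : X w -> s w != 0 -> peq (t (s w)) (t (f w)).
  move=> Xw /(h w Xw)[c c0 ->]; exists (c ^+ e); first by rewrite expf_neq0.
  by apply/rowP => l; rewrite [RHS]mxE (formfun_scale _ _ (ht l)).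
(* Where coordinate [j] of [s w] is nonzero, [s w] represents [f w]; where coordinate [i] of
   [t (s w)] is nonzero, [t] represents [g] there. *)
exists (d + e * d)%N, (fun w => s w 0 j * t (s w) 0 i), (e * d)%N, (fun w => t (s w)).
have hts l : form (e * d) (fun w => t (s w) 0 l) by exact: (formfun_comp (ht l) hs).
split=> // [||w Xw].
- exact: formfunM.
- rewrite mulf_neq0 //.
  by apply: peq_coord ti; apply/peq_sym/E.
- rewrite mulf_eq0 negb_or => /andP[sw tw].
  have t0w := coord_neq0 tw; split=> //.
  have Etw := E w Xw (coord_neq0 sw).
  apply: (peq_trans Etw); apply: k; first exact: regular_map_in hf Xw.
  exact: peq_neq0 Etw t0w.
Qed.

Lemma regular_map_preimage N M (X : set 'rV[K]_N) (Y U : set 'rV[K]_M) f :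
  cone Y -> regular_map iota X Y f -> zopen Y U ->
  zopen X [set v | X v /\ U (f v)].
Proof.
move=> cY hf /zopenP[UY hU]; apply/zopenP; split=> [v []//|v [Xv Uf]].
have [e [phi [k1 k2 k3]]] := hU _ Uf.
have [d [s [hs s0 h]]] := regular_mapE hf Xv.
have [j sj] := row_neq0_ex s0.
have E w : X w -> s w != 0 -> (phi (s w) != 0) = (phi (f w) != 0).
  move=> Xw /(h w Xw)[c c0 ->]; rewrite (formfun_scale _ _ k1).
  by rewrite [in RHS]mulf_eq0 expf_eq0 (negPf c0) andbF.
exists (d + e * d)%N, (fun w => s w 0 j * phi (s w)); split.
- by apply: formfunM => //; apply: formfun_comp.
- by rewrite mulf_neq0 // E.
- move=> w Xw; rewrite mulf_eq0 negb_or => /andP[/coord_neq0 sw pw].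
  by split=> //; apply: k3; [exact: regular_map_in hf Xw | rewrite -E].
Qed.

Lemma regular_map_coord_open N M (X : set 'rV[K]_N) (Y : set 'rV[K]_M) f j :
  regular_map iota X Y f -> zopen X [set v | X v /\ f v 0 j != 0].
Proof.
move=> hf.
have hf' : regular_map iota X (@proj_space K M) f.
  apply: (regular_map_restr hf) => // v; exact: regular_map_neq0 hf.
have := regular_map_preimage (@cone_proj_space K M) hf'
  (zopen_form (@proj_space K M) (formfun_coord iota j)).
congr (zariski_open _ _ _); apply/seteqP; split=> v /= [Xv]; first by case.
by split=> //; split=> //; exact: regular_map_neq0 hf Xv.
Qed.

Section BirationalMaps.

Variables (N M : nat) (X U : set 'rV[K]_N) (Y U' : set 'rV[K]_M).
Variables (f : 'rV[K]_N -> 'rV[K]_M) (g : 'rV[K]_M -> 'rV[K]_N).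
Hypotheses (cX : cone X) (cY : cone Y).
Hypothesis fg : birational_between iota X U Y U' f g.

Lemma birational_between_sym : birational_between iota Y U' X U g f.
Proof. by case: fg => [[? ?] ? ? ? ?]; split. Qed.

Lemma birational_between_restr V : dense_open iota X V ->
  birational_between iota X (U `&` V) Y [set y | U' y /\ V (g y)] f g.
Proof.
case: fg => [[dU dU'] hf hg e1 e2] dV.
have cU := zopen_cone cX dU.1; have cU' := zopen_cone cY dU'.1.
have cV := zopen_cone cX dV.1.
have dUV := dense_openI dU dV.
split.
- split=> //; apply: (dense_open_trans dU').
  have oUV : zopen U (U `&` V) by apply: zopen_restr dV.1; exact: zopen_sub dU.1.
  have o : zopen U' [set y | U' y /\ V (g y)].
    have := regular_map_preimage cU hg oUV; congr (zariski_open _ _ _).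
    apply/seteqP; split=> y /= [U'y]; first by case.
    by split=> //; split=> //; exact: regular_map_in hg U'y.
  (* Density of the smaller target: [O] is pulled back along [f] to an open set, which meets [V],
     and [f] carries the common point into [O]. *)
  split=> // O oO [y Oy].
  have oO' := regular_map_preimage cU' hf oO.
  have [|x [[Ux Ox] Vx]] := dV.2 _ (zopen_trans dU.1 oO').
    have U'y := zopen_sub oO Oy; exists (g y); split; first exact: regular_map_in hg U'y.
    exact: (zopen_cone cU' oO).2 Oy (peq_sym (e2 _ U'y)).
  exists (f x); split=> //; split; first exact: regular_map_in hf Ux.
  exact: cV.2 Vx (peq_sym (e1 _ Ux)).
- apply: (regular_map_restr hf) => [v []//|v [Uv Vv]].
  split; first exact: regular_map_in hf Uv.
  exact: cV.2 Vv (peq_sym (e1 _ Uv)).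
- apply: (regular_map_restr hg) => [v []//|v [Uv Vv]].
  by split=> //; exact: regular_map_in hg Uv.
- by move=> x [Ux _]; apply: e1.
- by move=> y [Uy _]; apply: e2.
Qed.

End BirationalMaps.

Lemma birational_between_trans N M L (X U : set 'rV[K]_N) (Y U' V : set 'rV[K]_M)
    (Z V' : set 'rV[K]_L) f g f' g' :
  cone X -> cone Y -> cone Z ->
  birational_between iota X U Y U' f g -> birational_between iota Y V Z V' f' g' ->
  birational_between iota X [set x | U x /\ V (f x)] Z [set z | V' z /\ U' (g' z)]
    (f' \o f) (g \o g').
Proof.
move=> cX cY cZ b1 b2.
have [[dU dU'] hf hg e1 e2] := b1; have [[dV dV'] hf' hg' e1' e2'] := b2.
have [[_ d1] h1 h1' _ _] :=
  birational_between_restr cY cX (birational_between_sym b1) dV.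
have [[_ d2] h2 h2' _ _] := birational_between_restr cY cZ b2 dU'.
have cU := zopen_cone cX dU.1; have cU' := zopen_cone cY dU'.1.
have cV := zopen_cone cY dV.1; have cV' := zopen_cone cZ dV'.1.
have cUV : cone (U' `&` V).
  by apply: (zopen_cone cY); apply: zopenI; [exact: dU'.1|exact: dV.1].
split=> //.
- apply: regular_map_comp cUV _ _; first exact: h1'.
  by rewrite setIC.
- apply: (regular_map_comp cUV); first by move: h2'; rewrite setIC.
  exact: h1.
- move=> x [Ux Vfx] /=; apply: peq_trans (e1 _ Ux).
  apply: (regular_map_peq cU' hg); last exact: e1'.
  by apply: cU'.2 (peq_sym (e1' _ Vfx)); exact: regular_map_in hf Ux.
- move=> z [V'z U'gz] /=; apply: peq_trans (e2' _ V'z).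
  apply: (regular_map_peq cV hf'); last exact: e2.
  by apply: cV.2 (peq_sym (e2 _ U'gz)); exact: regular_map_in hg' V'z.
Qed.

End Zariski.

(** * Maximal minors and the Cauchy-Binet formula *)

Section MaximalMinors.

Variables (K : fieldType) (k : nat).
Implicit Types (N : 'M[K]_(k.+1, k)) (x y : 'rV[K]_k.+1).

Definition signed_minors N : 'rV[K]_k.+1 := \row_i ((-1) ^+ i * \det (row' i N)).

Lemma mulmx_row' N x i : x 0 i = 0 -> x *m N = col' i x *m row' i N.
Proof.
move=> xi; apply/rowP => j; rewrite !mxE (bigD1_ord i) //= xi mul0r add0r.
by apply: eq_bigr => l _; rewrite !mxE.
Qed.

(* Laplace expansion of [N_j | N], which has a repeated column. *)
Lemma signed_minors_ker N : signed_minors N *m N = 0.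
Proof.
apply/rowP => j; rewrite !mxE.
pose B : 'M[K]_(k.+1) := \matrix_(a, b) oapp (N a) (N a j) (unlift ord0 b).
transitivity (\det B); last first.
  rewrite -det_tr; apply: (@determinant_alternate _ _ _ ord0 (lift ord0 j)).
    exact: neq_lift.
  by move=> a; rewrite !mxE unlift_none liftK.
rewrite (expand_det_col _ ord0); apply: eq_bigr => i _.
rewrite mxE [RHS]mulrC /cofactor addn0 [B i _]mxE unlift_none /=.
congr (_ * \det _ * _); apply/matrixP => a b.
by rewrite !mxE liftK.
Qed.

(** Subtracting the multiple of [s] that agrees with [x] at a coordinate [i] where [s] is nonzero
    leaves a kernel vector with 0 at [i]; the minor without row [i] is invertible, which kills the
    other coordinates. *)
Lemma signed_minors_span N x :
  signed_minors N != 0 -> x *m N = 0 -> exists a, x = a *: signed_minors N.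
Proof.
set s := signed_minors N => s0 xN; have [i si] := row_neq0_ex s0.
exists (x 0 i / s 0 i); apply/eqP; rewrite -subr_eq0; apply/eqP.
set y := _ - _.
have yi : y 0 i = 0 by rewrite !mxE; move: si; rewrite mxE => si; rewrite mulfVK ?subrr.
have : y *m N = 0 by rewrite mulmxBl -scalemxAl signed_minors_ker xN scaler0 subrr.
rewrite (mulmx_row' _ yi) => /(congr1 (mulmx^~ (invmx (row' i N)))).
have u : row' i N \in unitmx.
  by move: si; rewrite mxE mulf_eq0 negb_or unitmxE unitfE => /andP[].
rewrite mul0mx mulmxK // => y'.
apply/rowP => j; rewrite [RHS]mxE; case: (unliftP i j) => [l ->|->//].
by have := congr1 (fun M : 'rV_k => M 0 l) y'; rewrite !mxE.
Qed.

(** Take [i] with [x 0 i] nonzero. If the minor without row [i] vanished, a kernel vector of that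
    submatrix, extended by 0 at [i], would be a multiple of [x] with zero coordinate [i], hence
    0. *)
Lemma signed_minors_neq0 N x :
  x != 0 -> (forall y, y *m N = 0 -> exists a, y = a *: x) -> signed_minors N != 0.
Proof.
move=> x0 hx; have [i xi] := row_neq0_ex x0.
apply: (@coord_neq0 _ _ _ i); rewrite mxE mulf_neq0 ?signr_eq0 //.
apply/det0P => -[z z0 zN].
pose y : 'rV[K]_k.+1 := \row_j oapp (z 0) 0 (unlift i j).
have yi : y 0 i = 0 by rewrite mxE unlift_none.
have zE : col' i y = z by apply/rowP => l; rewrite !mxE liftK.
have [a ya] : exists a, y = a *: x by apply: hx; rewrite (mulmx_row' _ yi) zE.
move: yi; rewrite ya mxE => /eqP; rewrite mulf_eq0 (negPf xi) orbF => /eqP a0.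
by move: z0; rewrite -zE ya a0 scale0r raddf0 eqxx.
Qed.

End MaximalMinors.

Section Increasing.

Variables p n : nat.
Implicit Types (k l : 'I_#|incr p n|) (s : 'S_p).

Lemma incr_fun_lt k (i j : 'I_p) : (i < j)%N -> (incr_fun k i < incr_fun k j)%N.
Proof.
move=> ij; have := enum_valP k; rewrite inE => /forallP/(_ i)/forallP/(_ j).
by rewrite ij.
Qed.

Lemma incr_fun_inj k : injective (incr_fun k).
Proof.
move=> i j e; apply/val_inj/eqP; case: ltngtP => // /(incr_fun_lt k).
  by rewrite e ltnn.
by rewrite e ltnn.
Qed.

(** Sorting the image gives [k], and [s i] is the position of [phi i] in the sorted list. *)
Lemma sort_injective (phi : 'I_p -> 'I_n) : injective phi ->
  exists k s, forall i, phi i = incr_fun k (s i).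
Proof.
move=> inj; pose r := sort (relpre val leq) (codom phi).
have sr : size r = p by rewrite size_sort size_codom card_ord.
have ur : uniq r by rewrite sort_uniq; apply/injectiveP.
have tot : total (relpre (@nat_of_ord n) leq) by move=> a b; exact: leq_total.
have sorr : sorted (relpre (@nat_of_ord n) ltn) r.
  have := sort_sorted tot (codom phi).
  rewrite -/r -!sorted_map ltn_sorted_uniq_leq => ->.
  by rewrite map_inj_uniq ?ur //; exact: val_inj.
have lt (i : 'I_p) : (index (phi i) r < p)%N.
  have : (index (phi i) r < size r)%N by rewrite index_mem mem_sort codom_f.
  by rewrite sr.
pose sg (i : 'I_p) := Ordinal (lt i).
have sg_inj : injective sg.
  move=> i j /(congr1 val) /= e; apply: inj.
  rewrite -(nth_index (phi i) (_ : phi i \in r)) ?mem_sort ?codom_f //.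
  by rewrite e nth_index // mem_sort codom_f.
pose h : {ffun 'I_p -> 'I_n} := [ffun i : 'I_p => nth (phi i) r i].
have hin : h \in incr p n.
  rewrite inE; apply/forallP => i; apply/forallP => j; apply/implyP => ij.
  rewrite !ffunE (set_nth_default (phi i) (phi j)) ?sr //.
  apply: (@sorted_ltn_nth _ (relpre (@nat_of_ord n) ltn)) => //.
  - by move=> a b c; exact: ltn_trans.
  - by rewrite inE sr.
  - by rewrite inE sr.
exists (enum_rank_in hin h), (perm sg_inj) => i.
rewrite /incr_fun enum_rankK_in // permE ffunE /=.
by rewrite nth_index // mem_sort codom_f.
Qed.

Lemma incr_fun_perm_inj k l s s' :
  (forall i, incr_fun k (s i) = incr_fun l (s' i)) -> k = l /\ s = s'.
Proof.
move=> h.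
have sorted_c (a : 'I_#|incr p n|) : sorted ltn (map val (codom (incr_fun a))).
  apply/(sortedP 0%N) => i; rewrite size_map size_codom card_ord => ip.
  have i1 : (i < p)%N by exact: ltn_trans ip.
  rewrite !(nth_map (incr_fun a (Ordinal i1))) ?size_codom ?card_ord //.
  rewrite !codomE !(nth_map (Ordinal i1)) -?enumT ?size_enum_ord //.
  by apply: incr_fun_lt; rewrite !nth_enum_ord.
have e : map val (codom (incr_fun k)) = map val (codom (incr_fun l)).
  apply: (irr_sorted_eq ltn_trans ltnn (sorted_c k) (sorted_c l)) => x.
  apply/mapP/mapP => -[y /codomP[i ->] ->].
    by exists (incr_fun l (s' (s^-1 i))%g); rewrite ?codom_f // -h permKV.
  by exists (incr_fun k (s (s'^-1 i))%g); rewrite ?codom_f // h permKV.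
have kl : k = l.
  apply: enum_val_inj; apply/ffunP => i.
  move/(inj_map val_inj): e => /(congr1 (fun r => nth (incr_fun k i) r i)).
  rewrite !codomE !(nth_map i) -?enumT ?size_enum_ord //.
  by rewrite nth_ord_enum.
split=> //; apply/permP => i; apply: (@incr_fun_inj k).
by rewrite h kl.
Qed.

End Increasing.

Section CauchyBinet.

Variables (R : comNzRingType) (p n : nat).
Implicit Types (A : 'M[R]_(p, n)) (B : 'M[R]_(n, p)).

Lemma det_mulmx_ffun A B :
  \det (A *m B) =
    \sum_(phi : {ffun 'I_p -> 'I_n}) (\prod_i A i (phi i)) * \det (rowsub phi B).
Proof.
rewrite {1}/determinant.
transitivity (\sum_(s : 'S_p) \sum_(phi : {ffun 'I_p -> 'I_n})
    (-1) ^+ s * (\prod_i A i (phi i) * \prod_i B (phi i) (s i))).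
  apply: eq_bigr => s _; rewrite -big_distrr /=; congr (_ * _).
  under eq_bigr do rewrite mxE.
  rewrite bigA_distr_bigA /=; apply: eq_bigr => phi _.
  by rewrite big_split.
rewrite exchange_big; apply: eq_bigr => phi _ /=.
rewrite /determinant mulr_sumr; apply: eq_bigr => s _.
rewrite mulrCA; congr (_ * (_ * _)).
by apply: eq_bigr => i _; rewrite mxE.
Qed.

Lemma rowsub_perm (f : 'I_p -> 'I_n) (g : 'I_p -> 'I_n) (s : 'S_p) B :
  (forall i, f i = g (s i)) -> \det (rowsub f B) = (-1) ^+ s * \det (rowsub g B).
Proof.
move=> h; rewrite (_ : rowsub f B = row_perm s (rowsub g B)).
  by rewrite row_permE det_mulmx det_perm.
by apply/matrixP => i j; rewrite !mxE h.
Qed.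

(** In the sum over all [phi], a repeated value gives a minor of [B] with two equal rows. The
    injective [phi] are the [incr_fun k] composed with a permutation, and the signed sum over the
    permutations rebuilds the minor of [A]. *)
Lemma det_mulmx_cauchy_binet A B :
  \det (A *m B) =
    \sum_(k < #|incr p n|) \det (colsub (incr_fun k) A) * \det (rowsub (incr_fun k) B).
Proof.
rewrite det_mulmx_ffun (bigID (fun phi : {ffun _} => injectiveb phi)) /=.
rewrite [X in _ + X]big1 ?addr0; last first.
  move=> phi /injectivePn[i [j ij e]].
  rewrite (determinant_alternate ij) ?mulr0 // => l.
  by rewrite !mxE e.
pose f (ks : 'I_#|incr p n| * 'S_p) : {ffun 'I_p -> 'I_n} :=
  [ffun i => incr_fun ks.1 (ks.2 i)].
have f_inj : injective f.
  move=> [k s] [l s'] e.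
  have [i|-> ->//] := @incr_fun_perm_inj p n k l s s'.
  by have := congr1 (fun phi : {ffun 'I_p -> 'I_n} => phi i) e; rewrite !ffunE.
transitivity (\sum_(phi in f @: predT) (\prod_i A i (phi i)) * \det (rowsub phi B)).
  apply: eq_bigl => phi; apply/injectiveP/imsetP => [/sort_injective[k [s h]]|].
    by exists (k, s) => //; apply/ffunP => i; rewrite ffunE.
  move=> [[k s] _ ->] i j; rewrite !ffunE /= => /incr_fun_inj; exact: perm_inj.
rewrite big_imset /=; last by move=> x y _ _; exact: f_inj.
rewrite (eq_bigl xpredT); last by move=> x; rewrite inE.
rewrite -(pair_bigA _ (fun k s => (\prod_i A i (f (k, s) i)) * \det (rowsub (f (k, s)) B))) /=.
apply: eq_bigr => k _; rewrite /determinant mulr_suml; apply: eq_bigr => s _.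
rewrite -/(determinant _) (@rowsub_perm _ (incr_fun k) s); last by move=> i; rewrite ffunE.
rewrite mulrCA mulrA; congr (_ * _ * _).
by apply: eq_bigr => i _; rewrite ffunE mxE.
Qed.

End CauchyBinet.

(** * Plucker coordinates *)

Lemma unitmx_adj (R : fieldType) k (A : 'M[R]_k) : \det A != 0 -> \adj A \in unitmx.
Proof.
move=> d0; suff /mulmx1_unit[] : \adj A *m ((\det A)^-1 *: A) = 1%:M by [].
by rewrite -scalemxAr mul_adj_mx scale_scalar_mx mulVf.
Qed.

Section Plucker.

Variables (K : fieldType) (p n : nat).
Implicit Types (A : 'M[K]_(p, n)) (t : 'M[K]_n) (v : 'rV[K]_#|incr p n|).

Lemma pluckerE A k : plucker A 0 k = \det (colsub (incr_fun k) A).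
Proof. by rewrite mxE. Qed.

Lemma plucker_mull (g : 'M[K]_p) A : plucker (g *m A) = \det g *: plucker A.
Proof.
apply/rowP => k; rewrite mxE [RHS]mxE mxE -det_mulmx.
by congr (\det _); apply/matrixP => i j; rewrite !mxE; apply: eq_bigr => l _; rewrite mxE.
Qed.

Lemma plucker_ext A t : plucker (A *m t) = plucker A *m ext_mx p t.
Proof.
apply/rowP => l; rewrite pluckerE mxE.
rewrite (_ : colsub _ _ = A *m colsub (incr_fun l) t); last first.
  by apply/matrixP => i j; rewrite !mxE; apply: eq_bigr => k _; rewrite mxE.
rewrite det_mulmx_cauchy_binet; apply: eq_bigr => k _; rewrite !mxE.
by congr (_ * \det _); apply/matrixP => i j; rewrite !mxE.
Qed.

Lemma gr_act_plucker A t : gr_act p t (plucker A) = plucker (A *m t).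
Proof. by rewrite plucker_ext. Qed.

Lemma gr_actM t u v : gr_act p (t *m u) v = gr_act p u (gr_act p t v).
Proof.
(* Here [v] is an arbitrary vector, but the rows of [ext_mx] are Plucker vectors, so [plucker_ext]
   applies row by row. *)
rewrite /gr_act -mulmxA; congr (_ *m _); apply/row_matrixP => k.
rewrite row_mul !rowK -plucker_ext; congr (plucker _).
by apply/matrixP => i j; rewrite !mxE; apply: eq_bigr => l _; rewrite mxE.
Qed.

Lemma gr_actZ t c v : gr_act p t (c *: v) = c *: gr_act p t v.
Proof. by rewrite /gr_act scalemxAl. Qed.

Lemma gr_act_peq t v w : peq v w -> peq (gr_act p t v) (gr_act p t w).
Proof. by move=> [c c0 ->]; exists c; rewrite ?gr_actZ. Qed.

(** [fullrankfun] lists [p] independent columns in no particular order; sorting them changes the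
    minor by a sign only. *)
Lemma row_free_colsub A : row_free A -> exists k, plucker A 0 k != 0.
Proof.
move=> rA; have fA : row_full A^T by rewrite /row_full mxrank_tr.
pose phi := fullrankfun fA.
have d0 : \det (colsub phi A) != 0.
  rewrite -unitfE -unitmxE -unitmx_tr -row_full_unit.
  by rewrite (_ : (_)^T = rowsub phi A^T) ?fullrowsub_full //; apply/matrixP => i j; rewrite !mxE.
have [k [s h]] := sort_injective (@fullrankfun_inj _ _ _ _ fA : injective phi).
exists k; apply: contraNneq d0; rewrite pluckerE => k0.
rewrite -det_tr (_ : (_)^T = rowsub phi A^T); last by apply/matrixP => i j; rewrite !mxE.
rewrite (rowsub_perm _ h) (_ : rowsub _ _ = (colsub (incr_fun k) A)^T) ?det_tr ?k0 ?mulr0 //.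
by apply/matrixP => i j; rewrite !mxE.
Qed.

Lemma plucker_neq0 A : (plucker A != 0) = row_free A.
Proof.
apply/idP/idP => [/row_neq0_ex[k]|/row_free_colsub[k]]; last exact: coord_neq0.
rewrite pluckerE -unitfE -unitmxE -row_free_unit => h.
rewrite -row_leq_rank -{1}(eqP h).
rewrite (_ : colsub _ _ = A *m colsub (incr_fun k) 1%:M) ?mxrankM_maxl //.
rewrite -{1}[A]mulmx1; apply/matrixP => i j; rewrite mxE mxE [RHS]mxE.
by apply: eq_bigr => l _; rewrite [in RHS]mxE.
Qed.

Lemma row_free_unitmul A t : t \in unitmx -> row_free (A *m t) = row_free A.
Proof. by move=> ut; rewrite -!row_leq_rank mxrankMfree // row_free_unit. Qed.

Lemma unitmul_row_free (g : 'M[K]_p) A : g \in unitmx -> row_free (g *m A) = row_free A.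
Proof.
move=> ug; rewrite -!row_leq_rank.
by rewrite eqmxMfull // row_full_unit.
Qed.

End Plucker.

Section Chart.

Variables (F K : fieldType) (iota : {rmorphism F -> K}) (p n : nat).

(** A repeated column gives 0, and otherwise sorting gives a Plucker coordinate up to sign. So the
    linear form has coefficients in [F] and is the same for all [A]. *)
Lemma det_colsub_formfun (phi : 'I_p -> 'I_n) :
  exists L, formfun iota 1 L /\
    forall A : 'M[K]_(p, n), \det (colsub phi A) = L (plucker A).
Proof.
case: (boolP (injectiveb phi)) => [/injectiveP/sort_injective[k [s h]]|/injectivePn[i [j ij e]]].
  exists (fun v => iota ((-1) ^+ s) * v 0 k); split.
    exact/formfunZ/formfun_coord.
  move=> A; rewrite -det_tr (_ : (_)^T = rowsub phi A^T); last by apply/matrixP => i j; rewrite !mxE.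
  rewrite (rowsub_perm _ h) rmorphXn rmorphN rmorph1 pluckerE -det_tr.
  by congr (_ * \det _); apply/matrixP => i j; rewrite !mxE.
exists (fun=> 0); split; first exact: formfun0.
move=> A; rewrite -det_tr (determinant_alternate ij) // => l.
by rewrite !mxE e.
Qed.

(* By Cramer's rule the entries of [adj(A_k) A] are the minors of A on the columns
   of A_k with one of them replaced, so they are Plucker coordinates up to sign. *)
Lemma chart_exists (k : 'I_#|incr p n|) :
  exists B : 'rV[K]_#|incr p n| -> 'M[K]_(p, n),
    (forall i j, formfun iota 1 (fun v => B v i j)) /\
    forall A, B (plucker A) = \adj (colsub (incr_fun k) A) *m A.
Proof.
have /choice[L hL] : forall ij : 'I_p * 'I_n, exists L, formfun iota 1 L /\
    forall A : 'M[K]_(p, n),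
      \det (colsub (fun l => if l == ij.1 then ij.2 else incr_fun k l) A) = L (plucker A).
  by move=> ij; exact: det_colsub_formfun.
exists (fun v => \matrix_(i, j) L (i, j) v); split=> [i j|A].
  by apply: formfun_ext (hL (i, j)).1 => v; rewrite mxE.
apply/matrixP => i j; rewrite mxE -(hL (i, j)).2 /=.
rewrite (expand_det_col _ i) mxE; apply: eq_bigr => l _.
rewrite !mxE eqxx mulrC; congr (_ * _); rewrite /cofactor; congr (_ * \det _).
apply/matrixP => a b; rewrite !mxE.
by rewrite [X in if X then _ else _]eq_sym (negPf (neq_lift _ _)).
Qed.

End Chart.

Section PluckerSubspaces.

Variables (K : fieldType) (p n : nat).
Implicit Types (A : 'M[K]_(p, n)) (t : 'M[K]_n) (v : 'rV[K]_#|incr p n|).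

(** The chart is linear in the Plucker vector and returns a basis of the row space, so proportional
    Plucker vectors give proportional bases. *)
Lemma plucker_peq_sub A A' : row_free A -> peq (plucker A) (plucker A') -> (A' <= A)%MS.
Proof.
move=> rA e; have [k k0] := row_free_colsub rA.
have k0' := peq_coord e k0; case: e => c c0 e.
have [B [hB BE]] := @chart_exists K K idfun p n k.
have : \adj (colsub (incr_fun k) A') *m A' = c *: (\adj (colsub (incr_fun k) A) *m A).
  rewrite -!BE e; apply/matrixP => i j.
  by rewrite (formfun_scale _ _ (hB i j)) mxE expr1.
have u : \adj (colsub (incr_fun k) A') \in unitmx by rewrite pluckerE in k0'; exact: unitmx_adj.
move=> /(congr1 (mulmx (invmx (\adj (colsub (incr_fun k) A'))))); rewrite mulKmx // => ->.
by rewrite scalemxAl mulmxA submxMl.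
Qed.

Lemma plucker_peqE A A' : row_free A -> peq (plucker A) (plucker A') ->
  exists2 g, g \in unitmx & A' = g *m A.
Proof.
move=> rA e; have /submxP[g gE] := plucker_peq_sub rA e; exists g => //.
have rA' : row_free A' by rewrite -plucker_neq0 (peq_neq0 e) // plucker_neq0.
rewrite -row_free_unit -row_leq_rank.
by rewrite -{1}(eqP rA') gE mxrankM_maxl.
Qed.

Lemma plucker_unitmul_peq (g : 'M[K]_p) A : g \in unitmx -> peq (plucker A) (plucker (g *m A)).
Proof. by rewrite unitmxE unitfE => g0; rewrite plucker_mull; apply: peqZ. Qed.

Lemma plucker_scale_peq c A : c != 0 -> peq (plucker A) (plucker (c *: A)).
Proof.
move=> c0; rewrite -mul_scalar_mx; apply: plucker_unitmul_peq.
by rewrite unitmxE det_scalar unitfE expf_neq0.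
Qed.

Lemma cone_Gr (W : 'M[K]_n) : (0 < p)%N -> cone (Gr p W).
Proof.
move=> p0; split=> [v [A [rA _ ->]]|v w [A [rA AW ->]] [c c0 ->]].
  by rewrite plucker_neq0.
(* Scaling a single row by [c] multiplies the Plucker vector by [c]; the first row exists because
   [p] is positive. *)
pose g : 'M[K]_p := diag_mx (\row_i if i == Ordinal p0 then c else 1).
have dg : \det g = c.
  rewrite det_diag (bigD1 (Ordinal p0)) //= mxE eqxx big1 ?mulr1 // => i /negPf e.
  by rewrite mxE e.
have ug : g \in unitmx by rewrite unitmxE unitfE dg.
exists (g *m A); split; last by rewrite plucker_mull dg.
  by rewrite unitmul_row_free.
by apply: submx_trans AW; apply: submxMl.
Qed.

Lemma Gr_sub_GrV (W : 'M[K]_n) : Gr p W `<=` GrV p n.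
Proof. by move=> v [A [rA _ ->]]; exists A; rewrite submx1. Qed.

Lemma GrV_plucker v : GrV p n v <-> exists2 A : 'M[K]_(p, n), row_free A & v = plucker A.
Proof.
split=> [[A [rA _ ->]]|[A rA ->]]; first by exists A.
by exists A; rewrite submx1.
Qed.

Lemma GrV_act t v : t \in unitmx -> GrV p n v -> GrV p n (gr_act p t v).
Proof.
move=> ut /GrV_plucker[A rA ->]; apply/GrV_plucker.
by exists (A *m t); rewrite ?gr_act_plucker ?row_free_unitmul.
Qed.

Lemma GrV_act1 v : GrV p n v -> gr_act p 1%:M v = v.
Proof. by move=> /GrV_plucker[A rA ->]; rewrite gr_act_plucker mulmx1. Qed.

Lemma gr_act_formfun (F : fieldType) (iota : {rmorphism F -> K}) (t : 'M[F]_n) j :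
  formfun iota 1 (fun v => gr_act p (map_mx iota t) v 0 j).
Proof.
have : formfun iota 1 (fun v : 'rV[K]_#|incr p n| => \sum_k iota (ext_mx p t k j) * v 0 k).
  by apply: formfun_sum => k _ _; apply/formfunZ/formfun_coord.
apply: formfun_ext => v; rewrite mxE; apply: eq_bigr => k _; rewrite mulrC.
rewrite !mxE -det_map_mx; congr (_ * \det _).
by apply/matrixP => a b; rewrite !mxE.
Qed.

End PluckerSubspaces.

(** * Irreducibility of Grassmannians, by means of lines of matrices *)

Section Irreducibility.

Variables (F : fieldType) (K : closedFieldType) (iota : {rmorphism F -> K}).

Definition polypath (phi : K -> K) : Prop := exists P : {poly K}, forall s, phi s = P.[s].

Lemma polypath_cst c : polypath (fun=> c).
Proof. by exists c%:P => s; rewrite hornerC. Qed.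

Lemma polypath_id : polypath id.
Proof. by exists 'X => s; rewrite hornerX. Qed.

Lemma polypathD f g : polypath f -> polypath g -> polypath (fun s => f s + g s).
Proof. by move=> [P hP] [Q hQ]; exists (P + Q) => s; rewrite hornerD hP hQ. Qed.

Lemma polypathM f g : polypath f -> polypath g -> polypath (fun s => f s * g s).
Proof. by move=> [P hP] [Q hQ]; exists (P * Q) => s; rewrite hornerM hP hQ. Qed.

Lemma polypath_formfun N d phi (v : K -> 'rV[K]_N) :
  formfun iota d phi -> (forall j, polypath (fun s => v s 0 j)) ->
  polypath (fun s => phi (v s)).
Proof.
move=> [f _ ef] hv.
have [P hP] := funring_feval iota polypath_cst polypathD polypathM f hv.
by exists P => s; rewrite -ef.
Qed.

Lemma polypath_plucker p n (A : K -> 'M[K]_(p, n)) j :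
  (forall i j, polypath (fun s => A s i j)) -> polypath (fun s => plucker (A s) 0 j).
Proof.
move=> hA; have [|P hP] := funring_det polypath_cst polypathD polypathM
   (M := fun s => colsub (incr_fun j) (A s)).
  by move=> a b; have [P hP] := hA a (incr_fun j b); exists P => s; rewrite mxE.
by exists P => s; rewrite pluckerE.
Qed.

Lemma polypath_nonzero f a : polypath f -> f a != 0 ->
  exists2 P : {poly K}, P != 0 & forall s, f s = P.[s].
Proof. by move=> [P hP] fa; exists P => //; apply: contraNneq fa => P0; rewrite hP P0 horner0. Qed.

Lemma polypath_common f g h a b c :
  polypath f -> polypath g -> polypath h -> f a != 0 -> g b != 0 -> h c != 0 ->
  exists s, [/\ f s != 0, g s != 0 & h s != 0].
Proof.
move=> /polypath_nonzero pf /polypath_nonzero pg /polypath_nonzero ph.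
move=> /pf[P P0 hP] /pg[Q Q0 hQ] /ph[R R0 hR].
have [s] : exists s, ~~ root (P * Q * R) s by apply/closed_nonrootP; rewrite !mulf_neq0.
rewrite rootE !hornerM !mulf_eq0 !negb_or -hP -hQ -hR => /andP[/andP[? ?] ?].
by exists s.
Qed.

(** On the line of matrices from [A] to [B], both forms and one Plucker coordinate are polynomials
    in the parameter, each nonzero at 0 or at 1, so some parameter is a root of none of them. The
    Plucker coordinate keeps the rows independent. *)
Lemma Gr_form_common p n (W : 'M[K]_n) d e phi psi x y :
  formfun iota d phi -> formfun iota e psi -> Gr p W x -> Gr p W y ->
  phi x != 0 -> psi y != 0 ->
  exists z, [/\ Gr p W z, phi z != 0 & psi z != 0].
Proof.
move=> hphi hpsi [A [rA AW ->]] [B [rB BW ->]] px py.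
pose C s := A + s *: (B - A).
have hC i j : polypath (fun s => C s i j).
  have := polypathD (polypath_cst (A i j)) (polypathM polypath_id (polypath_cst (B i j - A i j))).
  by move=> [P hP]; exists P => s; rewrite -hP !mxE.
have hpl j := polypath_plucker j hC.
have C0 : C 0 = A by rewrite /C scale0r addr0.
have C1 : C 1 = B by rewrite /C scale1r addrC subrK.
have [k k0] := row_free_colsub rA.
have [|||s [h1 h2 /coord_neq0]] := polypath_common (polypath_formfun hphi hpl)
  (polypath_formfun hpsi hpl) (hpl k) (a := 0) (b := 1) (c := 0).
- by rewrite C0.
- by rewrite C1.
- by rewrite C0.
rewrite plucker_neq0 => rC.
exists (plucker (C s)); split=> //; exists (C s); split=> //.
by rewrite addmx_sub // scalemx_sub // addmx_sub // eqmx_opp.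
Qed.

Lemma Gr_dense_open p n (W : 'M[K]_n) U :
  zariski_open iota (Gr p W) U -> U !=set0 -> dense_open iota (Gr p W) U.
Proof.
move=> oU [x Ux]; split=> // O oO [y Oy].
have /zopenP[US /(_ x Ux)[d [phi [h1 h2 h3]]]] := oU.
have /zopenP[OS /(_ y Oy)[e [psi [k1 k2 k3]]]] := oO.
have [z [Wz pz qz]] := Gr_form_common h1 k1 (US _ Ux) (OS _ Oy) h2 k2.
by exists z; split; [apply: k3|apply: h3].
Qed.

End Irreducibility.

(** * Maximal tori *)

Section OneParameter.

Variables (K : closedFieldType).

Lemma polynomial_coef_eq0 m n D (C : nat -> 'M[K]_(m, n)) :
  (forall a : K, a != 0 -> \sum_(i < D) a ^+ i *: C i = 0) ->
  forall i, (i < D)%N -> C i = 0.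
Proof.
move=> h i iD; apply/matrixP => a b; rewrite [RHS]mxE.
pose q := \poly_(j < D) C j a b.
suff q0 : q = 0 by have := coef_poly D (fun j => C j a b) i; rewrite -/q q0 coef0 iD => <-.
apply/eqP; apply: contraT => q0.
(* The extra factor ['X] makes the nonroot [s] nonzero, so that the hypothesis applies to it. *)
have [s] : exists s, ~~ root ('X * q) s by apply/closed_nonrootP; rewrite mulf_neq0 ?polyX_eq0.
rewrite rootE hornerM hornerX mulf_eq0 negb_or => /andP[s0].
have := congr1 (fun M : 'M_(m, n) => M a b) (h s s0).
rewrite summxE mxE /q horner_poly => e.
rewrite (eq_bigr (fun j : 'I_D => (s ^+ j *: C j) a b)) ?e ?eqxx // => j _.
by rewrite mxE mulrC.
Qed.

(** Only nonzero arguments count: a Laurent polynomial is encoded by the polynomial left after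
    clearing a power of the argument. *)
Definition laurent (f : K -> K) : Prop :=
  exists d (P : {poly K}), forall a : K, a != 0 -> a ^+ d * f a = P.[a].

Lemma laurent_cst c : laurent (fun=> c).
Proof. by exists 0%N, c%:P => a _; rewrite hornerC expr0 mul1r. Qed.

Lemma laurent_id : laurent id.
Proof. by exists 0%N, 'X => a _; rewrite hornerX expr0 mul1r. Qed.

Lemma laurent_inv : laurent GRing.inv.
Proof. by exists 1%N, 1 => a a0; rewrite hornerC expr1 divff. Qed.

Lemma laurentD f g : laurent f -> laurent g -> laurent (fun a => f a + g a).
Proof.
move=> [d [P hP]] [e [Q hQ]]; exists (d + e)%N, ('X^e * P + 'X^d * Q) => a a0.
rewrite hornerD !hornerM !hornerXn -hP // -hQ // mulrDr exprD.
by congr (_ + _); rewrite mulrA // [a ^+ d * _]mulrC.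
Qed.

Lemma laurentM f g : laurent f -> laurent g -> laurent (fun a => f a * g a).
Proof.
move=> [d [P hP]] [e [Q hQ]]; exists (d + e)%N, (P * Q) => a a0.
by rewrite hornerM -hP // -hQ // exprD mulrACA.
Qed.

Lemma laurent_matrix m n (M : K -> 'M[K]_(m, n)) :
  (forall i j, laurent (fun a => M a i j)) ->
  exists d D (E : nat -> 'M[K]_(m, n)),
    forall a : K, a != 0 -> a ^+ d *: M a = \sum_(i < D) a ^+ i *: E i.
Proof.
move=> h.
have /choice[c hc] : forall ij : 'I_m * 'I_n, exists c : nat * {poly K},
    forall a : K, a != 0 -> a ^+ c.1 * M a ij.1 ij.2 = c.2.[a].
  by move=> [i j]; have [d [P hP]] := h i j; exists (d, P).
pose d := (\sum_ij (c ij).1)%N.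
pose q ij := 'X^(d - (c ij).1) * (c ij).2.
pose D := (\sum_ij size (q ij))%N.
exists d, D, (fun l => \matrix_(i, j) (q (i, j))`_l) => a a0.
apply/matrixP => i j; rewrite summxE mxE.
have cd : ((c (i, j)).1 <= d)%N by rewrite /d (bigD1 (i, j)) //= leq_addr.
have qD : (size (q (i, j)) <= D)%N by rewrite /D (bigD1 (i, j)) //= leq_addr.
rewrite -(subnK cd) exprD -mulrA (hc (i, j)) // -hornerXn -hornerM -/(q (i, j)).
rewrite (horner_coef_wide _ qD); apply: eq_bigr => l _.
by rewrite !mxE mulrC.
Qed.

Section Coefficients.

Variables (n : nat) (M M' : K -> 'M[K]_n) (d D d' D' : nat) (E E' : nat -> 'M[K]_n).
Hypothesis hE : forall a : K, a != 0 -> a ^+ d *: M a = \sum_(i < D) a ^+ i *: E i.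
Hypothesis hE' : forall a : K, a != 0 -> a ^+ d' *: M' a = \sum_(i < D') a ^+ i *: E' i.

(** Comparing the coefficients of [a ^+ i] and then of [b ^+ j] in [M (a * b) = M a *m M b] shows
    that [E i *m E j] is [E i] for [j = i] and 0 otherwise: the [E i] are the projectors on the
    weight spaces, of weight [i - d]. *)
Lemma one_parameter_idempotent :
  (forall a b : K, a != 0 -> b != 0 -> M (a * b) = M a *m M b) ->
  forall i, (i < D)%N -> E i *m E i = E i.
Proof.
move=> hM i iD.
have h (b : K) : b != 0 -> b ^+ i *: E i = \sum_(j < D) b ^+ j *: (E i *m E j).
  move=> b0; apply/eqP; rewrite -subr_eq0; apply/eqP.
  pose C i : 'M[K]_n := b ^+ i *: E i - \sum_(j < D) b ^+ j *: (E i *m E j).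
  apply: (@polynomial_coef_eq0 _ _ D C _ i iD) => a a0.
  rewrite /C; under eq_bigr do rewrite scalerBr.
  rewrite sumrB; apply/eqP; rewrite subr_eq0; apply/eqP.
  under eq_bigr do rewrite scalerA -exprMn.
  rewrite -hE ?mulf_neq0 // hM // exprMn -scalerA [RHS](eq_bigr (fun i : 'I_D =>
    (a ^+ i *: E i) *m (b ^+ d *: M b))); last first.
    move=> j _; rewrite hE // -scalemxAl; congr (_ *: _).
    by rewrite mulmx_sumr; apply: eq_bigr => l _; rewrite -scalemxAr.
  by rewrite -mulmx_suml -hE // -scalemxAl -scalemxAr.
have : (if i == i then E i else 0) - E i *m E i = 0.
  pose C j : 'M[K]_n := (if j == i then E i else 0) - E i *m E j.
  apply: (@polynomial_coef_eq0 _ _ D C _ i iD) => b b0.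
  rewrite /C; under eq_bigr do rewrite scalerBr.
  rewrite sumrB -h // (bigD1 (Ordinal iD)) //= eqxx big1 ?addr0 ?subrr // => j /negPf.
  by rewrite -val_eqE /= => ->; rewrite scaler0.
by rewrite eqxx => /eqP; rewrite subr_eq0 => /eqP.
Qed.

Lemma one_parameter_commute :
  (forall a b : K, a != 0 -> b != 0 -> M a *m M' b = M' b *m M a) ->
  forall i j, (i < D)%N -> (j < D')%N -> E i *m E' j = E' j *m E i.
Proof.
move=> hM i j iD jD.
have h (b : K) : b != 0 -> E i *m M' b = M' b *m E i.
  move=> b0; apply/eqP; rewrite -subr_eq0; apply/eqP.
  pose C i : 'M[K]_n := E i *m M' b - M' b *m E i.
  apply: (@polynomial_coef_eq0 _ _ D C _ i iD) => a a0.
  transitivity ((\sum_(l < D) a ^+ l *: E l) *m M' b - M' b *m \sum_(l < D) a ^+ l *: E l).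
    rewrite mulmx_suml mulmx_sumr -sumrB; apply: eq_bigr => l _.
    by rewrite scalerBr scalemxAl scalemxAr.
  by rewrite -hE // -scalemxAl -scalemxAr hM // subrr.
apply/eqP; rewrite -subr_eq0; apply/eqP.
pose C j : 'M[K]_n := E i *m E' j - E' j *m E i.
apply: (@polynomial_coef_eq0 _ _ D' C) jD => b b0.
transitivity (E i *m (\sum_(l < D') b ^+ l *: E' l) - (\sum_(l < D') b ^+ l *: E' l) *m E i).
  rewrite mulmx_suml mulmx_sumr -sumrB; apply: eq_bigr => l _.
  by rewrite /C scalerBr scalemxAr scalemxAl.
by rewrite -hE' // -scalemxAl -scalemxAr h // subrr.
Qed.

End Coefficients.

(** The polynomial [X (X - 1)] annihilates [E] and has simple roots in every characteristic. *)
Lemma idempotent_diagonalizable n (E : 'M[K]_n.+1) : E *m E = E -> diagonalizable E.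
Proof.
move=> EE; apply/diagonalizableP; exists [:: 0; 1].
  by rewrite /= inE eq_sym oner_eq0.
rewrite mxminpoly_min // !big_cons big_nil mulr1 polyC0 subr0.
rewrite rmorphM rmorphB /= horner_mx_X horner_mx_C mulrBr mulr1.
by apply/eqP; rewrite subr_eq0; apply/eqP.
Qed.

End OneParameter.

Section DiagonalConjugates.

Variables (K : fieldType) (n : nat) (P : 'M[K]_n).
Hypothesis uP : P \in unitmx.
Implicit Types d e : 'rV[K]_n.

(** The rows of [P] are the eigenvectors, since matrices act on row vectors from the right. *)
Definition dmat d : 'M[K]_n := invmx P *m diag_mx d *m P.

Lemma dmatP X : reflect (exists d, X = dmat d) (is_diag_mx (P *m X *m invmx P)).
Proof.
apply: (iffP (diag_mxP _)) => -[d e]; exists d; last first.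
  by rewrite e /dmat !mulmxA mulmxV // mul1mx mulmxK.
by rewrite /dmat -e !mulmxA mulVmx // mul1mx mulmxKV.
Qed.

Lemma dmatK d : P *m dmat d *m invmx P = diag_mx d.
Proof. by rewrite /dmat !mulmxA mulmxV // mul1mx mulmxK. Qed.

Lemma dmat_inj : injective dmat.
Proof.
move=> d e h; have := dmatK d; rewrite h dmatK => /matrixP h'.
by apply/rowP => j; have := h' j j; rewrite !mxE eqxx.
Qed.

Lemma dmatD d e : dmat (d + e) = dmat d + dmat e.
Proof. by rewrite /dmat raddfD /= mulmxDr mulmxDl. Qed.

Lemma dmatZ c d : dmat (c *: d) = c *: dmat d.
Proof. by rewrite /dmat linearZ /= -scalemxAr -scalemxAl. Qed.

Lemma dmat0 : dmat 0 = 0.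
Proof. by rewrite /dmat raddf0 mulmx0 mul0mx. Qed.

Lemma dmat_cst c : dmat (const_mx c) = c%:M.
Proof. by rewrite /dmat diag_const_mx mul_mx_scalar -scalemxAl mulVmx // scalemx1. Qed.

Lemma dmatM d e : dmat d *m dmat e = dmat (\row_k (d 0 k * e 0 k)).
Proof.
rewrite /dmat !mulmxA mulmxK //; congr (_ *m _); rewrite -!mulmxA mulmx_diag.
by congr (_ *m _).
Qed.

Lemma dmatC d e : dmat d *m dmat e = dmat e *m dmat d.
Proof. by rewrite !dmatM; congr dmat; apply/rowP => k; rewrite !mxE mulrC. Qed.

Lemma det_dmat d : \det (dmat d) = \prod_i d 0 i.
Proof. by rewrite /dmat !det_mulmx det_inv mulrAC mulVf ?mul1r ?det_diag // -unitfE -unitmxE. Qed.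

Lemma dmatV d : dmat d \in unitmx -> invmx (dmat d) = dmat (\row_k (d 0 k)^-1).
Proof.
move=> u; have d0 : \prod_i d 0 i != 0 by rewrite -det_dmat -unitfE -unitmxE.
rewrite -[RHS](mulKmx u) dmatM (_ : \row_k _ = const_mx 1) ?dmat_cst ?mulmx1 //.
by apply/rowP => k; rewrite !mxE divff // (prodf_neq0 _ _ d0).
Qed.

Lemma dmat_sum I (r : seq I) (Q : pred I) (d : I -> 'rV[K]_n) :
  dmat (\sum_(i <- r | Q i) d i) = \sum_(i <- r | Q i) dmat (d i).
Proof. exact: (big_morph dmat dmatD dmat0). Qed.

Definition diag_torus : set 'M[K]_n := [set t | (exists d, t = dmat d) /\ \det t = 1].

End DiagonalConjugates.

Section DiagTorusIsTorus.

Variables (K : fieldType).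

Definition polyfun N (phi : 'rV[K]_N -> K) : Prop :=
  exists f : {mpoly K[N]}, feval idfun f =1 phi.

Lemma polyfun_cst N c : @polyfun N (fun=> c).
Proof. by have [f _ h] := @formfun_cst K K idfun N c; exists f. Qed.

Lemma polyfun_coord N j : @polyfun N (fun v => v 0 j).
Proof. by have [f _ h] := @formfun_coord K K idfun N j; exists f. Qed.

Lemma polyfunD N f g : @polyfun N f -> polyfun g -> polyfun (fun v => f v + g v).
Proof. by move=> [a ha] [b hb]; exists (a + b) => v; rewrite /feval mmapD -ha -hb. Qed.

Lemma polyfunM N f g : @polyfun N f -> polyfun g -> polyfun (fun v => f v * g v).
Proof. by move=> [a ha] [b hb]; exists (a * b) => v; rewrite /feval rmorphM -ha -hb. Qed.

Lemma polyfun_conj N n (A B : 'M[K]_n) (M : 'rV[K]_N -> 'M[K]_n) :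
  (forall i j, polyfun (fun v => M v i j)) ->
  forall i j, polyfun (fun v => (A *m M v *m B) i j).
Proof.
move=> hM i j.
have cst (C : 'M[K]_n) i' j' : @polyfun N (fun=> C i' j') by exact: polyfun_cst.
exact: (funring_mulmx (@polyfun_cst N) (@polyfunD N) (@polyfunM N)
  (funring_mulmx (@polyfun_cst N) (@polyfunD N) (@polyfunM N) (cst A) hM) (cst B)).
Qed.

Lemma polyfun_vec_mx n i j : polyfun (fun v : 'rV[K]_(n * n) => vec_mx v i j).
Proof. by have [f h] := @polyfun_coord (n * n) (mxvec_index i j); exists f => v; rewrite h mxE. Qed.

Variables (n : nat) (P : 'M[K]_n.+1).
Hypothesis uP : P \in unitmx.

Lemma diag_torus_closed : closed_subgroup_SL (diag_torus P).
Proof.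
split.
- by move=> t [].
- by split; [exists (const_mx 1); rewrite dmat_cst | rewrite det1].
- move=> t u [[d ->] dt] [[e ->] du]; split; last by rewrite det_mulmx dt du mulr1.
  by rewrite dmatM //; eexists.
- move=> t [[d ->] dt]; split; last by rewrite det_inv dt invr1.
  by rewrite dmatV ?unitmxE ?dt ?unitr1 //; eexists.
(* Closedness: the off-diagonal entries of [P t P^-1] and [det t - 1] are polynomials in the entries
   of [t] that vanish on the group. *)
- move=> t h; split.
    apply/dmatP => //; apply/is_diag_mxP => i j ij.
    have [f hf] := polyfun_conj P (invmx P) (@polyfun_vec_mx n.+1) i j.
    rewrite -{1}(mxvecK t) -hf; apply: h => u [[d ->] _].
    rewrite hf mxvecK dmatK // mxE; move: ij; rewrite -val_eqE => /negPf.
    by case: eqP => // ->; rewrite eqxx.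
  have [f hf] := polyfunD (funring_det (@polyfun_cst _) (@polyfunD _) (@polyfunM _)
    (@polyfun_vec_mx n.+1)) (@polyfun_cst _ (-1)).
  apply/eqP; rewrite -subr_eq0 -{1}(mxvecK t) -hf; apply/eqP; apply: h => u [_ du].
  by rewrite hf mxvecK du subrr.
Qed.

Lemma diag_torus_is_torus : is_torus (diag_torus P).
Proof.
(* The first [n] diagonal entries are free and the last is the inverse of their product; it is read
   off from [y], the block of inverse coordinates. *)
pose dd (x y : 'rV[K]_n) : 'rV[K]_n.+1 :=
  \row_i oapp (fun j => x 0 j) (\prod_j y 0 j) (unlift ord_max i).
pose inv (x : 'rV[K]_n) := map_mx GRing.inv x.
have dmax x y : dd x y 0 ord_max = \prod_j y 0 j by rewrite mxE unlift_none.
have dlift x y j : dd x y 0 (lift ord_max j) = x 0 j by rewrite mxE liftK.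
have /choice[phi hphi] : forall ij : 'I_n.+1 * 'I_n.+1, exists f : {mpoly K[n + n]},
    feval idfun f =1 fun u => dmat P (dd (lsubmx u) (rsubmx u)) ij.1 ij.2.
  move=> [i j]; apply: polyfun_conj => a b.
  have h : polyfun (fun u : 'rV_(n + n) => dd (lsubmx u) (rsubmx u) 0 a).
    case: (unliftP ord_max a) => [c ->|->].
      have [f h] := polyfun_coord (lshift n c); exists f => v.
      by rewrite h dlift mxE.
    have [|f h] := @funring_prod _ _ _ (@polyfun_cst (n + n)) (@polyfunM _) 'I_n
      (index_enum _) xpredT (fun c v => v 0 (rshift n c)); first by move=> c; apply: polyfun_coord.
    by exists f => v; rewrite h dmax; apply: eq_bigr => c _; rewrite mxE.
  have [f hf] := h; exists (f *+ (a == b)) => v.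
  by rewrite [RHS]mxE -hf /feval mmapMn.
have /choice[chi hchi] : forall k : 'I_n, exists f : {mpoly K[n.+1 * n.+1]},
    feval idfun f =1 fun v => (P *m vec_mx v *m invmx P) (lift ord_max k) (lift ord_max k).
  by move=> k; apply: polyfun_conj; exact: polyfun_vec_mx.
exists n, (fun i j => phi (i, j)), chi => Gm Phi Chi.
have PhiE s : Phi s = dmat P (dd s (inv s)).
  by apply/matrixP => i j; rewrite mxE hphi row_mxKl row_mxKr.
have ChiE d : Chi (dmat P d) = \row_k d 0 (lift ord_max k).
  by apply/rowP => k; rewrite !mxE hchi mxvecK dmatK // !mxE eqxx.
have prodE s : \prod_i dd s (inv s) 0 i = (\prod_j s 0 j)^-1 * \prod_j s 0 j.
  rewrite (bigD1_ord ord_max) //= dmax -prodfV; congr (_ * _).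
    by apply: eq_bigr => j _; rewrite mxE.
  by apply: eq_bigr => j _; rewrite dlift.
split.
- move=> s Gs; split; last first.
    by rewrite PhiE ChiE; apply/rowP => k; rewrite mxE dlift.
  split; first by exists (dd s (inv s)).
  by rewrite PhiE det_dmat // prodE mulVf //; apply/prodf_neq0 => k _; exact: Gs.
- move=> t [[d ->]]; rewrite det_dmat // => d1; rewrite ChiE PhiE.
  have d0 k : d 0 k != 0.
    have : \prod_i d 0 i != 0 by rewrite d1 oner_neq0.
    by move=> /prodf_neq0; apply.
  split; first by move=> k; rewrite mxE.
  congr dmat; apply/rowP => i; case: (unliftP ord_max i) => [k ->|->].
    by rewrite dlift mxE.
  rewrite dmax; move: d1; rewrite (bigD1_ord ord_max) //= => d1.
  rewrite -[RHS]mulr1.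
  rewrite -[X in _ * X](@divff _ (\prod_i d 0 (lift ord_max i))); last by apply/prodf_neq0.
  rewrite mulrA d1 mul1r -prodfV; apply: eq_bigr => k _.
  by rewrite !mxE.
- move=> s s' Gs Gs'; rewrite !PhiE dmatM //; congr dmat; apply/rowP => i.
  rewrite [RHS]mxE; case: (unliftP ord_max i) => [k ->|->].
    by rewrite !dlift mxE.
  by rewrite !dmax -big_split; apply: eq_bigr => k _; rewrite !mxE invfM.
Qed.

End DiagTorusIsTorus.

Section MaximalTorus.

Variables (K : closedFieldType) (n : nat) (T : set 'M[K]_n.+1).

(** Each factor of the product of multiplicative groups gives a one-parameter group [lam k], whose
    Laurent coefficients are idempotents that all commute. They are diagonalized simultaneously, and
    every element of [T] is a product of values of the [lam k]. *)
Lemma torus_codiagonalizable : T 1%:M -> is_torus T ->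
  exists2 P, P \in unitmx & forall t, T t -> exists d, t = dmat P d.
Proof.
move=> T1 [r [phi [chi H]]].
pose Phi (s : 'rV[K]_r) : 'M[K]_n.+1 :=
  \matrix_(i, j) feval idfun (phi i j) (row_mx s (map_mx GRing.inv s)).
pose Chi (t : 'M[K]_n.+1) : 'rV[K]_r := \row_k feval idfun (chi k) (mxvec t).
have [h1 h2 h3] : [/\ forall s : 'rV_r, (forall k, s 0 k != 0) -> T (Phi s) /\ Chi (Phi s) = s,
    forall t, T t -> (forall k, Chi t 0 k != 0) /\ Phi (Chi t) = t
  & forall s s' : 'rV_r, (forall k, s 0 k != 0) -> (forall k, s' 0 k != 0) ->
      Phi (\row_k (s 0 k * s' 0 k)) = Phi s *m Phi s'] := H.
have Phi1 : Phi (const_mx 1) = 1%:M.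
  have [GC PC] := h2 _ T1; rewrite -[LHS]mulmx1 -{1}PC -h3 //; last first.
    by move=> k; rewrite mxE oner_neq0.
  by rewrite -{2}PC; congr Phi; apply/rowP => k; rewrite !mxE mul1r.
pose sk (k : 'I_r) (a : K) : 'rV[K]_r := \row_j if j == k then a else 1.
have Gsk k a : a != 0 -> forall j, sk k a 0 j != 0.
  by move=> a0 j; rewrite mxE; case: ifP => _ //; rewrite oner_neq0.
pose lam k a := Phi (sk k a).
have lamL k i j : laurent (fun a => lam k a i j).
  have [d [P hP]] : laurent (fun a => feval idfun (phi i j)
      (row_mx (sk k a) (map_mx GRing.inv (sk k a)))).
    apply: (funring_feval idfun (@laurent_cst K) (@laurentD K) (@laurentM K)) => l.
    case: (split_ordP l) => l' ->.
      rewrite (_ : (fun _ => _) = fun a => if l' == k then a else 1).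
        by case: (l' == k); [exact: laurent_id|exact: laurent_cst].
      by apply: funext => a; rewrite row_mxEl mxE.
    rewrite (_ : (fun _ => _) = fun a => if l' == k then a^-1 else 1).
      by case: (l' == k); [exact: laurent_inv|exact: laurent_cst].
    by apply: funext => a; rewrite row_mxEr !mxE; case: ifP; rewrite // invr1.
  by exists d, P => a a0; rewrite -hP // mxE.
have /choice[c hc] : forall k, exists c : nat * nat * (nat -> 'M[K]_n.+1),
   forall a : K, a != 0 -> a ^+ c.1.1 *: lam k a = \sum_(i < c.1.2) a ^+ i *: c.2 i.
  by move=> k; have [d [D [E h]]] := laurent_matrix (lamL k); exists (d, D, E).
have lamM k a b : a != 0 -> b != 0 -> lam k (a * b) = lam k a *m lam k b.
  move=> a0 b0; rewrite /lam -h3; [|exact: Gsk..].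
  by congr Phi; apply/rowP => j; rewrite !mxE; case: ifP => // _; rewrite mulr1.
have lamC k l a b : a != 0 -> b != 0 -> lam k a *m lam l b = lam l b *m lam k a.
  move=> a0 b0; rewrite /lam -!h3; [|exact: Gsk..].
  by congr Phi; apply/rowP => j; rewrite !mxE mulrC.
pose Es := [seq (c k).2 i | k <- enum 'I_r, i <- iota 0 (c k).1.2].
have [P uP hP] : codiagonalizable Es.
  apply/codiagonalizableP; split.
    move=> A B /allpairsPdep[k [i [_ ik ->]]] /allpairsPdep[l [j [_ jl ->]]].
    move: ik jl; rewrite !mem_iota => /= ik jl.
    exact: (one_parameter_commute (hc k) (hc l) (lamC k l)).
  move=> A /allpairsPdep[k [i [_ ik ->]]]; move: ik; rewrite mem_iota => /= ik.
  apply: idempotent_diagonalizable.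
  exact: (one_parameter_idempotent (hc k) (lamM k)).
have lamD k a : a != 0 -> exists d, lam k a = dmat P d.
  move=> a0.
  have /choice[e he] : forall i : 'I_(c k).1.2, exists d, (c k).2 i = dmat P d.
    move=> i; apply/dmatP => //; rewrite -conjumx //.
    apply: (allP hP ((c k).2 i)).
    by apply/allpairsPdep; exists k, (val i); rewrite mem_enum mem_iota /=.
  exists (a ^- (c k).1.1 *: \sum_(i < (c k).1.2) a ^+ i *: e i).
  rewrite dmatZ dmat_sum; apply: (canRL (scalerK _)); first by rewrite expf_neq0.
  by rewrite hc //; apply: eq_bigr => i _; rewrite dmatZ -he.
exists P => // t Tt; have [Gt <-] := h2 t Tt.
set s := Chi t in Gt *.
(* The parameter [s] is built up one coordinate at a time: coordinates outside [r'] are still 1. *)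
suff h (r' : seq 'I_r) : uniq r' ->
    exists d, Phi (\row_j if j \in r' then s 0 j else 1) = dmat P d.
  have [d hd] := h (enum 'I_r) (enum_uniq _); exists d; rewrite -hd; congr Phi.
  by apply/rowP => j; rewrite mxE mem_enum.
elim: r' => [_|k r' IH /= /andP[kr ur]].
  exists (const_mx 1); rewrite dmat_cst // -Phi1; congr Phi.
  by apply/rowP => j; rewrite !mxE.
have [d hd] := IH ur; have [e he] := lamD k _ (Gt k).
rewrite (_ : \row_j _ = \row_j ((\row_j if j \in r' then s 0 j else 1) 0 j * sk k (s 0 k) 0 j)).
  rewrite h3; first by rewrite hd -/(lam k (s 0 k)) he dmatM //; eexists.
    by move=> j; rewrite mxE; case: ifP => // _; rewrite oner_neq0.
  exact: Gsk.
apply/rowP => j; rewrite !mxE inE; case: eqP => [->|_] /=; last by rewrite mulr1.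
by rewrite (negPf kr) mul1r.
Qed.

(** Diagonalizing puts [T] inside [diag_torus P], which is itself a torus, so maximality makes them
    equal. *)
Lemma maximal_torus_diag (F : fieldType) (iota : {rmorphism F -> K}) :
  maximal_torus_SL iota T -> exists2 P, P \in unitmx & T = diag_torus P.
Proof.
move=> [hcl htor _ hmax]; have [hdet T1 _ _ _] := hcl.
have [P uP hP] := torus_codiagonalizable T1 htor.
exists P => //; apply/esym/hmax.
- exact: diag_torus_closed.
- exact: diag_torus_is_torus.
- by move=> t Tt; split; [exact: hP|exact: hdet].
Qed.

End MaximalTorus.

(** * Descent of linear equations from [K] to [F] *)

Section LinearDescent.

Variables (F K : fieldType) (iota : {rmorphism F -> K}).

Lemma mnm1_eq N (i j : 'I_N) : (U_(i)%MM == U_(j)%MM) = (i == j).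
Proof.
apply/eqP/eqP => [/mnmP/(_ j)|->//].
by rewrite !mnm1E eqxx; case: eqP.
Qed.

Lemma dhomog1E (N : nat) (g : {mpoly F[N]}) v : g \is 1.-homog ->
  feval iota g v = \sum_i iota g@_U_(i) * v 0 i.
Proof.
move=> /dhomogP hg.
have -> : g = \sum_i g@_U_(i) *: 'X_i.
  apply/mpolyP => m; rewrite raddf_sum /=.
  under eq_bigr do rewrite mcoeffZ mcoeffX.
  case: (boolP (mdeg m == 1%N)) => [/mdeg1P[i /eqP ->]|m1].
    rewrite (bigD1 i) //= eqxx mulr1 big1 ?addr0 // => j /negPf ji.
    by rewrite mnm1_eq ji mulr0.
  rewrite big1 => [|j _]; last first.
    case: eqP => [e|_]; last by rewrite mulr0.
    by rewrite -e mdeg1 in m1.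
  by apply/eqP; rewrite mcoeff_eq0; apply: contra m1 => /hg /= /eqP.
rewrite /feval raddf_sum; apply: eq_bigr => i _ /=.
rewrite mmapZ mmapX mmap1U; congr (iota _ * _).
rewrite raddf_sum (bigD1 i) //= mcoeffZ mcoeffX eqxx mulr1 big1 ?addr0 // => j /negPf ji.
by rewrite mcoeffZ mcoeffX mnm1_eq ji mulr0.
Qed.

(** The hypothesis on the ideal writes the form [alpha] as a combination of polynomials over [F]
    vanishing on [T], possibly with terms of other degrees. The coefficient vectors for which all
    terms of degree other than 1 cancel form the kernel of a matrix over [F], so they are spanned by
    vectors over [F]; these give the columns of [G]. *)
Lemma linear_form_descent n (T : set 'M[K]_n) (alpha : 'cV[K]_(n * n)) :
  defined_over iota T -> (forall t, T t -> mxvec t *m alpha = 0) ->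
  exists q (G : 'M[F]_(n * n, q)),
    (forall t, T t -> mxvec t *m map_mx iota G = 0) /\
    exists y : 'cV[K]_q, alpha = map_mx iota G *m y.
Proof.
move=> hdef halpha.
pose h : {mpoly K[n * n]} := \sum_i alpha i 0 *: 'X_i.
have hcoef m : h@_m = \sum_i alpha i 0 * (U_(i)%MM == m)%:R.
  by rewrite raddf_sum; apply: eq_bigr => i _; rewrite /= mcoeffZ mcoeffX.
have hU i : h@_U_(i) = alpha i 0.
  rewrite hcoef (bigD1 i) //= eqxx mulr1 big1 ?addr0 // => j /negPf ji.
  by rewrite mnm1_eq ji mulr0.
have hnl m : mdeg m != 1%N -> h@_m = 0.
  move=> m1; rewrite hcoef big1 // => i _.
  case: eqP => [e|_]; last by rewrite mulr0.
  by rewrite -e mdeg1 in m1.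
have [|s [svan hs]] := hdef h.
  move=> t Tt; transitivity ((mxvec t *m alpha) 0 0); last by rewrite halpha // mxE.
  rewrite mxE /feval raddf_sum; apply: eq_bigr => i _ /=.
  by rewrite mmapZ mmapX mmap1U mulrC.
pose r := size s; pose f (q : 'I_r) := (nth (0, 0) s q).2.
pose c : 'rV[K]_r := \row_q (nth (0, 0) s q).1.
have hE m : h@_m = \sum_q c 0 q * iota (f q)@_m.
  rewrite hs raddf_sum /= (big_nth (0, 0)) big_mkord; apply: eq_bigr => q _.
  by rewrite mcoeffZ mcoeff_map_mpoly mxE.
pose ms := [seq m <- flatten [seq msupp cf.2 | cf <- s] | mdeg m != 1%N].
pose B : 'M[F]_(r, size ms) := \matrix_(q, j) (f q)@_(nth 0%MM ms j).
have cB : c *m map_mx iota B = 0.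
  apply/rowP => j; rewrite [RHS]mxE; transitivity (h@_(nth 0%MM ms j)).
    by rewrite hE mxE; apply: eq_bigr => q _; rewrite !mxE.
  apply: hnl; have : nth 0%MM ms j \in ms by apply: mem_nth.
  by rewrite mem_filter => /andP[].
(* Kernels commute with field extension, so [c] is a [K]-combination of the rows of a kernel
   computed over [F]. *)
have /submxP[y yE] : (c <= map_mx iota (kermx B))%MS by rewrite map_kermx; apply/sub_kermxP.
pose g j := \sum_q kermx B j q *: f q.
have gcoef j m : (g j)@_m = \sum_q kermx B j q * (f q)@_m.
  by rewrite raddf_sum; apply: eq_bigr => q _; rewrite /= mcoeffZ.
have ghom j : g j \is 1.-homog.
  apply/dhomogP => m; rewrite mcoeff_msupp /=; apply: contraNeq => m1.
  rewrite gcoef; case: (boolP (m \in ms)) => [/(nthP 0%MM)[l lms <-]|nms].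
    have := mulmx_ker B => /matrixP/(_ j (Ordinal lms)); rewrite mxE [RHS]mxE => e.
    by apply/eqP; rewrite -[RHS]e; apply: eq_bigr => q _; rewrite !mxE.
  rewrite big1 // => q _; apply/eqP; rewrite mulf_eq0; apply/orP; right.
  rewrite mcoeff_eq0; apply: contra nms => hm; rewrite mem_filter m1.
  apply/flattenP; exists (msupp (f q)) => //; apply/mapP.
  by exists (nth (0, 0) s q); rewrite ?mem_nth.
exists r, (\matrix_(i, j) (g j)@_U_(i)); split.
  move=> t Tt; apply/rowP => j; rewrite [RHS]mxE mxE.
  transitivity (feval iota (g j) (mxvec t)).
    by rewrite dhomog1E //; apply: eq_bigr => i _; rewrite !mxE mulrC.
  rewrite /feval raddf_sum big1 // => q _ /=; rewrite mmapZ.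
  by rewrite [X in _ * X](svan _ (mem_nth _ (ltn_ord q)) t Tt) mulr0.
exists y^T; apply/colP => i; rewrite -hU hE mxE.
transitivity (\sum_q \sum_j y 0 j * iota (kermx B j q * (f q)@_U_(i))).
  apply: eq_bigr => q _; rewrite yE mxE mulr_suml; apply: eq_bigr => j _.
  by rewrite mxE rmorphM mulrA.
rewrite exchange_big; apply: eq_bigr => j _.
by rewrite !mxE gcoef rmorph_sum mulr_suml; apply: eq_bigr => q _; rewrite mulrC.
Qed.

End LinearDescent.

Section DiagonalSpan.

Variables (K : closedFieldType) (n : nat) (P : 'M[K]_n.+1).
Hypothesis uP : P \in unitmx.

Lemma closed_nth_root (a : K) k : (0 < k)%N -> exists c, c ^+ k = a.
Proof.
move=> k0; have [c cE] := @solve_monicpoly K k (fun i => if i == 0%N then a else 0) k0.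
exists c; rewrite cE (bigD1 (Ordinal k0)) //= expr0 mulr1 big1 ?addr0 //.
by move=> [[|i] hi] // _; rewrite mul0r.
Qed.

(** The scalar [c] is a root of order [n.+1] of the determinant, which exists because [K] is
    algebraically closed. *)
Lemma diag_torus_scale t : t \in unitmx -> (exists d, t = dmat P d) ->
  exists c u, [/\ c != 0, diag_torus P u & t = c *: u].
Proof.
move=> ut [d tE].
have [c cE] := closed_nth_root (\det t) (ltn0Sn n).
have c0 : c != 0.
  move: ut; rewrite unitmxE unitfE -cE; apply: contraNneq => ->.
  by rewrite expr0n.
exists c, (c^-1 *: t); split=> //; last by rewrite scalerA divff ?scale1r.
split; first by exists (c^-1 *: d); rewrite dmatZ tE.
by rewrite detZ -cE -exprMn mulVf // expr1n.
Qed.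

(** The torus spans the algebra: invertible elements are multiples of torus elements, and the [i]-th
    idempotent [E] is the difference of the invertible elements [1 + (a - 1) E] and 1, divided by
    [a - 1], for some [a] other than 0 and 1. *)
Lemma diag_torus_span q (L : 'M[K]_(n.+1 * n.+1, q)) :
  (forall t, diag_torus P t -> mxvec t *m L = 0) ->
  forall d, mxvec (dmat P d) *m L = 0.
Proof.
move=> h.
have hu d : dmat P d \in unitmx -> mxvec (dmat P d) *m L = 0.
  move=> /diag_torus_scale[|c [u [_ Tu ->]]]; first by exists d.
  by rewrite linearZ /= -scalemxAl h // scaler0.
have [a] : exists a, ~~ root ('X * ('X - 1%:P) : {poly K}) a.
  by apply/closed_nonrootP; rewrite mulf_neq0 ?polyX_eq0 ?polyXsubC_eq0.
rewrite rootE hornerM hornerX hornerXsubC mulf_eq0 negb_or => /andP[a0 a1].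
have hd i : mxvec (dmat P (delta_mx 0 i)) *m L = 0.
  apply: (scalerI a1); rewrite scaler0 scalemxAl -linearZ -dmatZ /=.
  have -> : (a - 1) *: delta_mx 0 i = (const_mx 1 + (a - 1) *: delta_mx 0 i) - const_mx 1 :> 'rV[K]_n.+1.
    by rewrite addrAC subrr add0r.
  rewrite -scaleN1r dmatD dmatZ linearD /= linearZ /= mulmxDl -scalemxAl !hu ?scaler0 ?addr0 //.
    by rewrite dmat_cst // unitmx1.
  rewrite unitmxE unitfE det_dmat //; apply/prodf_neq0 => j _; rewrite !mxE eqxx /=.
  by case: (j == i); rewrite ?mulr1 ?mulr0 ?addr0 ?oner_neq0 // addrC subrK.
move=> d; have -> : d = \sum_i d 0 i *: delta_mx 0 i by rewrite [LHS]row_sum_delta.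
rewrite dmat_sum raddf_sum /= mulmx_suml big1 // => i _.
by rewrite dmatZ linearZ /= -scalemxAl hd scaler0.
Qed.

(** The algebra is cut out by the off-diagonal entries of [P X P^-1]. Each of these linear forms
    vanishes on the torus, so it can be replaced by equations over [F]; the common solution space
    [S0] is defined over [F], and its rank can be computed over [K]. *)
Lemma diag_torus_rational_basis (F : fieldType) (iota : {rmorphism F -> K}) :
  defined_over iota (diag_torus P) ->
  exists e : 'M[F]_(n.+1, n.+1 * n.+1), row_free e /\
    forall X, (exists d, X = dmat P d) <-> (exists c, X = vec_mx (c *m map_mx iota e)).
Proof.
move=> hdef.
pose N := (n.+1 * n.+1)%N.
have hS (ij : 'I_n.+1 * 'I_n.+1) : exists S : 'M[F]_N, ij.1 != ij.2 ->
    (forall d, (mxvec (dmat P d) <= map_mx iota S)%MS) /\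
    forall X, (mxvec X <= map_mx iota S)%MS -> (P *m X *m invmx P) ij.1 ij.2 = 0.
  case: ij => i j; case: (eqVneq i j) => [->|ij]; first by exists 0 => /= /negP[].
  pose l := lin1_mx (mulmxr (col j (invmx P)) \o mulmx (row i P) \o vec_mx) : 'M_(N, 1).
  have lE X : mxvec X *m l = ((P *m X *m invmx P) i j)%:M.
    rewrite mul_rV_lin1 /= mxvecK [LHS]mx11_scalar; congr (_%:M).
    rewrite !mxE; apply: eq_bigr => k _; rewrite !mxE; congr (_ * _).
    by apply: eq_bigr => k' _; rewrite !mxE.
  have [|q [G [hG [y yE]]]] := linear_form_descent hdef (alpha := l).
    move=> t [[d ->] _]; rewrite lE dmatK // mxE (negPf ij) mulr0n.
    by rewrite -scalemx1 scale0r.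
  (* The kernel of [G] contains the torus, hence the algebra that it spans; it lies in the kernel of
     [l], which factors through [G]. *)
  exists (kermx G) => _; split=> [d|X]; rewrite map_kermx.
    exact/sub_kermxP/(diag_torus_span hG).
  move=> /sub_kermxP XG; have := lE X; rewrite yE mulmxA XG mul0mx.
  by move=> /matrixP/(_ 0 0); rewrite !mxE eqxx.
have /choice[S {}hS] := hS.
pose S0 := (\bigcap_(ij | ij.1 != ij.2) S ij)%MS.
have mapS : (map_mx iota S0 :=: \bigcap_(ij | ij.1 != ij.2) map_mx iota (S ij))%MS.
  rewrite /S0; elim/big_rec2: _ => [|ij A B _ IH]; first by rewrite map_mx1.
  by apply: eqmx_trans (map_capmx _ _ _) _; apply: cap_eqmx.
have hS0 X : (mxvec X <= map_mx iota S0)%MS <-> exists d, X = dmat P d.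
  rewrite mapS; split=> [/sub_bigcapmxP h|[d ->]].
    apply/dmatP => //; apply/is_diag_mxP => i j ij.
    by apply: ((hS (i, j) _).2 X); [|apply: (h (i, j))]; rewrite -val_eqE.
  by apply/sub_bigcapmxP => ij nij; exact: ((hS ij nij).1 d).
pose D : 'M[K]_(n.+1, N) := \matrix_i mxvec (dmat P (delta_mx 0 i)).
have DE c : c *m D = mxvec (dmat P c).
  rewrite [c in RHS]row_sum_delta dmat_sum raddf_sum /= mulmx_sum_row.
  by apply: eq_bigr => i _; rewrite rowK dmatZ linearZ.
have rD : row_free D.
  apply/inj_row_free => v; rewrite DE => /(canRL mxvecK); rewrite raddf0 => h.
  by apply: (dmat_inj uP); rewrite h dmat0.
have SD : (map_mx iota S0 :=: D)%MS.
  apply/eqmxP/andP; split; apply/rV_subP => v.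
    by rewrite -{1}(vec_mxK v) => /hS0[d]; rewrite -{2}(vec_mxK v) => ->; rewrite -DE submxMl.
  by move=> /submxP[c ->]; rewrite DE; apply/hS0; exists c.
have rk : \rank S0 = n.+1 by rewrite -(mxrank_map iota) SD; apply/eqP.
pose e : 'M[F]_(n.+1, N) := castmx (rk, erefl N) (row_base S0).
have eS : (map_mx iota e :=: map_mx iota S0)%MS.
  apply/eqmxP; rewrite !map_submx; apply/eqmxP.
  exact: eqmx_trans (eqmx_cast _ _) (eq_row_base _).
exists e; split.
  by rewrite /row_free -(mxrank_map iota) eS mxrank_map rk.
move=> X; rewrite -hS0 -eS; split=> [/submxP[c cE]|[c ->]].
  by exists c; rewrite -cE mxvecK.
by rewrite vec_mxK submxMl.
Qed.

End DiagonalSpan.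

(** * Descent to the quotient *)

Section QuasiProjective.

Variables (F K : fieldType) (iota : {rmorphism F -> K}) (N : nat).

(** A closed subset of projective space inherits stability under scaling from its open
    complement. *)
Lemma quasi_projective_cone (X : set 'rV[K]_N) : quasi_projective iota X -> cone X.
Proof.
move=> [Z [ZP oPZ] oX]; apply: zopen_cone oX.
split=> [v /ZP//|v w Zv vw]; apply: contrapT => nZw.
have [_ c] := zopen_cone (@cone_proj_space K N) oPZ.
have [|_ []//] := c w v _ (peq_sym vw).
by split=> //; apply: peq_neq0 vw _; exact: ZP.
Qed.

Lemma regular_function_peq (B : set 'rV[K]_N) h v w :
  cone B -> regular_function iota B h -> B v -> peq v w -> h v = h w.
Proof.
move=> cB hh Bv vw; have [d [a [b [ha hb bv E]]]] := hh v Bv.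
have Bw := cB.2 _ _ Bv vw.
case: vw => c c0 wE.
have bw : feval iota b w != 0.
  by rewrite wE (feval_homogZ _ _ _ hb) mulf_neq0 // expf_neq0.
rewrite (E v) // (E w) // wE (feval_homogZ _ _ _ ha) (feval_homogZ _ _ _ hb).
by rewrite -mulf_div divff ?mul1r // expf_neq0.
Qed.

End QuasiProjective.

Section Descent.

Variables (F K : fieldType) (iota : {rmorphism F -> K}) (p n M : nat).
Variables (T : set 'M[K]_n) (X : set 'rV[K]_#|incr p n|) (Q : set 'rV[K]_M).
Variables (pi : 'rV[K]_#|incr p n| -> 'rV[K]_M).
Hypothesis cQ : cone Q.
Hypothesis hpi : geometric_quotient iota T X Q pi.

Definition quotient_preimage (B : set 'rV[K]_M) : set 'rV[K]_#|incr p n| :=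
  [set x | X x /\ exists2 y, B y & peq (pi x) y].
Local Notation preim := quotient_preimage.

Lemma quotient_surjective y : Q y -> exists2 x, X x & peq (pi x) y.
Proof. by have [_ h _ _ _] := hpi; exact: h. Qed.

Lemma quotient_orbit x x' : X x -> X x' -> peq (pi x) (pi x') <-> orbit_set T x x'.
Proof. by have [_ _ h _ _] := hpi; exact: h. Qed.

Lemma quotient_regular : regular_map iota X Q pi.
Proof. by have [] := hpi. Qed.

Lemma quotient_open (B : set 'rV[K]_M) :
  B `<=` Q -> (forall y y', B y -> peq y y' -> B y') ->
  zariski_open iota Q B <-> zariski_open iota X (preim B).
Proof. by have [_ _ _ h _] := hpi; exact: h. Qed.

Section InvariantMap.

Variables (B0 : set 'rV[K]_M) (L : nat) (Y : set 'rV[K]_L).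
Variables (phi : 'rV[K]_#|incr p n| -> 'rV[K]_L) (psi : 'rV[K]_M -> 'rV[K]_L).
Hypotheses (oB0 : zariski_open iota Q B0) (cY : cone Y).
Hypothesis hphi : regular_map iota (preim B0) Y phi.
Hypothesis phiT : forall t x, T t -> preim B0 x -> peq (phi (gr_act p t x)) (phi x).
Hypothesis psiE : forall x y, preim B0 x -> B0 y -> peq (pi x) y -> peq (psi y) (phi x).

Let cB0 : cone B0 := zopen_cone cQ oB0.

Let lift_point y : B0 y -> exists x, preim B0 x /\ peq (pi x) y.
Proof.
move=> By; have [x Xx xy] := quotient_surjective (zopen_sub oB0 By).
by exists x; split=> //; split=> //; exists y.
Qed.

Let chart j : set 'rV[K]_M := [set y | B0 y /\ psi y 0 j != 0].

(** [psi] is an arbitrary function on vectors; its compatibility with scaling comes from [psiE] at a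
    common lift of [y] and [y']. *)
Let chart_peq j y y' : chart j y -> peq y y' -> chart j y'.
Proof.
move=> [By py] yy'; have By' := cB0.2 _ _ By yy'; split=> //.
have [x [Bx xy]] := lift_point By.
have h1 := psiE Bx By xy; have h2 := psiE Bx By' (peq_trans xy yy').
exact: peq_coord (peq_trans h1 (peq_sym h2)) py.
Qed.

Let chart_preim j : preim (chart j) = [set x | preim B0 x /\ phi x 0 j != 0].
Proof.
apply/seteqP; split=> x /=.
  move=> [Xx [y [By py] xy]]; have Bx : preim B0 x by split=> //; exists y.
  by split=> //; apply: peq_coord py; exact: psiE.
move=> [[Xx [y By xy]] px]; split=> //; exists y => //; split=> //.
have Bx : preim B0 x by split=> //; exists y.
exact: peq_coord (peq_sym (psiE Bx By xy)) px.
Qed.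

Let chart_open j : zariski_open iota Q (chart j).
Proof.
apply/quotient_open; [|exact: chart_peq|].
  by move=> y [By _]; exact: zopen_sub oB0 y By.
rewrite chart_preim; apply: zopen_trans (regular_map_coord_open _ hphi).
by apply/quotient_open => //; [exact: zopen_sub oB0|exact: cB0.2].
Qed.

(* The ratios [phi_k / phi_j] are invariant regular functions, so they descend. *)
Let descend_ratio j k : exists2 h', regular_function iota (chart j) h' &
  forall x, X x -> chart j (pi x) -> phi x 0 k / phi x 0 j = h' (pi x).
Proof.
have [_ _ _ _ h5] := hpi.
apply: (h5 (chart j) (fun x => phi x 0 k / phi x 0 j) (chart_open j)); last first.
  move=> t x Tt; rewrite -/(preim _) chart_preim => -[Bx px].
  have [c c0 E] := phiT Tt Bx.
  by rewrite E !mxE -mulf_div divff // mul1r.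
rewrite -/(preim _) chart_preim => v [Bv pv].
have [d [s [hs s0 h]]] := regular_mapE hphi Bv.
have [a ha aE] := hs k; have [b hb bE] := hs j.
exists d, a, b; split=> //.
  by rewrite bE; apply: peq_coord pv; apply/peq_sym/h.
move=> w [Bw pw]; rewrite aE bE => sw.
have [c c0 ->] := h w Bw (coord_neq0 sw).
by rewrite !mxE -mulf_div divff // mul1r.
Qed.

(** Near [y] some coordinate [j] of [psi] is nonzero. Dividing by coordinate [j] turns the
    coordinates of [phi] into invariant functions, which descend to quotients [a k / b k] of forms;
    clearing denominators gives forms that represent [psi]. *)
Lemma invariant_map_descends : regular_map iota B0 Y psi.
Proof.
have toY y x : B0 y -> preim B0 x -> peq (pi x) y -> Y (psi y).
  move=> By Bx xy; apply: cY.2 (regular_map_in hphi Bx) _.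
  exact/peq_sym/psiE.
apply: regular_map_local => y By.
  by have [x [Bx xy]] := lift_point By; exact: toY Bx xy.
have [x [Bx xy]] := lift_point By.
have [j pj] : exists j, psi y 0 j != 0.
  by apply: row_neq0_ex; apply: cY.1 (toY _ _ By Bx xy).
have Cy : chart j y by [].
have cC : cone (chart j) := zopen_cone cQ (chart_open j).
have /choice[h' hh'] : forall k, exists h', regular_function iota (chart j) h' /\
    forall x, X x -> chart j (pi x) -> phi x 0 k / phi x 0 j = h' (pi x).
  by move=> k; have [h' ? ?] := descend_ratio j k; exists h'.
have /choice[ab hab] : forall k, exists dab : nat * {mpoly F[M]} * {mpoly F[M]},
    [/\ dab.1.2 \is dab.1.1.-homog, dab.2 \is dab.1.1.-homog, feval iota dab.2 y != 0
      & forall w, chart j w -> feval iota dab.2 w != 0 ->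
          h' k w = feval iota dab.1.2 w / feval iota dab.2 w].
  by move=> k; have [d [a [b ?]]] := (hh' k).1 y Cy; exists (d, a, b).
pose a k := feval iota (ab k).1.2; pose b k := feval iota (ab k).2; pose d k := (ab k).1.1.
have ha k : formfun iota (d k) (a k) by apply: formfun_feval; case: (hab k).
have hb k : formfun iota (d k) (b k) by apply: formfun_feval; case: (hab k).
have /zopenP[_ /(_ y Cy)[e [chi [h1 h2 h3]]]] := chart_open j.
(* The factor [chi] confines the formula to the chart, and the product of the [b k] to the locus
   where all quotients are valid. *)
exists (e + \sum_k d k)%N, (fun w => chi w * \prod_k b k w), (\sum_k d k)%N,
  (fun w => \row_k (a k w * \prod_(l | l != k) b l w)); split.
- by apply: formfunM => //; apply: formfun_prod.
- move=> k; rewrite (bigD1 k) //=.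
  have : formfun iota (d k + \sum_(l | l != k) d l) (fun w => a k w * \prod_(l | l != k) b l w).
    by apply: formfunM => //; apply: formfun_prod.
  by apply: formfun_ext => w; rewrite mxE.
- by rewrite mulf_neq0 //; apply/prodf_neq0 => k _; case: (hab k).
move=> w Bw; rewrite mulf_eq0 negb_or => /andP[chiw pbw].
have Cw : chart j w by apply: h3 => //; exact: zopen_sub oB0 w Bw.
have [x' [Bx' xw]] := lift_point Bw.
have px' : phi x' 0 j != 0 by exact: peq_coord (psiE Bx' Bw xw) Cw.2.
have E : \row_k (a k w * \prod_(l | l != k) b l w) = (\prod_k b k w / phi x' 0 j) *: phi x'.
  apply/rowP => k; rewrite !mxE [in RHS](bigD1 k) //=.
  have bk : b k w != 0 by move/prodf_neq0: pbw; apply.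
  have [_ _ _ /(_ w Cw bk)] := hab k.
  have Cx' : chart j (pi x') by apply: cC.2 Cw (peq_sym xw).
  rewrite -(regular_function_peq cC (hh' k).1 Cx' xw) -(hh' k).2 //; last by case: Bx'.
  rewrite -/(a k w) -/(b k w) => hk.
  by rewrite -[a k w](divfK bk) -hk; ring.
rewrite E; split.
  by rewrite scaler_eq0 negb_or mulf_neq0 ?invr_eq0 // (coord_neq0 px').
apply: peq_trans (peq_sym (psiE Bx' Bw xw)).
by apply/peq_sym/peqZ; rewrite mulf_neq0 ?invr_eq0.
Qed.

End InvariantMap.

End Descent.

(** * The section of the quotient map *)

(** The columns of [C] are a basis of the column space of the cokernel of [W]. Their number is
    exactly the codimension [m], which makes the system for [t] one column short of square. *)
Lemma annihilator_exists (F : fieldType) (n r m : nat) (W : 'M[F]_n) :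
  \rank W = r -> n = (r + m)%N ->
  exists C : 'M[F]_(n, m), forall (K : fieldType) (iota : {rmorphism F -> K}) q (X : 'M[K]_(q, n)),
    (X <= map_mx iota W)%MS <-> X *m map_mx iota C = 0.
Proof.
move=> rW nE.
have rC : \rank (cokermx W) = m by rewrite mxrank_coker rW nE addKn.
exists (castmx (erefl n, rC) (col_base (cokermx W))) => K iota q X.
have castE r' m' (rE : r' = m') (B : 'M[F]_(n, r')) :
    X *m map_mx iota (castmx (erefl n, rE) B) = 0 <-> X *m map_mx iota B = 0.
  by case: m' / rE; rewrite castmx_id.
apply: iff_trans (iff_sym (castE _ _ rC _)).
rewrite submxE -map_cokermx -{1}(mulmx_base (cokermx W)) map_mxM mulmxA.
split=> [/eqP h|->]; last by rewrite mul0mx.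
by apply: (row_free_inj (_ : row_free (map_mx iota (row_base (cokermx W)))));
  rewrite ?h ?mul0mx // row_free_map row_base_free.
Qed.

Section SectionMap.

Variables (F : fieldType) (K : closedFieldType) (iota : {rmorphism F -> K}).
Variables (p m : nat).
Local Notation n := (p * m).+1.
Variables (P : 'M[K]_n) (e : 'M[F]_(n, n * n)) (W : 'M[F]_n) (C : 'M[F]_(n, m)).
Hypothesis p0 : (0 < p)%N.
Hypothesis uP : P \in unitmx.
Hypothesis free_e : row_free e.
Hypothesis eP : forall X, (exists d, X = dmat P d) <-> (exists c, X = vec_mx (c *m map_mx iota e)).
Hypothesis CP : forall q (X : 'M[K]_(q, n)),
  (X <= map_mx iota W)%MS <-> X *m map_mx iota C = 0.

Local Notation T := (diag_torus P).
Local Notation WK := (map_mx iota W).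
Implicit Types (A : 'M[K]_(p, n)) (X Y t u : 'M[K]_n) (x y z : 'rV[K]_#|incr p n|).

Definition in_algebra X : Prop := exists d, X = dmat P d.

Lemma in_algebraM X Y : in_algebra X -> in_algebra Y -> in_algebra (X *m Y).
Proof. by move=> [d ->] [d' ->]; rewrite dmatM //; eexists. Qed.

Lemma in_algebraD X Y : in_algebra X -> in_algebra Y -> in_algebra (X + Y).
Proof. by move=> [d ->] [d' ->]; rewrite -dmatD; eexists. Qed.

Lemma in_algebraZ a X : in_algebra X -> in_algebra (a *: X).
Proof. by move=> [d ->]; rewrite -dmatZ; eexists. Qed.

Lemma in_algebraV X : X \in unitmx -> in_algebra X -> in_algebra (invmx X).
Proof. by move=> u [d dE]; move: u; rewrite dE => u; rewrite dmatV //; eexists. Qed.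

Lemma in_algebra1 : in_algebra 1%:M.
Proof. by exists (const_mx 1); rewrite dmat_cst. Qed.

Lemma in_algebraC X Y : in_algebra X -> in_algebra Y -> X *m Y = Y *m X.
Proof. by move=> [d ->] [d' ->]; exact: dmatC. Qed.

Lemma diag_torus_in_algebra t : T t -> in_algebra t.
Proof. by case. Qed.

Lemma diag_torus_unit t : T t -> t \in unitmx.
Proof. by move=> [_ dt]; rewrite unitmxE dt unitr1. Qed.

(* Coordinates [c] of [t] in the basis [e] of the algebra satisfy [c *m translation_system A = 0]
   exactly when [A *m t] has rows in W: these are p * m equations in p * m + 1 unknowns. *)
Definition translation_system A : 'M[K]_(n, p * m) :=
  \matrix_i mxvec (A *m map_mx iota (vec_mx (row i e)) *m map_mx iota C).

(** This is the [t(A)] of the overview, found by Cramer's rule. *)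
Definition translation A : 'M[K]_n :=
  vec_mx (signed_minors (translation_system A) *m map_mx iota e).

Lemma translation_systemE A c :
  c *m translation_system A = mxvec (A *m vec_mx (c *m map_mx iota e) *m map_mx iota C).
Proof.
rewrite mulmx_sum_row [c *m map_mx iota e]mulmx_sum_row raddf_sum /= mulmx_sumr mulmx_suml.
rewrite raddf_sum; apply: eq_bigr => i _ /=.
rewrite rowK linearZ /= -scalemxAr -scalemxAl linearZ /=; congr (_ *: mxvec (_ *m _ *m _)).
by rewrite map_vec_mx map_row.
Qed.

Lemma translation_system_ker A c :
  c *m translation_system A = 0 <-> (A *m vec_mx (c *m map_mx iota e) <= WK)%MS.
Proof.
rewrite translation_systemE; apply: iff_trans (iff_sym (CP _)).
by split=> [/(canRL mxvecK)|->]; rewrite raddf0.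
Qed.

Lemma vec_mx_basis_inj c c' :
  vec_mx (c *m map_mx iota e) = vec_mx (c' *m map_mx iota e) -> c = c'.
Proof.
move=> /(can_inj vec_mxK); apply: row_free_inj.
by rewrite row_free_map.
Qed.

Lemma translation_in_algebra A : in_algebra (translation A).
Proof. by apply/eP; eexists. Qed.

Lemma translation_sub A : (A *m translation A <= WK)%MS.
Proof. by apply/translation_system_ker; exact: signed_minors_ker. Qed.

(** Genericity described without minors and up to a scalar. In this form it is easily carried along
    a change of basis of the subspace or a translation by a unit of the algebra. *)
Definition unique_translation A X : Prop :=
  [/\ in_algebra X, X \in unitmx, (A *m X <= WK)%MS
    & forall Y, in_algebra Y -> (A *m Y <= WK)%MS -> exists a, Y = a *: X].

Definition generic A : Prop := translation A \in unitmx.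

Lemma generic_unique A : generic A -> unique_translation A (translation A).
Proof.
move=> gA; split=> //; [exact: translation_in_algebra|exact: translation_sub|].
move=> Y /eP[c ->] /translation_system_ker h.
have [|a ->] := signed_minors_span _ h.
  apply: contraTneq gA; rewrite /generic /translation => ->.
  by rewrite mul0mx raddf0 unitmxE det0 unitr0.
by exists a; rewrite -scalemxAl linearZ.
Qed.

(** Uniqueness makes the solution space a line, so the signed minors are not all zero and
    [translation A] is a nonzero multiple of [X]. *)
Lemma unique_translationP A X : unique_translation A X ->
  generic A /\ exists2 a, a != 0 & translation A = a *: X.
Proof.
move=> [/eP[c XE] uX hX hY].
have c0 : c != 0.
  apply: contraTneq uX; rewrite XE => ->.
  by rewrite mul0mx raddf0 unitmxE det0 unitr0.
have s0 : signed_minors (translation_system A) != 0.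
  apply: (signed_minors_neq0 c0) => y /translation_system_ker yN.
  have [||a aE] := hY (vec_mx (y *m map_mx iota e)) => //; first by apply/eP; exists y.
  exists a; apply: vec_mx_basis_inj.
  by rewrite aE XE -scalemxAl linearZ.
have [a aE] := hY _ (translation_in_algebra A) (translation_sub A).
have a0 : a != 0.
  apply: contraNneq s0 => a0; apply/eqP/vec_mx_basis_inj.
  by rewrite mul0mx raddf0 -/(translation A) aE a0 scale0r.
by split; [rewrite /generic aE unitmxZ // unitfE|exists a].
Qed.

Lemma generic_mull (g : 'M[K]_p) A : g \in unitmx -> generic A ->
  generic (g *m A) /\ exists2 a, a != 0 & translation (g *m A) = a *: translation A.
Proof.
move=> ug /generic_unique[h1 h2 h3 h4]; apply: unique_translationP; split=> //.
  by rewrite -mulmxA (submx_trans _ h3) // submxMl.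
by move=> Y aY; rewrite -mulmxA eqmxMfull ?row_full_unit //; exact: h4.
Qed.

Lemma generic_mulr u A : u \in unitmx -> in_algebra u -> generic A -> generic (A *m u).
Proof.
move=> uu au /generic_unique[h1 h2 h3 h4].
have [] // := @unique_translationP (A *m u) (invmx u *m translation A).
split.
- exact/in_algebraM/h1/in_algebraV.
- by rewrite unitmx_mul unitmx_inv uu.
- by rewrite mulmxA mulmxK.
- move=> Y aY; rewrite -mulmxA => h; have [|a E] := h4 (u *m Y) _ h.
    exact: in_algebraM.
  by exists a; rewrite scalemxAr -E mulKmx.
Qed.

(** Both 1 and [u] move [A] into W, and the solutions form a line. *)
Lemma generic_sub_scalar A u : generic A -> (A <= WK)%MS -> in_algebra u -> (A *m u <= WK)%MS ->
  exists a, u = a%:M.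
Proof.
move=> /generic_unique[h1 h2 h3 h4] AW au Au.
have [|a aE] := h4 1%:M in_algebra1; first by rewrite mulmx1.
have [b ->] := h4 u au Au.
have a0 : a != 0.
  by apply: contra_eq_neq aE => ->; rewrite scale0r oner_neq0.
exists (b / a); rewrite -scalemx1 aE scalerA divfK //.
Qed.

Definition generic_locus : set 'rV[K]_#|incr p n| :=
  [set v | exists A, [/\ row_free A, generic A & v = plucker A]].

(** Sends a generic subspace to the point of [Gr p WK] in its orbit. A basis has to be chosen to get
    a function on vectors; [straighten_peq] shows that the choice matters only up to a scalar. *)
Definition straighten (v : 'rV[K]_#|incr p n|) : 'rV[K]_#|incr p n| :=
  let A := xget 0 [set A | row_free A /\ v = plucker A] in plucker (A *m translation A).

Lemma straighten_peq A : row_free A -> generic A ->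
  peq (plucker (A *m translation A)) (straighten (plucker A)).
Proof.
move=> rA gA; rewrite /straighten.
case: xgetP => [A' _ [rA' E]|/(_ A)/= h]; last by case: h.
have [g ug ->] := @plucker_peqE _ _ _ A A' rA ltac:(rewrite E; exact: peq_refl).
have [_ [a a0 ->]] := generic_mull ug gA.
rewrite -scalemxAr -[a *: _]mul_scalar_mx -(mulmxA g) (mulmxA a%:M).
apply: plucker_unitmul_peq; rewrite unitmx_mul ug andbT.
by rewrite unitmxE det_scalar unitfE expf_neq0.
Qed.

(** The degree is that of a minor of size [p * m] with entries of degree [d]; the matrices [e] and
    [C] are constant and over [F]. *)
Lemma translation_formfun N d (B : 'rV[K]_N -> 'M[K]_(p, n)) :
  (forall i j, formfun iota d (fun v => B v i j)) ->
  forall i j, formfun iota (p * m * d) (fun v => translation (B v) i j).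
Proof.
move=> hB.
have cst a b (G : 'M[F]_(a, b)) i j : @formfun F K iota N 0 (fun=> map_mx iota G i j).
  by apply: formfun_ext (formfun_cst iota N (G i j)) => v; rewrite mxE.
have hN i j : formfun iota d (fun v => translation_system (B v) i j).
  case/mxvec_indexP: j => a b.
  have := formfun_mulmx (formfun_mulmx hB (cst _ _ (vec_mx (row i e)))) (cst _ _ C) a b.
  rewrite !addn0; apply: formfun_ext => v.
  by rewrite [RHS]mxE mxvecE.
have hs (o : 'I_1) i :
    formfun iota (p * m * d) (fun v => signed_minors (translation_system (B v)) o i).
  rewrite ord1; have : formfun iota (p * m * d)
      (fun v => iota ((-1) ^+ i) * \det (row' i (translation_system (B v)))).
    apply/formfunZ/formfun_det => a b.
    by apply: formfun_ext (hN (lift i a) b) => v; rewrite [RHS]mxE.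
  by apply: formfun_ext => v; rewrite mxE rmorphXn rmorphN rmorph1.
move=> i j.
have := formfun_mulmx hs (cst _ _ e) 0 (mxvec_index i j).
rewrite addn0; apply: formfun_ext => v.
by rewrite [RHS]mxE.
Qed.

Lemma generic_locus_sub : generic_locus `<=` GrV p n.
Proof. by move=> v [A [rA _ ->]]; apply/GrV_plucker; exists A. Qed.

Lemma generic_locus_open : zariski_open iota (GrV p n) generic_locus.
Proof.
apply/zopenP; split=> [|v [A [rA gA ->]]]; first exact: generic_locus_sub.
have [k k0] := row_free_colsub rA.
have [B [hB BE]] := @chart_exists F K iota p n k.
(* Where coordinate [k] is nonzero, [B] is a basis of the subspace that is linear in the Plucker
   coordinates, and genericity is the nonvanishing of a determinant of size [n]. *)
exists (1 + n * (p * m * 1))%N, (fun w : 'rV[K]_#|incr p n| => w 0 k * \det (translation (B w))); split.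
- apply: formfunM; first exact: formfun_coord.
  by apply: formfun_det => i j; exact: translation_formfun.
- rewrite mulf_neq0 // BE -unitfE -unitmxE.
  apply: (generic_mull _ gA).1; apply: unitmx_adj.
  by rewrite -pluckerE.
- move=> w /GrV_plucker[A' rA' ->]; rewrite mulf_eq0 negb_or => /andP[k0'].
  rewrite BE -unitfE -unitmxE -/(generic _) => gA'.
  exists A'; split=> //.
  have ug : \adj (colsub (incr_fun k) A') \in unitmx by apply: unitmx_adj; rewrite -pluckerE.
  by rewrite -(mulKmx ug A'); apply: (generic_mull _ gA').1; rewrite unitmx_inv.
Qed.

Lemma generic_locus_cone : cone generic_locus.
Proof. exact: zopen_cone (cone_Gr _ p0) generic_locus_open. Qed.

Lemma straighten_Gr v : generic_locus v -> Gr p WK (straighten v).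
Proof.
move=> [A [rA gA ->]]; apply: (cone_Gr WK p0).2 (straighten_peq rA gA).
by exists (A *m translation A); rewrite row_free_unitmul // translation_sub.
Qed.

Lemma straighten_regular : regular_map iota generic_locus (Gr p WK) straighten.
Proof.
apply: regular_map_local => [v|v [A [rA gA ->]]]; first exact: straighten_Gr.
have [k k0] := row_free_colsub rA.
have [B [hB BE]] := @chart_exists F K iota p n k.
(* Entries of [B] have degree 1 and those of its translation degree [p * m], so the minors of size
   [p] of the product have degree [p * (1 + p * m)]. *)
exists 1%N, (fun w : 'rV[K]_#|incr p n| => w 0 k), (p * (1 + p * m * 1))%N,
  (fun w => plucker (B w *m translation (B w))).
split=> // [|j|w [A' [rA' gA' ->]] k0'].
- exact: formfun_coord.
- apply: formfun_ext (formfun_det (M := fun w => colsub (incr_fun j) (B w *m translation (B w))) _).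
    by move=> w; rewrite pluckerE.
  move=> a b; have := formfun_mulmx hB (translation_formfun hB) a (incr_fun j b).
  by apply: formfun_ext => w; rewrite [RHS]mxE.
- rewrite BE; set g := \adj _.
  have ug : g \in unitmx by apply: unitmx_adj; rewrite -pluckerE.
  have [gg [a a0 ->]] := generic_mull ug gA'.
  have E : peq (plucker (A' *m translation A')) (plucker (g *m A' *m (a *: translation A'))).
    rewrite -scalemxAr -mulmxA.
    apply: peq_trans (plucker_unitmul_peq _ ug) _; exact: plucker_scale_peq.
  split.
    by apply: (peq_neq0 E); rewrite plucker_neq0 row_free_unitmul.
  by apply: peq_trans (peq_sym E) _; exact: straighten_peq.
Qed.

Lemma orbit_sym x y : GrV p n x -> orbit_set T x y -> orbit_set T y x.
Proof.
move=> Vx [t Tt txy]; exists (invmx t).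
  by split; [exact/in_algebraV/diag_torus_in_algebra/Tt/diag_torus_unit|rewrite det_inv Tt.2 invr1].
apply: peq_trans (gr_act_peq _ (peq_sym txy)) _.
by rewrite -gr_actM mulmxV ?diag_torus_unit // GrV_act1 //; exact: peq_refl.
Qed.

Lemma orbit_trans x y z : orbit_set T x y -> orbit_set T y z -> orbit_set T x z.
Proof.
move=> [t Tt txy] [u Tu uyz]; exists (t *m u).
  split; first by apply: in_algebraM; [exact: Tt.1|exact: Tu.1].
  by rewrite det_mulmx Tt.2 Tu.2 mulr1.
by rewrite gr_actM; apply: peq_trans (gr_act_peq _ txy) uyz.
Qed.

Lemma orbit_peq x y z : orbit_set T x y -> peq y z -> orbit_set T x z.
Proof. by move=> [t Tt txy] yz; exists t => //; apply: peq_trans yz. Qed.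

Lemma orbit_GrV x y : GrV p n x -> orbit_set T x y -> GrV p n y.
Proof.
move=> Vx [t Tt]; apply: (cone_Gr _ p0).2; apply: GrV_act Vx.
exact: diag_torus_unit.
Qed.

Lemma generic_orbit x y : generic_locus x -> orbit_set T x y -> generic_locus y.
Proof.
move=> [A [rA gA ->]] [t Tt]; apply: generic_locus_cone.2.
have ut := diag_torus_unit Tt.
exists (A *m t); rewrite row_free_unitmul // gr_act_plucker; split=> //.
exact: generic_mulr ut Tt.1 gA.
Qed.

Lemma straighten_orbit x : generic_locus x -> orbit_set T x (straighten x).
Proof.
move=> [A [rA gA ->]].
have [c [u [c0 Tu E]]] := diag_torus_scale gA (translation_in_algebra A).
exists u => //; rewrite gr_act_plucker; apply: peq_trans (straighten_peq rA gA).
by rewrite E -scalemxAr; exact: plucker_scale_peq.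
Qed.

(** A torus element that keeps a generic [A] inside W is a scalar, and scalars fix every
    subspace. *)
Lemma generic_orbit_unique x y : generic_locus x -> Gr p WK x -> Gr p WK y ->
  orbit_set T x y -> peq x y.
Proof.
move=> [A [rA gA xE]] [A0 [rA0 A0W xE0]] [A' [rA' A'W ->]] [u Tu].
rewrite xE gr_act_plucker => Au; have uu := diag_torus_unit Tu.
have AW : (A <= WK)%MS.
  apply: submx_trans A0W; apply: plucker_peq_sub => //.
  by rewrite -xE xE0; exact: peq_refl.
have AuW : (A *m u <= WK)%MS.
  by apply: submx_trans A'W; apply: plucker_peq_sub => //; exact: peq_sym.
have [a aE] := generic_sub_scalar gA AW Tu.1 AuW.
apply: peq_trans Au; rewrite aE mul_mx_scalar; apply: plucker_scale_peq.
by apply: contraTneq uu => a0; rewrite aE a0 raddf0 unitmxE det0 unitr0.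
Qed.

Lemma straighten_act u x : generic_locus x -> T u ->
  peq (straighten (gr_act p u x)) (straighten x).
Proof.
move=> gx Tu; have Vx := generic_locus_sub gx.
have xu : orbit_set T x (gr_act p u x) by exists u => //; exact: peq_refl.
have gux := generic_orbit gx xu.
apply/peq_sym/generic_orbit_unique.
- exact: generic_orbit gx (straighten_orbit gx).
- exact: straighten_Gr.
- exact: straighten_Gr.
- apply: orbit_trans (orbit_sym Vx (straighten_orbit gx)) _.
  exact: orbit_trans xu (straighten_orbit gux).
Qed.

Lemma straighten_fix x : generic_locus x -> Gr p WK x -> peq (straighten x) x.
Proof.
move=> gx Wx; apply/peq_sym/generic_orbit_unique => //; first exact: straighten_Gr.
exact: straighten_orbit.
Qed.

Lemma finite_roots (Q : {poly K}) : Q != 0 -> finite_set [set a : K | root Q a].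
Proof.
move=> Q0; have [r E] := closed_field_poly_normal Q.
apply: (@sub_finite_set _ [set a : K | root Q a] [set` r]); last exact: finite_seq.
by move=> a /=; rewrite E rootZ ?lead_coef_eq0 // root_prod_XsubC.
Qed.

(** If [t] stabilizes the subspace, [t *m translation A] also moves it into W and is therefore a
    multiple of [translation A]. So [t] is a scalar [b], and determinant 1 gives [b ^+ n = 1]. *)
Lemma generic_finite_stabilizer x : generic_locus x ->
  finite_set [set t | T t /\ peq (gr_act p t x) x].
Proof.
move=> [A [rA gA ->]].
have fr : finite_set [set a : K | root ('X^n - 1) a].
  by apply: finite_roots; rewrite -size_poly_gt0 size_XnsubC.
apply: sub_finite_set (finite_image (fun a => a%:M : 'M[K]_n) fr) => t /= [Tt].
rewrite gr_act_plucker => /(plucker_peqE _) => h.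
have [|g ug E] := h; first by rewrite row_free_unitmul // diag_torus_unit.
have AE : A *m t = invmx g *m A by rewrite {2}E mulKmx.
have [h1 h2 h3 h4] := generic_unique gA.
have [||b bE] := h4 (t *m translation A).
- exact: in_algebraM Tt.1 h1.
- by rewrite mulmxA AE -mulmxA (submx_trans _ h3) // submxMl.
have tb : t = b%:M.
  by rewrite -(mulmxK h2 t) bE -scalemxAl mulmxV // scalemx1.
exists b; last by rewrite tb.
by rewrite /= rootE !hornerE -det_scalar -tb Tt.2 subrr.
Qed.

(* If [Y] is a nonscalar element of the algebra keeping A inside W, the points
   [A *m (1 + s Y)] trace a curve in the intersection of Gr(p, W) with the orbit. *)
Lemma translation_curve x A Y :
  GrV p n x -> finite_set [set t | T t /\ peq (gr_act p t x) x] ->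
  row_free A -> (A <= WK)%MS -> orbit_set T x (plucker A) ->
  in_algebra Y -> (A *m Y <= WK)%MS -> (forall a, Y != a%:M) ->
  irreducible_chain idfun (Gr p WK `&` orbit_set T x) 1.
Proof.
move=> Vx fin rA AW xA aY AY nY.
pose L s : 'M[K]_n := 1%:M + s *: Y.
pose X := Gr p WK `&` orbit_set T x.
pose y := plucker A.
have aL s : in_algebra (L s) by apply/in_algebraD/in_algebraZ => //; exact: in_algebra1.
have AL s : (A *m L s <= WK)%MS.
  by rewrite mulmxDr mulmx1 -scalemxAr addmx_sub // scalemx_sub.
have L0 : L 0 = 1%:M by rewrite /L scale0r addr0.
have pathL i j : polypath (fun s => L s i j).
  have [Q hQ] := polypathD (polypath_cst (1%:M i j)) (polypathM (polypath_id K) (polypath_cst (Y i j))).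
  by exists Q => s; rewrite -hQ !mxE.
have pathd : polypath (fun s => \det (L s)).
  exact: (funring_det (@polypath_cst K) (@polypathD K) (@polypathM K) pathL).
have pathAL i j : polypath (fun s => (A *m L s) i j).
  apply: (funring_mulmx (@polypath_cst K) (@polypathD K) (@polypathM K) _ pathL i j).
  by move=> a b; exact: polypath_cst.
have pathp j : polypath (fun s => plucker (A *m L s) 0 j) by exact: polypath_plucker.
have d0 : \det (L 0) != 0 by rewrite L0 det1 oner_neq0.
have inX s : \det (L s) != 0 -> X (plucker (A *m L s)).
  move=> ds; have uL : L s \in unitmx by rewrite unitmxE unitfE.
  split; first by exists (A *m L s); rewrite row_free_unitmul.
  have [c [u [c0 Tu E]]] := diag_torus_scale uL (aL s).
  apply: orbit_trans xA _; exists u => //; rewrite gr_act_plucker E -scalemxAr.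
  exact: plucker_scale_peq.
have cX : cone X.
  split=> [v [Wv _]|v w [Wv Ov] vw]; first exact: (cone_Gr _ p0).1 Wv.
  by split; [exact: (cone_Gr _ p0).2 Wv vw|exact: orbit_peq Ov vw].
pose S := [set v | exists2 s, \det (L s) != 0 & v = plucker (A *m L s)].
(* The chain consists of the point [Z0] at [s = 0] and of the closure [Z1] of the curve [S] in
   [X]. *)
pose Z1 := [set v | X v /\ forall d phi, formfun idfun d phi ->
              (forall w, S w -> phi w = 0) -> phi v = 0].
pose Z0 := [set v | peq y v].
have yX : X y by rewrite /y -[A]mulmx1 -L0; exact: inX.
have SZ1 : S `<=` Z1.
  move=> v [s ds ->]; split; first exact: inX.
  by move=> d phi _; apply; exists s.
have Z0X : Z0 `<=` X by move=> v; exact: cX.2.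
have Z0Z1 : Z0 `<=` Z1.
  move=> v yv; split; first exact: Z0X.
  move=> d phi hphi h; case: yv => c _ ->; rewrite (formfun_scale _ _ hphi) h ?mulr0 //.
  by exists 0 => //; rewrite L0 mulmx1.
have closed0 : zariski_closed idfun X Z0.
  split=> //; apply/zopenP; split=> [v []//|v [Xv nv]].
  have [i [j ij]] : exists i j, y 0 i * v 0 j - y 0 j * v 0 i != 0.
    apply: contrapT => h; apply: nv; apply: peq_minors.
    - exact: cX.1 yX.
    - exact: cX.1 Xv.
    - move=> i j; apply/eqP; rewrite -subr_eq0; apply/negPn/negP => ne.
      by apply: h; exists i, j.
  exists 1%N, (fun v => y 0 i * v 0 j - y 0 j * v 0 i); split=> //.
    apply: formfunD; first exact: (formfunZ (iota := idfun)) (formfun_coord _ _).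
    exact/formfunN/(formfunZ (iota := idfun))/formfun_coord.
  move=> w Xw ne; split=> // -[c _ wE]; move: ne.
  have wc k : w 0 k = c * y 0 k by rewrite wE mxE.
  by rewrite !wc mulrCA [X in _ - X]mulrCA [y 0 j * _]mulrC subrr eqxx.
have closed1 : zariski_closed idfun X Z1.
  split=> [v []//|]; apply/zopenP; split=> [v []//|v [Xv nv]].
  have [d [phi [hphi h pv]]] : exists d phi,
      [/\ formfun idfun d phi, forall w, S w -> phi w = 0 & phi v != 0].
    apply: contrapT => h; apply: nv; split=> // d phi hphi hS.
    by apply/eqP/negPn/negP => ne; apply: h; exists d, phi.
  exists d, phi; split=> // w Xw pw; split=> // -[_ /(_ d phi hphi h) p0'].
  by rewrite p0' eqxx in pw.
have irr0 : irreducible_set idfun Z0.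
  split=> [|O O' oO oO' [v Ov] [w O'w]]; first by exists y; exact: peq_refl.
  have cZ0 : cone Z0.
    split=> [v' /Z0X /cX.1//|v' w' yv vw]; exact: peq_trans yv vw.
  have Zv := zopen_sub oO Ov; have Zw := zopen_sub oO' O'w.
  exists y; split.
    exact: (zopen_cone cZ0 oO).2 Ov (peq_sym Zv).
  exact: (zopen_cone cZ0 oO').2 O'w (peq_sym Zw).
have irr1 : irreducible_set idfun Z1.
  split=> [|O O' oO oO' [v Ov] [w O'w]]; first by exists y; apply: Z0Z1; exact: peq_refl.
  (* A nonempty open subset of [Z1] meets the curve, since a form vanishing on the curve vanishes on
     [Z1]. Two such subsets then share a point of the curve, at a parameter that is a root of
     neither form. *)
  have pt O1 v1 : zariski_open idfun Z1 O1 -> O1 v1 -> exists d phi s,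
    [/\ formfun idfun d phi, phi (plucker (A *m L s)) != 0
      & forall w, Z1 w -> phi w != 0 -> O1 w].
    move=> /[dup] o1 /zopenP[OZ /(_ v1) h] Ov1.
    have [d [phi [h1 h2 h3]]] := h Ov1.
    have [s ps] : exists s, \det (L s) != 0 /\ phi (plucker (A *m L s)) != 0.
      apply: contrapT => ns; case/negP: h2; apply/eqP.
      apply: (OZ _ Ov1).2 h1 _ => u [s ds ->].
      by apply/eqP/negPn/negP => ne; apply: ns; exists s.
    by exists d, phi, s; split=> //; case: ps.
  have [d [phi [s [h1 h2 h3]]]] := pt _ _ oO Ov.
  have [d' [phi' [s' [h1' h2' h3']]]] := pt _ _ oO' O'w.
  have [r [r1 r2 r3]] := polypath_common (polypath_formfun h1 pathp)
    (polypath_formfun h1' pathp) pathd h2 h2' d0.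
  have Zr : Z1 (plucker (A *m L r)) by apply: SZ1; exists r.
  by exists (plucker (A *m L r)); split; [exact: h3|exact: h3'].
have Z10 : ~ (Z1 `<=` Z0).
  (* If the curve were a single point, every invertible [L s] would fix [y]. As [T] is commutative,
     the elements of [T] fixing [y] also fix [x], so [L s] would be proportional to one of finitely
     many [u]. *)
  move=> sub; have /finite_seqP[r rE] := fin.
  have stab s : \det (L s) != 0 -> exists2 u, u \in r & exists2 c, c != 0 & L s = c *: u.
    move=> ds; have uL : L s \in unitmx by rewrite unitmxE unitfE.
    have [c [u [c0 Tu E]]] := diag_torus_scale uL (aL s).
    exists u; last by exists c.
    suff : [set` r] u by [].
    rewrite -rE; split=> //.
    have yLs : peq y (plucker (A *m L s)) by apply: sub; apply: SZ1; exists s.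
    have [t Tt xt] := xA.
    have yu : peq (gr_act p u y) y.
      rewrite gr_act_plucker; apply: peq_sym; apply: peq_trans yLs _.
      by rewrite E -scalemxAr; apply/peq_sym/plucker_scale_peq.
    have tV : peq (gr_act p (invmx t) y) x.
      apply: peq_trans (gr_act_peq _ (peq_sym xt)) _.
      by rewrite -gr_actM mulmxV ?diag_torus_unit // GrV_act1 //; exact: peq_refl.
    apply: peq_trans (gr_act_peq _ (peq_sym tV)) _.
    rewrite -gr_actM (in_algebraC (in_algebraV (diag_torus_unit Tt) Tt.1) Tu.1) gr_actM.
    exact: peq_trans (gr_act_peq _ yu) tV.
  (* From [c' L s = c L s'], the matrix [(c s' - c' s) Y] is scalar; as [Y] is not, [c s' = c' s],
     and then [c' = c]. *)
  have uniq_s s s' u c c' : c != 0 -> c' != 0 -> L s = c *: u -> L s' = c' *: u -> s = s'.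
    move=> c0 c0' E E'.
    have H : (c' - c) *: 1%:M = (c * s' - c' * s) *: Y.
      have : c' *: L s = c *: L s' by rewrite E E' !scalerA mulrC.
      rewrite /L !scalerDr !scalerA => h; rewrite !scalerBl; apply/eqP.
      by rewrite subr_eq addrAC eq_sym subr_eq addrC -h addrC eqxx.
    have [z|nz] := eqVneq (c * s' - c' * s) 0; last first.
      case/negP: (nY ((c * s' - c' * s)^-1 * (c' - c))).
      by rewrite -scalemx1 -scalerA H scalerA mulVf // scale1r.
    have cc : c' = c.
      have := congr1 (fun M : 'M[K]_n => M 0 0) H.
      by rewrite z scale0r !mxE eqxx mulr1 => /eqP; rewrite subr_eq0 => /eqP.
    move/eqP: z; rewrite cc -mulrBr mulf_eq0 (negPf c0) subr_eq0 => /eqP.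
    by move->.
  (* [sg u] is the only parameter that [u] can account for, or 0 if there is none. A parameter with
     [L s] invertible that avoids the finitely many [sg u] contradicts [stab]. *)
  have /choice[sg hsg] : forall u, exists s,
      (exists s' c, [/\ c != 0, \det (L s') != 0 & L s' = c *: u]) ->
      exists2 c, c != 0 & L s = c *: u.
    move=> u; have [[s' [c [c0 _ E]]]|h] := pselect (exists s' c,
      [/\ c != 0, \det (L s') != 0 & L s' = c *: u]).
      by exists s' => _; exists c.
    by exists 0 => /h.
  have [Q Q0 hQ] := polypath_nonzero pathd d0.
  have : Q * \prod_(u <- r) ('X - (sg u)%:P) != 0.
    rewrite mulf_neq0 //; apply: monic_neq0; exact: monic_prod_XsubC.
  move=> /closed_nonrootP[s]; rewrite rootE hornerM mulf_eq0 negb_or -hQ => /andP[ds].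
  have [u ur [c c0 E]] := stab s ds.
  have [|c' c0' E'] := hsg u; first by exists s, c.
  by rewrite -rootE -(big_map sg xpredT (fun a => 'X - a%:P)) root_prod_XsubC
     (uniq_s _ _ _ _ _ c0 c0' E E') map_f.
exists (fun i => if i is 0%N then Z0 else Z1); split; first by case=> [|i] _.
by case=> // _; split.
Qed.

(** At a point [A] of the intersection, 1 is a solution. A solution not proportional to 1 would give
    an irreducible chain of length 1, against dimension 0; so [A] is generic. *)
Lemma transverse_generic x :
  GrV p n x -> finite_set [set t | T t /\ peq (gr_act p t x) x] ->
  (Gr p WK `&` orbit_set T x) !=set0 -> zariski_dim idfun (Gr p WK `&` orbit_set T x) 0 ->
  exists y, [/\ generic_locus y, Gr p WK y & orbit_set T x y].
Proof.
move=> Vx fin [_ [[A [rA AW ->]] xA]] [_ hdim].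
have Wy : Gr p WK (plucker A) by exists A.
exists (plucker A); split=> //; exists A; split=> //.
have [] // := @unique_translationP A 1%:M.
split; [exact: in_algebra1|exact: unitmx1|by rewrite mulmx1|].
move=> Y aY AY; apply: contrapT => nY.
suff : (1 <= 0)%N by [].
apply/hdim/(translation_curve Vx fin rA AW xA aY AY).
by move=> a; apply/eqP => E; apply: nY; exists a; rewrite E scalemx1.
Qed.

Lemma stable_locus_cone : cone (stable_locus p iota T).
Proof.
split=> [v [Vv _]|v w [Vv [d [f [hd hT fv hD fin]]]] vw]; first exact: (cone_Gr _ p0).1 Vv.
split; first exact: (cone_Gr _ p0).2 Vv vw.
exists d, f; split=> //.
  by case: vw => c c0 ->; rewrite (feval_homogZ _ _ _ hd.2) mulf_neq0 // expf_neq0.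
apply: sub_finite_set fin => t [Tt tw]; split=> //.
by apply: peq_trans (gr_act_peq _ vw) _; apply: peq_trans tw (peq_sym vw).
Qed.

Lemma stable_locus_sub : stable_locus p iota T `<=` GrV p n.
Proof. by move=> v []. Qed.

Section RationalSection.

Variables (M : nat) (Q : set 'rV[K]_M) (pi : 'rV[K]_#|incr p n| -> 'rV[K]_M).
Local Notation X := (stable_locus p iota T).
Hypotheses (cQ : cone Q) (hpi : geometric_quotient iota T X Q pi).
Hypothesis htr : transverse p iota T WK.

Lemma section_birational : exists U U' g,
  U `<=` X /\ birational_between iota (Gr p WK) U Q U' pi g.
Proof.
have [x [[Vx [d [f [[d0 hd] hT fx hD fin]]]] hne hdim]] := htr.
have [y [gy Wy [t Tt xy]]] := transverse_generic Vx fin hne hdim.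
have hf := formfun_feval iota hd.
have f_peq v w : peq v w -> feval iota f v != 0 -> feval iota f w != 0.
  by move=> [c c0 ->] fv; rewrite (formfun_scale _ _ hf) mulf_neq0 // expf_neq0.
have fy : feval iota f y != 0 by apply: (f_peq _ _ xy); rewrite hT.
(* The form [f] witnessing stability of [x] witnesses it on all of [X0]: the orbits where [f] is
   nonzero are closed there, and generic points have finite stabilizers. *)
pose X0 := generic_locus `&` [set v | GrV p n v /\ feval iota f v != 0].
have oX0 : zariski_open iota (GrV p n) X0.
  by apply: zopenI generic_locus_open _; exact: zopen_form hf.
have X0X : X0 `<=` X.
  move=> v [gv [Vv fv]]; split=> //; exists d, f; split=> //.
  exact: generic_finite_stabilizer.
have cX := stable_locus_cone.
have WV : Gr p WK `<=` GrV p n := @Gr_sub_GrV _ _ _ _.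
have cX0 : cone X0 := zopen_cone (cone_Gr _ p0) oX0.
have X0_orbit v w : X0 v -> orbit_set T v w -> X0 w.
  move=> [gv [Vv fv]] vw; split; first exact: generic_orbit gv vw.
  split; first exact: orbit_GrV Vv vw.
  by case: vw => u Tu /f_peq; apply; rewrite hT.
have oX : zariski_open iota X X0.
  have := zopen_restr stable_locus_sub oX0.
  by rewrite setIidr //; exact: X0X.
pose U := Gr p WK `&` X0.
(* The image of [X0] in the quotient. It is open because [X0], being a union of orbits, is its full
   preimage. *)
pose U' := [set z | Q z /\ exists2 v, X0 v & peq (pi v) z].
have preimU' : quotient_preimage X pi U' = X0.
  apply/seteqP; split=> v.
    move=> [Xv [z [_ [w X0w wz]] vz]].
    apply: (X0_orbit _ _ X0w); apply/(quotient_orbit hpi) => //; first exact: X0X.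
    exact: peq_trans wz (peq_sym vz).
  move=> X0v; have Xv := X0X _ X0v; split=> //; exists (pi v); last exact: peq_refl.
  split; first exact: regular_map_in (quotient_regular hpi) Xv.
  by exists v => //; exact: peq_refl.
have oU' : zariski_open iota Q U'.
  apply/(quotient_open hpi); [by move=> z []| |by rewrite preimU'].
  move=> z z' [Qz [v X0v vz]] zz'; split; first exact: cQ.2 Qz zz'.
  by exists v => //; apply: peq_trans zz'.
have straight_orbit v w : X0 v -> orbit_set T v w -> peq (straighten v) (straighten w).
  move=> [gv _] [u Tu uw]; apply: peq_trans (peq_sym (straighten_act gv Tu)) _.
  apply: regular_map_peq straighten_regular _ uw; first exact: generic_locus_cone.
  by apply: generic_orbit gv _; exists u => //; exact: peq_refl.
have straight_U v : X0 v -> U (straighten v).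
  move=> /[dup] X0v [gv _]; split; first exact: straighten_Gr.
  exact: X0_orbit _ _ X0v (straighten_orbit gv).
(* The inverse of [pi] straightens a lift; two lifts lie in one orbit, so the result is determined
   up to a scalar. *)
pose g (z : 'rV[K]_M) := straighten (xget 0 [set v | X0 v /\ peq (pi v) z]).
have gE v (z : 'rV[K]_M) : X0 v -> U' z -> peq (pi v) z -> peq (g z) (straighten v).
  move=> X0v [Qz [w X0w wz]] vz; rewrite /g.
  case: xgetP => [w' _ [X0w' wz']|/(_ w)/= h]; last by case: h.
  apply: straight_orbit => //; apply/(quotient_orbit hpi); [exact: X0X..|].
  exact: peq_trans wz' (peq_sym vz).
have dU : dense_open iota (Gr p WK) U.
  apply: Gr_dense_open; first exact: zopen_restr WV oX0.
  by exists y; split=> //; split=> //; split=> //; exact: WV.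
have dU' : dense_open iota Q U'.
  split=> // O oO [z Oz].
  have [v Xv vz] := quotient_surjective hpi (zopen_sub oO Oz).
  have oO' : zariski_open iota X (quotient_preimage X pi O).
    by apply/(quotient_open hpi) => //; [exact: zopen_sub oO|exact: (zopen_cone cQ oO).2].
  (* The preimage of [O] is open in the stable locus, but the form [psi] describing it near [v]
     makes sense on all of [GrV]; irreducibility of [GrV] gives a point of [X0] where [psi] is
     nonzero. *)
  have [|e' [psi [h1 h2 h3]]] := (iffLR (zopenP _ _ _) oO').2 v; first by split=> //; exists z.
  have [w X0w] : X0 !=set0 by exists y; split=> //; split=> //; exact: WV.
  have [_ dX0] := Gr_dense_open oX0 (ex_intro _ w X0w).
  have [|w' [[Vw' pw'] X0w']] := dX0 _ (zopen_form (GrV p n) h1).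
    by exists v; split=> //; exact: stable_locus_sub.
  have [_ [z' Oz' wz']] := h3 w' (X0X _ X0w') pw'.
  by exists z'; split=> //; split; [exact: zopen_sub oO z' Oz'|exists w'].
have cU : cone U := zopen_cone (cone_Gr _ p0) dU.1.
exists U, U', g; split; first by move=> v [_ /X0X].
split.
- by split.
- apply: (regular_map_restr (quotient_regular hpi)) => v [Wv X0v]; first exact: X0X.
  split; first exact/(regular_map_in (quotient_regular hpi))/X0X.
  by exists v => //; exact: peq_refl.
- apply: (@invariant_map_descends _ _ _ _ _ _ _ _ _ _ cQ hpi U' _ U straighten g oU' cU).
  + rewrite preimU'; apply: (regular_map_restr straighten_regular); last exact: straight_U.
    by move=> v [].
  + by rewrite preimU' => u v Tu [gv _]; exact: straighten_act.
  + by rewrite preimU' => v z X0v; exact: gE.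
- move=> v [Wv X0v]; have [gv _] := X0v.
  apply: peq_trans (straighten_fix gv Wv); apply: gE => //; last exact: peq_refl.
  split; first exact/(regular_map_in (quotient_regular hpi))/X0X.
  by exists v => //; exact: peq_refl.
- move=> z U'z; have [Qz [v X0v vz]] := U'z.
  have gz := gE _ _ X0v U'z vz.
  have X0s : X0 (straighten v) by case: (straight_U _ X0v).
  have X0g : X0 (g z) := cX0.2 _ _ X0s (peq_sym gz).
  apply: peq_trans vz; apply: peq_trans (regular_map_peq cX (quotient_regular hpi) (X0X _ X0g) gz) _.
  apply/(quotient_orbit hpi); [exact: X0X..|].
  have [gv [Vv _]] := X0v.
  exact: orbit_sym Vv (straighten_orbit gv).
Qed.

End RationalSection.

End SectionMap.

(** * Equivariant birational maps and products with projective space *)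

Section EquivariantBirational.

Variables (F K : fieldType) (iota : {rmorphism F -> K}).
Variables (gT : finGroupType) (G : {group gT}).
Variables (N M : nat) (X : set 'rV[K]_N) (Y : set 'rV[K]_M).
Variables (actX : gT -> 'rV[K]_N -> 'rV[K]_N) (actY : gT -> 'rV[K]_M -> 'rV[K]_M).
Hypotheses (cX : cone X) (cY : cone Y).
Hypotheses (vX : variety_action iota G X actX) (vY : variety_action iota G Y actY).

Lemma action_in h x : h \in G -> X x -> X (actX h x).
Proof. by have [r _ _] := vX => /r/regular_map_in; apply. Qed.

Lemma action_peq h x x' : h \in G -> X x -> peq x x' -> peq (actX h x) (actX h x').
Proof. by have [r _ _] := vX => /r/(regular_map_peq cX); apply. Qed.

Lemma actionM h k x : h \in G -> k \in G -> X x -> peq (actX (h * k)%g x) (actX k (actX h x)).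
Proof. by have [_ _] := vX; apply. Qed.

Lemma actionKV h x : h \in G -> X x -> peq (actX h^-1%g (actX h x)) x.
Proof.
move=> Gh Xx; have [_ a1 _] := vX; apply: peq_trans (a1 x Xx).
apply: peq_sym; rewrite -{1}(mulgV h).
exact: actionM (groupVr Gh) Xx.
Qed.

Lemma dense_open_translate h U : h \in G -> dense_open iota X U ->
  dense_open iota X [set x | X x /\ U (actX h x)].
Proof.
move=> Gh dU; have [rX a1 aM] := vX; have cU := zopen_cone cX dU.1.
split; first exact: regular_map_preimage cX (rX h Gh) dU.1.
move=> O oO [x Ox]; have Xx := zopen_sub oO Ox.
have cO := zopen_cone cX oO.
have oO' := regular_map_preimage cX (rX _ (groupVr Gh)) oO.
have [|x' [[Xx' Ox'] Ux']] := dU.2 _ oO'.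
  exists (actX h x); split; first exact: action_in.
  exact: cO.2 Ox (peq_sym (actionKV Gh Xx)).
exists (actX h^-1%g x'); split=> //; split; first exact: action_in (groupVr Gh) Xx'.
apply: cU.2 Ux' _; apply: peq_sym.
by have := actionKV (groupVr Gh) Xx'; rewrite invgK.
Qed.

(** [equivariant_on] says nothing about points that leave [U], whereas transporting an action needs
    a stable domain; the finitely many translates of [U] are intersected. *)
Lemma equivariantly_birational_stable :
  equivariantly_birational iota G X actX Y actY ->
  exists U U' f g, [/\ birational_between iota X U Y U' f g,
    equivariant_on G U actX actY f
    & forall h x, h \in G -> U x -> U (actX h x)].
Proof.
move=> [U [U' [f [g [bir eqv]]]]]; have [[dU dU'] _ _ _ _] := bir.
have cU := zopen_cone cX dU.1.
(* The index [h] runs over the whole type [gT], so elements outside [G] get the trivial condition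
   [X]. *)
pose V := [set x | X x /\ forall h, (if h \in G then [set x | X x /\ U (actX h x)] else X) x].
have dV : dense_open iota X V.
  apply: dense_open_bigcap => h; case: ifP => Gh; last exact: dense_open_full.
  exact: dense_open_translate.
exists (U `&` V), [set y | U' y /\ V (g y)], f, g; split.
- exact: birational_between_restr.
- by move=> h x Gh [Ux _] [Uhx _]; exact: eqv.
- move=> h x Gh [Ux [Xx Vx]]; split; first by have := Vx h; rewrite Gh => -[].
  split=> [|k]; first exact: action_in.
  case: ifP => Gk; last exact: action_in.
  split; first exact: action_in.
  have := Vx (h * k)%g; rewrite groupM // => -[_].
  by move/cU.2; apply; exact: actionM.
Qed.

End EquivariantBirational.

Section LinearizableTransfer.

Variables (F K : fieldType) (iota : {rmorphism F -> K}).
Variables (gT : finGroupType) (G : {group gT}).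
Variables (N M : nat) (X : set 'rV[K]_N) (Y : set 'rV[K]_M).
Variables (actX : gT -> 'rV[K]_N -> 'rV[K]_N) (actY : gT -> 'rV[K]_M -> 'rV[K]_M).
Hypotheses (cX : cone X) (cY : cone Y) (vY : variety_action iota G Y actY).

(** On the stable domain [actY] is the conjugate of [actX] by the birational map ([back]), so
    freeness and the linearization of [X] are carried over by the inverse [g]. *)
Lemma linearizable_transfer :
  equivariantly_birational iota G X actX Y actY ->
  linearizable iota G X actX -> linearizable iota G Y actY.
Proof.
move=> eqb [vX [U0 dU0 free] [d [rV [V [V' [f1 [g1 [bir1 eqv1]]]]]]]].
have [U [U' [f [g [bir eqv st]]]]] := equivariantly_birational_stable cX cY vX eqb.
have [[dU dU'] rf rg gf fg] := bir.
have cU := zopen_cone cX dU.1; have cU' := zopen_cone cY dU'.1.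
have back h y : h \in G -> U' y -> peq (f (actX h (g y))) (actY h y).
  move=> Gh U'y; have Ugy := regular_map_in rg U'y.
  apply: peq_trans (eqv h _ Gh Ugy (st h _ Gh Ugy)) _.
  apply: (action_peq cY vY Gh) (fg _ U'y).
  exact: zopen_sub dU'.1 _ (regular_map_in rf Ugy).
split=> //.
- exists [set y | U' y /\ U0 (g y)].
    by have [[]] := birational_between_restr cX cY bir dU0.
  move=> h y Gh [U'y U0gy] hy; have Ugy := regular_map_in rg U'y.
  have Uh := st h _ Gh Ugy.
  apply: (free h (g y)) => //; apply: peq_trans (peq_sym (gf _ Uh)) _.
  apply: (regular_map_peq cU' rg); first exact: regular_map_in rf Uh.
  exact: peq_trans (back h y Gh U'y) hy.
- exists d, rV, [set y | U' y /\ V (g y)], [set z | V' z /\ U (g1 z)], (f1 \o g), (f \o g1).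
  split.
    exact: birational_between_trans cY cX (@cone_proj_space K d.+1)
      (birational_between_sym bir) bir1.
  have [[dV _] rf1 _ _ _] := bir1; have cV := zopen_cone cX dV.1.
  move=> h y Gh [U'y Vgy] [U'hy Vghy] /=.
  have Ugy := regular_map_in rg U'y; have Uh := st h _ Gh Ugy.
  have E : peq (g (actY h y)) (actX h (g y)).
    apply: peq_trans (gf _ Uh); apply: (regular_map_peq cU' rg U'hy).
    exact: peq_sym (back h y Gh U'y).
  apply: peq_trans (regular_map_peq cV rf1 Vghy E) _.
  by apply: eqv1 => //; exact: cV.2 Vghy E.
Qed.

End LinearizableTransfer.

(** * Products with projective space in the Segre embedding *)

Section Segre.

Variables (K : fieldType) (N r : nat).
Implicit Types (v : 'rV[K]_N) (w : 'rV[K]_r.+1).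

Definition segre_point v w : 'rV[K]_(N * r.+1) := mxvec (v^T *m w).

Lemma segre_pointE v w i j : segre_point v w 0 (mxvec_index i j) = v 0 i * w 0 j.
Proof. by rewrite mxvecE mxE big_ord1 mxE. Qed.

Lemma segre_point_scale a b v w : segre_point (a *: v) (b *: w) = (a * b) *: segre_point v w.
Proof.
by apply/rowP => k; case/mxvec_indexP: k => i j; rewrite [RHS]mxE !segre_pointE !mxE mulrACA.
Qed.

Lemma segre_point_peq v v' w w' :
  peq v v' -> peq w w' -> peq (segre_point v w) (segre_point v' w').
Proof.
move=> [a a0 ->] [b b0 ->]; exists (a * b); first by rewrite mulf_neq0.
exact: segre_point_scale.
Qed.

Lemma segre_point_neq0 v w : v != 0 -> w != 0 -> segre_point v w != 0.
Proof.
move=> /row_neq0_ex[i vi] /row_neq0_ex[j wj].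
by apply: (@coord_neq0 _ _ _ (mxvec_index i j)); rewrite segre_pointE mulf_neq0.
Qed.

Lemma scale_peq L (u u' : 'rV[K]_L) c : u' != 0 -> u' = c *: u -> peq u u'.
Proof. by move=> u0 E; exists c => //; apply: contraNneq u0 => c0; rewrite E c0 scale0r. Qed.

Lemma segre_point_inj v v' w w' : v' != 0 -> w' != 0 ->
  peq (segre_point v w) (segre_point v' w') -> peq v v' /\ peq w w'.
Proof.
move=> v0' w0' [c c0 E].
have h i j : v' 0 i * w' 0 j = c * (v 0 i * w 0 j).
  by rewrite -!segre_pointE E mxE.
have [i vi] := row_neq0_ex v0'; have [j wj] := row_neq0_ex w0'.
split; [apply: (@scale_peq _ _ _ (c * w 0 j / w' 0 j)) => //|
        apply: (@scale_peq _ _ _ (c * v 0 i / v' 0 i)) => //];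
  apply/rowP => k; rewrite mxE.
  by rewrite -[LHS](mulfK wj) h; ring.
by rewrite -[LHS](mulfK vi) [w' 0 k * _]mulrC h; ring.
Qed.

Lemma segre_cone X : cone X -> cone (@segre K N r X).
Proof.
move=> [X0 cX]; split=> [z [v [w [Xv w0 ->]]]|z z' [v [w [Xv w0 ->]]] [c c0 ->]].
  by apply: segre_point_neq0 => //; exact: X0.
exists (c *: v), w; split=> //; first exact: cX Xv (peqZ _ c0).
by rewrite -[RHS]/(segre_point _ _) -[w in RHS]scale1r segre_point_scale mulr1.
Qed.

Lemma segre_pointP X v w : cone X -> @segre K N r X (segre_point v w) -> X v.
Proof.
move=> cX [v' [w' [Xv' w0' E]]].
have [|vv _] := @segre_point_inj v v' w w' (cX.1 _ Xv') w0'.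
  by rewrite E; exact: peq_refl.
exact: cX.2 Xv' (peq_sym vv).
Qed.

End Segre.

Section SegreMap.

Variables (K : fieldType) (N M r : nat).

(** The product of [f] with the identity; [segre_act] is the case where [f] is the action of a group
    element. The factors are sought in the full variety [X], also when [f] is only controlled on a
    subset. *)
Definition segre_map (X : set 'rV[K]_N) (f : 'rV[K]_N -> 'rV[K]_M) (z : 'rV[K]_(N * r.+1)) :
    'rV[K]_(M * r.+1) :=
  let vw := xget (0, 0) [set vw : 'rV[K]_N * 'rV[K]_r.+1 |
    [/\ X vw.1, proj_space vw.2 & z = mxvec (vw.1^T *m vw.2)]] in
  mxvec ((f vw.1)^T *m vw.2).

Lemma segre_mapE (X U : set 'rV[K]_N) (f : 'rV[K]_N -> 'rV[K]_M) v (w : 'rV[K]_r.+1) :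
  cone X -> U `<=` X -> (forall v v', U v -> peq v v' -> peq (f v) (f v')) ->
  U v -> w != 0 -> peq (segre_map X f (segre_point v w)) (segre_point (f v) w).
Proof.
move=> cX UX hf Uv w0; rewrite /segre_map.
case: xgetP => [[v' w'] _ /= [Xv' w0' E]|/(_ (v, w))/= h]; last first.
  by case: h; split=> //; exact: UX.
have [|vv' ww'] := @segre_point_inj K N r v v' w w' (cX.1 _ Xv') w0'.
  by rewrite E; exact: peq_refl.
by apply/peq_sym/segre_point_peq => //; exact: hf.
Qed.

End SegreMap.

Section SegreRegular.

Variables (F K : fieldType) (iota : {rmorphism F -> K}) (r : nat).

Lemma segre_map_regular N M (X U : set 'rV[K]_N) (U' : set 'rV[K]_M) f :
  cone X -> U `<=` X -> cone U -> cone U' -> regular_map iota U U' f ->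
  regular_map iota (@segre K N r U) (@segre K M r U') (segre_map X f).
Proof.
move=> cX UX cU cU' rf.
have hf v v' : U v -> peq v v' -> peq (f v) (f v') by exact: regular_map_peq cU rf.
have E v (w : 'rV[K]_r.+1) : U v -> w != 0 -> peq (segre_map X f (segre_point v w)) (segre_point (f v) w).
  exact: segre_mapE.
apply: regular_map_local => z [v [w [Uv w0 ->]]].
  have H : @segre K M r U' (segre_point (f v) w).
    by exists (f v), w; split=> //; exact: regular_map_in rf Uv.
  exact: (segre_cone r cU').2 _ _ H (peq_sym (E v w Uv w0)).
have [d [s [hs s0 hsf]]] := regular_mapE rf Uv.
have [j wj] := row_neq0_ex w0; have [i vi] := row_neq0_ex (cU.1 _ Uv).
have [l sl] := row_neq0_ex s0.
(* Column [j] and row [i] of the rank one matrix [z], through an entry that is nonzero at the given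
   point, recover [v] and [w] up to scalars by linear forms. *)
pose colz (z : 'rV[K]_(N * r.+1)) : 'rV[K]_N := \row_k z 0 (mxvec_index k j).
pose rowz (z : 'rV[K]_(N * r.+1)) : 'rV[K]_r.+1 := \row_k z 0 (mxvec_index i k).
have colE v' (w' : 'rV[K]_r.+1) : colz (segre_point v' w') = w' 0 j *: v'.
  by apply/rowP => k; rewrite mxE segre_pointE mxE mulrC.
have rowE v' (w' : 'rV[K]_r.+1) : rowz (segre_point v' w') = v' 0 i *: w'.
  by apply/rowP => k; rewrite mxE segre_pointE mxE.
have hcol k : formfun iota 1 (fun z => colz z 0 k).
  by apply: formfun_ext (formfun_coord iota (mxvec_index k j)) => z'; rewrite mxE.
have hscol k : formfun iota (d * 1) (fun z => s (colz z) 0 k).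
  exact: formfun_comp (hs k) hcol.
exists (1 + d * 1)%N, (fun z : 'rV[K]_(N * r.+1) => z 0 (mxvec_index i j) * s (colz z) 0 l),
  (d * 1 + 1)%N, (fun z => segre_point (s (colz z)) (rowz z)); split.
- exact: formfunM (formfun_coord _ _) (hscol l).
- case/mxvec_indexP => a b.
  have := formfunM (hscol a) (formfun_coord iota (mxvec_index i b)).
  by apply: formfun_ext => z'; rewrite segre_pointE [rowz z' 0 b]mxE.
- rewrite -/(segre_point v w) segre_pointE colE (formfun_scale _ _ (hs l)).
  by rewrite !mulf_neq0 // expf_neq0.
move=> z' [v' [w' [Uv' w0' ->]]]; rewrite -/(segre_point v' w') segre_pointE !colE rowE.
rewrite mulf_eq0 negb_or => /andP[]; rewrite mulf_eq0 negb_or => /andP[vi' wj'].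
rewrite (formfun_scale _ _ (hs l)) mulf_eq0 negb_or => /andP[_ sl'].
have ss : peq (s v') (s (w' 0 j *: v')).
  exists (w' 0 j ^+ d); first by rewrite expf_neq0.
  by apply/rowP => k; rewrite [RHS]mxE (formfun_scale _ _ (hs k)).
have sf := hsf v' Uv' (coord_neq0 sl').
split.
  apply: segre_point_neq0; first exact: peq_neq0 ss (coord_neq0 sl').
  by rewrite scaler_eq0 negb_or vi'.
apply: peq_trans (peq_sym (E v' w' Uv' w0')).
apply: segre_point_peq; last exact/peq_sym/peqZ.
exact: peq_trans (peq_sym ss) sf.
Qed.

Lemma segre_open N (X U : set 'rV[K]_N) :
  zariski_open iota X U -> zariski_open iota (@segre K N r X) (@segre K N r U).
Proof.
move=> /zopenP[UX hU]; apply/zopenP; split=> [z [v [w [Uv w0 ->]]]|z [v [w [Uv w0 ->]]]].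
  by exists v, w; split=> //; exact: UX.
have [d [phi [h1 h2 h3]]] := hU v Uv; have [j wj] := row_neq0_ex w0.
pose colz (z : 'rV[K]_(N * r.+1)) : 'rV[K]_N := \row_k z 0 (mxvec_index k j).
have colE v' (w' : 'rV[K]_r.+1) : colz (segre_point v' w') = w' 0 j *: v'.
  by apply/rowP => k; rewrite mxE segre_pointE mxE mulrC.
exists (d * 1)%N, (fun z => phi (colz z)); split.
- apply: formfun_comp h1 _ => k.
  by apply: formfun_ext (formfun_coord iota (mxvec_index k j)) => z'; rewrite mxE.
- rewrite -/(segre_point v w) colE (formfun_scale _ _ h1).
  by rewrite mulf_neq0 // expf_neq0.
move=> z' [v' [w' [Xv' w0' ->]]]; rewrite -/(segre_point v' w') colE.
rewrite (formfun_scale _ _ h1) mulf_eq0 negb_or => /andP[_ pv'].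
by exists v', w'; split=> //; exact: h3.
Qed.

End SegreRegular.

Section SegreDense.

Variables (F : fieldType) (K : closedFieldType) (iota : {rmorphism F -> K}) (N : nat).
Variables (X U : set 'rV[K]_N).
Hypotheses (cX : cone X) (dU : dense_open iota X U).

(* The point [w] has coordinates in K, so a slice of an F-open set need not be F-open:
   instead, polynomials in [w] are expanded one variable at a time. *)
Lemma dense_open_separated (I : eqType) d (phi : I -> 'rV[K]_N -> K) (beta : I -> nat -> nat) k :
  (forall m, formfun iota d (phi m)) -> forall (L : seq I) v (w : nat -> K), X v ->
  \sum_(m <- L) phi m v * \prod_(j < k) w j ^+ beta m j != 0 ->
  exists2 v', U v' & exists w' : nat -> K,
    \sum_(m <- L) phi m v' * \prod_(j < k) w' j ^+ beta m j != 0.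
Proof.
move=> hphi; elim: k => [|k IH] L v w Xv.
  have E u (w' : nat -> K) : \sum_(m <- L) phi m u * \prod_(j < 0) w' j ^+ beta m j =
      \sum_(m <- L) phi m u.
    by apply: eq_bigr => m _; rewrite big_ord0 mulr1.
  rewrite E => nz.
  have hs : formfun iota d (fun u => \sum_(m <- L) phi m u).
    by apply: formfun_sum => m _ _; exact: hphi.
  have [|u [[Xu pu] Uu]] := dU.2 _ (zopen_form X hs); first by exists v.
  by exists u => //; exists w; rewrite E.
(* The sum as a polynomial in the last coordinate of [w]. Its coefficients are sums of the same kind
   over sublists, so induction moves a nonzero coefficient from [v] to a point of [U]; the last
   coordinate is then chosen as a nonroot. *)
pose P u (w' : nat -> K) : {poly K} :=
  \sum_(m <- L) (phi m u * \prod_(j < k) w' j ^+ beta m j) *: 'X^(beta m k).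
have PE u w' a : (forall j, (j < k)%N -> w' j = a j) ->
    \sum_(m <- L) phi m u * \prod_(j < k.+1) a j ^+ beta m j = (P u w').[a k].
  move=> h; rewrite horner_sum; apply: eq_bigr => m _.
  rewrite big_ord_recr hornerZ hornerXn mulrA; congr (_ * _ * _).
  by apply: eq_bigr => j _; rewrite h.
have Pcoef u w' i : (P u w')`_i =
    \sum_(m <- [seq m <- L | beta m k == i]) phi m u * \prod_(j < k) w' j ^+ beta m j.
  rewrite coef_sum big_filter [RHS]big_mkcond; apply: eq_bigr => m _.
  by rewrite coefZ coefXn eq_sym; case: eqP; rewrite ?mulr1 ?mulr0.
rewrite (PE v w w) // => nz.
have : P v w != 0 by apply: contraNneq nz => ->; rewrite horner0.
rewrite -lead_coef_eq0 lead_coefE Pcoef => /(IH _ _ _ Xv)[u Uu [w' nz']].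
exists u => //.
have : P u w' != 0 by apply: contraNneq nz' => P0; rewrite -Pcoef P0 coef0.
move=> /closed_nonrootP[s ns].
pose a j := if j == k then s else w' j.
exists a; rewrite (PE u w' a) /a ?eqxx //.
by move=> j jk; rewrite ltn_eqF.
Qed.

Lemma segre_dense_open r : dense_open iota (@segre K N r X) (@segre K N r U).
Proof.
split; first exact: segre_open dU.1.
move=> O oO [z Oz]; have /zopenP[OX hO] := oO.
have [v [w [Xv w0 zE]]] := OX _ Oz.
have [d0 [phi0 [h01 h02 h03]]] := hO z Oz.
have [l zl] := row_neq0_ex ((segre_cone r cX).1 z (OX _ Oz)).
(* The extra coordinate factor, which raises the degree by 1, forces the new point and hence its
   second factor to be nonzero. *)
have [f hf fE] := formfunM h01 (formfun_coord iota l).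
set d := (d0 + 1)%N in hf.
(* The degrees of a monomial in the coordinates of [v] and of [w]: on Segre points [f] becomes a sum
   of forms in [v] times monomials in [w]. *)
pose alpha (m : 'X_{1..N * r.+1}) i := (\sum_(j < r.+1) m (mxvec_index i j))%N.
pose beta (m : 'X_{1..N * r.+1}) j := (\sum_(i < N) m (mxvec_index i (inord j : 'I_r.+1)))%N.
(* Monomials of another degree are sent to 0, so that [phi m] is a form of degree [d] for every
   [m]. *)
pose phi (m : 'X_{1..N * r.+1}) (u : 'rV[K]_N) : K :=
  if mdeg m == d then iota f@_m * \prod_i u 0 i ^+ alpha m i else 0.
have hphi m : formfun iota d (phi m).
  rewrite /phi; case: eqP => [<-|_]; last exact: formfun0.
  have -> : mdeg m = (\sum_i alpha m i * 1)%N.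
    rewrite mdegE (reindex _ (curry_mxvec_bij N r.+1)) /=.
    rewrite (eq_bigr (fun ij => m (mxvec_index ij.1 ij.2))); last by case.
    rewrite -(pair_bigA _ (fun i j => m (mxvec_index i j))) /=.
    by apply: eq_bigr => i _; rewrite muln1.
  apply/formfunZ/formfun_prod => i _; apply: formfun_exp; exact: formfun_coord.
have key u (a : nat -> K) : feval iota f (segre_point u (\row_(j < r.+1) a j)) =
    \sum_(m <- msupp f) phi m u * \prod_(j < r.+1) a j ^+ beta m j.
  rewrite fevalE; apply: eq_big_seq => m /(dhomog_mf hf) /= md.
  rewrite /phi md eqxx -mulrA; congr (_ * _).
  rewrite (reindex _ (curry_mxvec_bij N r.+1)) /=.
  pose E i j := segre_point u (\row_(j < r.+1) a j) 0 (mxvec_index i j) ^+ m (mxvec_index i j).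
  rewrite (eq_bigr (fun ij => E ij.1 ij.2)); last by case.
  rewrite -(pair_bigA _ E) /E /=.
  under eq_bigr do under eq_bigr do rewrite segre_pointE exprMn.
  under eq_bigr do rewrite big_split /=.
  rewrite big_split /=; congr (_ * _).
    by apply: eq_bigr => i _; rewrite prodrXr.
  rewrite exchange_big; apply: eq_bigr => j _ /=.
  by rewrite /beta inord_val -prodrXr; apply: eq_bigr => i _; rewrite mxE.
have wE : w = \row_(j < r.+1) w 0 (inord j) by apply/rowP => j; rewrite mxE inord_val.
have [|v' Uv' [w' nz]] := @dense_open_separated _ d phi beta r.+1 hphi (msupp f) v
    (fun j => w 0 (inord j)) Xv.
  have := key v (fun j => w 0 (inord j)); rewrite -wE => <-.
  by rewrite fE /segre_point -zE mulf_neq0.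
move: nz; rewrite -key fE mulf_eq0 negb_or; set z' := segre_point _ _ => /andP[pz' zl'].
have w0' : \row_(j < r.+1) w' j != 0.
  by apply: contraNneq zl' => w0'; rewrite /z' w0' /segre_point mulmx0 raddf0 mxE.
have Xv' := zopen_sub dU.1 Uv'.
exists z'; split; last by exists v', (\row_(j < r.+1) w' j).
by apply: h03 => //; exists v', (\row_(j < r.+1) w' j).
Qed.

End SegreDense.

Section SegreAction.

Variables (F K : fieldType) (iota : {rmorphism F -> K}) (r N : nat) (X : set 'rV[K]_N).
Hypothesis cX : cone X.
Variables (gT : finGroupType) (G : {group gT}) (actX : gT -> 'rV[K]_N -> 'rV[K]_N).

Lemma segre_actE h v (w : 'rV[K]_r.+1) : variety_action iota G X actX ->
  h \in G -> X v -> w != 0 ->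
  peq (segre_act X actX h (segre_point v w)) (segre_point (actX h v) w).
Proof.
move=> vX Gh Xv w0; apply: (@segre_mapE K N N r X X (actX h)) => //.
by move=> u u'; exact: (action_peq cX vX).
Qed.

Lemma segre_variety_action : variety_action iota G X actX ->
  variety_action iota G (@segre K N r X) (@segre_act K gT N r X actX).
Proof.
move=> vX; have [rX a1 aM] := vX.
have rS h : h \in G -> regular_map iota (@segre K N r X) (@segre K N r X) (@segre_act K gT N r X actX h).
  by move=> Gh; exact: (@segre_map_regular _ _ iota r _ _ _ _ _ _ cX (@subset_refl _ X) cX cX (rX h Gh)).
split=> //.
  move=> z [v [w [Xv w0 ->]]].
  apply: peq_trans (segre_actE vX (group1 G) Xv w0) _.
  by apply: segre_point_peq (a1 _ Xv) _; exact: peq_refl.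
move=> h k z Gh Gk [v [w [Xv w0 ->]]].
apply: peq_trans (segre_actE vX (groupM Gh Gk) Xv w0) _.
have Xhv := action_in vX Gh Xv.
apply: peq_trans (segre_point_peq (aM h k v Gh Gk Xv) (peq_refl w)) _.
apply: peq_trans (peq_sym (segre_actE vX Gk Xhv w0)) _.
apply: (regular_map_peq (segre_cone r cX) (rS k Gk)).
  by exists (actX h v), w.
exact: peq_sym (segre_actE vX Gh Xv w0).
Qed.

End SegreAction.

Section SegreBirational.

Variables (F : fieldType) (K : closedFieldType) (iota : {rmorphism F -> K}) (r : nat).
Variables (N M : nat) (X : set 'rV[K]_N) (Y : set 'rV[K]_M).
Hypotheses (cX : cone X) (cY : cone Y).

Lemma segre_birational U U' f g : birational_between iota X U Y U' f g ->
  birational_between iota (@segre K N r X) (@segre K N r U) (@segre K M r Y) (@segre K M r U')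
    (segre_map X f) (segre_map Y g).
Proof.
move=> [[dU dU'] rf rg gf fg].
have cU := zopen_cone cX dU.1; have cU' := zopen_cone cY dU'.1.
have UX := zopen_sub dU.1; have UY := zopen_sub dU'.1.
have pf v v' : U v -> peq v v' -> peq (f v) (f v') by exact: regular_map_peq cU rf.
have pg v v' : U' v -> peq v v' -> peq (g v) (g v') by exact: regular_map_peq cU' rg.
have rF := @segre_map_regular _ _ iota r _ _ _ _ _ _ cX UX cU cU' rf.
have rG := @segre_map_regular _ _ iota r _ _ _ _ _ _ cY UY cU' cU rg.
split=> //.
- by split; apply: segre_dense_open.
- move=> z /[dup] Uz [v [w [Uv w0 E]]]; rewrite E in Uz *.
  have Ufv := regular_map_in rf Uv.
  apply: peq_trans (regular_map_peq (segre_cone r cU') rG (regular_map_in rF Uz)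
    (segre_mapE cX UX pf Uv w0)) _.
  apply: peq_trans (segre_mapE cY UY pg Ufv w0) _.
  by apply: segre_point_peq (gf _ Uv) _; exact: peq_refl.
- move=> z /[dup] Uz [v [w [Uv w0 E]]]; rewrite E in Uz *.
  have Ufv := regular_map_in rg Uv.
  apply: peq_trans (regular_map_peq (segre_cone r cU) rF (regular_map_in rG Uz)
    (segre_mapE cY UY pg Uv w0)) _.
  apply: peq_trans (segre_mapE cX UX pf Ufv w0) _.
  by apply: segre_point_peq (fg _ Uv) _; exact: peq_refl.
Qed.

Variables (gT : finGroupType) (G : {group gT}).
Variables (actX : gT -> 'rV[K]_N -> 'rV[K]_N) (actY : gT -> 'rV[K]_M -> 'rV[K]_M).

Lemma segre_equivariantly_birational :
  variety_action iota G X actX -> variety_action iota G Y actY ->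
  equivariantly_birational iota G X actX Y actY ->
  equivariantly_birational iota G (@segre K N r X) (@segre_act K gT N r X actX)
    (@segre K M r Y) (@segre_act K gT M r Y actY).
Proof.
move=> vX vY [U [U' [f [g [bir eqv]]]]].
exists (@segre K N r U), (@segre K M r U'), (segre_map X f), (segre_map Y g).
split; first exact: segre_birational.
have [[dU dU'] rf rg _ _] := bir.
have cU := zopen_cone cX dU.1; have cU' := zopen_cone cY dU'.1.
have UX := zopen_sub dU.1; have UY := zopen_sub dU'.1.
have pf v v' : U v -> peq v v' -> peq (f v) (f v') by exact: regular_map_peq cU rf.
have rF := @segre_map_regular _ _ iota r _ _ _ _ _ _ cX UX cU cU' rf.
have [rS _ _] := segre_variety_action r cY vY.
move=> h z Gh [v [w [Uv w0 ->]]] Uhz.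
have E := segre_actE cX vX Gh (UX _ Uv) w0.
have Uhv : U (actX h v) := segre_pointP cU ((segre_cone r cU).2 _ _ Uhz E).
have Ufv := regular_map_in rf Uv.
apply: peq_trans (regular_map_peq (segre_cone r cU) rF Uhz E) _.
apply: peq_trans (segre_mapE cX UX pf Uhv w0) _.
apply: peq_trans (segre_point_peq (eqv h v Gh Uv Uhv) (peq_refl w)) _.
apply: peq_trans (peq_sym (segre_actE cY vY Gh (UY _ Ufv) w0)) _.
apply: (regular_map_peq (segre_cone r cY) (rS h Gh)).
  by exists (f v), w; split=> //; exact: UY.
exact: peq_sym (segre_mapE cX UX pf Uv w0).
Qed.

Lemma segre_linearizable_transfer :
  variety_action iota G X actX -> variety_action iota G Y actY ->
  equivariantly_birational iota G X actX Y actY ->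
  linearizable iota G (@segre K N r X) (@segre_act K gT N r X actX) ->
  linearizable iota G (@segre K M r Y) (@segre_act K gT M r Y actY).
Proof.
move=> vX vY eqb; apply: linearizable_transfer.
- exact: segre_cone.
- exact: segre_cone.
- exact: segre_variety_action.
- exact: segre_equivariantly_birational.
Qed.

End SegreBirational.

(** * Group actions on the quotient *)

Section NormalizingAction.

Variables (F K : fieldType) (iota : {rmorphism F -> K}) (p n : nat).
Variables (T : set 'M[K]_n) (gT : finGroupType) (G : {group gT}).
Variable rG : mx_representation F G n.
Hypothesis p0 : (0 < p)%N.

Definition repr_map g : 'M[K]_n := map_mx iota (rG g).
Local Notation act g := (gr_act p (repr_map g)).

Hypothesis closedT : closed_subgroup_SL T.
Hypothesis normT : forall g t, g \in G -> T t ->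
  T (invmx (repr_map g) *m t *m repr_map g).

Lemma subgroup_unit t : T t -> t \in unitmx.
Proof. by have [dT _ _ _ _] := closedT => /dT dt; rewrite unitmxE dt unitr1. Qed.

Lemma stable_locus_subgroup t x :
  T t -> stable_locus p iota T x -> stable_locus p iota T (gr_act p t x).
Proof.
have [_ _ TM TV _] := closedT.
move=> Tt [Vx [d [f [hd hT fx hD fin]]]]; have ut := subgroup_unit Tt.
split; first exact: GrV_act.
exists d, f; split=> //; first by rewrite hT.
apply: sub_finite_set (finite_image (fun u => invmx t *m u *m t) fin) => u [Tu ux].
exists (t *m u *m invmx t); last by rewrite !mulmxA mulVmx // mul1mx mulmxKV.
split; first exact: (TM _ _ (TM _ _ Tt Tu) (TV _ Tt)).
have := gr_act_peq (invmx t) ux.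
by rewrite -!gr_actM mulmxV // GrV_act1 // !mulmxA.
Qed.

Lemma repr_map_unit g : g \in G -> repr_map g \in unitmx.
Proof. by move=> Gg; rewrite map_unitmx repr_mx_unit. Qed.

Lemma repr_map1 : repr_map 1%g = 1%:M.
Proof. by rewrite /repr_map repr_mx1 map_mx1. Qed.

Lemma repr_mapM g h : g \in G -> h \in G -> repr_map (g * h)%g = repr_map g *m repr_map h.
Proof. by move=> Gg Gh; rewrite /repr_map repr_mxM // map_mxM. Qed.

Lemma repr_mapV g : g \in G -> repr_map g^-1%g = invmx (repr_map g).
Proof. by move=> Gg; rewrite /repr_map repr_mxV // map_invmx. Qed.

Lemma gr_act_reprK g v : g \in G -> GrV p n v -> act g (act g^-1%g v) = v.
Proof.
by move=> Gg Vv; rewrite -gr_actM repr_mapV // mulVmx ?repr_map_unit // GrV_act1.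
Qed.

Lemma gr_act_reprVK g v : g \in G -> GrV p n v -> act g^-1%g (act g v) = v.
Proof.
by move=> Gg Vv; rewrite -gr_actM repr_mapV // mulmxV ?repr_map_unit // GrV_act1.
Qed.

Lemma gr_act_normalize g t v : g \in G ->
  act g (gr_act p t v) = gr_act p (invmx (repr_map g) *m t *m repr_map g) (act g v).
Proof.
move=> Gg; rewrite -!gr_actM !mulmxA mulmxV ?mul1mx //.
exact: repr_map_unit.
Qed.

Lemma orbit_normalize g x y : g \in G -> orbit_set T x y -> orbit_set T (act g x) (act g y).
Proof.
move=> Gg [t Tt xy]; exists (invmx (repr_map g) *m t *m repr_map g); first exact: normT.
by rewrite -gr_act_normalize //; exact: gr_act_peq.
Qed.

Lemma GrV_repr g v : g \in G -> GrV p n v -> GrV p n (act g v).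
Proof. by move=> Gg; apply: GrV_act; exact: repr_map_unit. Qed.

(** The invariant form at [act g x] is [f] composed with the action of [g^-1]: it is over [F]
    because the representation is, and invariant because [G] normalizes [T]. Closed orbits and
    finite stabilizers are transported likewise. *)
Lemma stable_locus_repr g x : g \in G -> stable_locus p iota T x -> stable_locus p iota T (act g x).
Proof.
move=> Gg [Vx [d [f [[d0 hd] hT fx hD fin]]]].
have Gi := groupVr Gg.
split; first exact: GrV_repr.
have [f' hf' f'E] := formfun_comp (formfun_feval iota hd) (@gr_act_formfun K p n F iota (rG g^-1%g)).
exists (d * 1)%N, f'; split.
- by split; rewrite // muln1.
- move=> t y Tt Vy; rewrite !f'E gr_act_normalize // hT //; first exact: normT.
  exact: GrV_repr.
- by rewrite f'E -/(repr_map _) gr_act_reprVK.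
- move=> y [Vy]; rewrite f'E => fy.
  have Viy := GrV_repr Gi Vy.
  have [sub /zopenP[_ cl]] := hD (act g^-1%g y) (conj Viy fy).
  have orbV z : GrV p n z -> orbit_set T (act g^-1%g y) (act g^-1%g z) -> orbit_set T y z.
    by move=> Vz /(orbit_normalize Gg); rewrite !gr_act_reprK.
  have orbD z : orbit_set T y z -> GrV p n z /\ feval iota f' z != 0.
    move=> yz; have [Vz fz] := sub _ (orbit_normalize Gi yz); rewrite f'E; split=> //.
    by case: yz => t Tt; apply: (cone_Gr _ p0).2; apply: GrV_act Vy; exact: subgroup_unit.
  split=> //; apply/zopenP; split=> [z []//|z [[Vz f'z] nz]].
  have [|e [phi [h1 h2 h3]]] := cl (act g^-1%g z).
    split; last by move=> /orbV-/(_ Vz).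
    by split; [exact: GrV_repr|rewrite -f'E].
  exists (e * 1)%N, (fun w => phi (act g^-1%g w)); split=> //.
    apply: formfun_comp h1 _ => j.
    by have := @gr_act_formfun K p n K idfun (repr_map g^-1%g) j; rewrite map_mx_id.
  move=> w [Vw f'w] pw; split=> // yw.
  have [|_] := h3 (act g^-1%g w) _ pw; first by split; [exact: GrV_repr|rewrite -f'E].
  by apply; exact: orbit_normalize.
- apply: sub_finite_set (finite_image (fun t => invmx (repr_map g) *m t *m repr_map g) fin).
  move=> t [Tt tx]; exists (invmx (repr_map g^-1%g) *m t *m repr_map g^-1%g); last first.
    by rewrite repr_mapV // invmxK !mulmxA mulVmx ?repr_map_unit // mul1mx mulmxKV // repr_map_unit.
  split; first exact: normT.
  have := gr_act_peq (repr_map g^-1%g) tx.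
  by rewrite gr_act_normalize // gr_act_reprVK.
Qed.

Section QuotientAction.

Variables (M : nat) (Q : set 'rV[K]_M) (pi : 'rV[K]_#|incr p n| -> 'rV[K]_M).
Local Notation X := (stable_locus p iota T).
Hypotheses (cX : cone X) (cQ : cone Q) (hpi : geometric_quotient iota T X Q pi).

(** Acts on a chosen lift; [G] permutes the orbits of [T] in the stable locus, so the choice matters
    only up to a scalar. *)
Definition quotient_act (g : gT) (y : 'rV[K]_M) : 'rV[K]_M :=
  pi (act g (xget 0 [set x | X x /\ peq (pi x) y])).

Lemma quotient_actE g x y : g \in G -> X x -> peq (pi x) y ->
  peq (quotient_act g y) (pi (act g x)).
Proof.
move=> Gg Xx xy; rewrite /quotient_act.
case: xgetP => [x' _ [Xx' xy']|/(_ x)/= h]; last by case: h.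
apply/(quotient_orbit hpi); [exact: stable_locus_repr..|].
apply: orbit_normalize => //; apply/(quotient_orbit hpi) => //.
exact: peq_trans xy' (peq_sym xy).
Qed.

Lemma gr_act_regular g (Z Z' : set 'rV[K]_#|incr p n|) :
  (forall v, Z v -> Z' (act g v)) -> cone Z' -> regular_map iota Z Z' (act g).
Proof.
move=> ZZ cZ'; apply: regular_map_local => // v Zv.
exists 0%N, (fun=> 1), 1%N, (act g); split=> //.
- exact: formfun1.
- by move=> j; exact: gr_act_formfun.
- exact: oner_neq0.
- by move=> w Zw _; split; [exact: cZ'.1 (ZZ _ Zw)|exact: peq_refl].
Qed.

Lemma quotient_variety_action : variety_action iota G Q quotient_act.
Proof.
have lift y : Q y -> exists2 x, X x & peq (pi x) y by move=> Qy; exact: (quotient_surjective hpi Qy).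
have rpi := quotient_regular hpi.
have inQ g y : g \in G -> Q y -> Q (quotient_act g y).
  move=> Gg /lift[x Xx xy]; apply: cQ.2 (peq_sym (quotient_actE Gg Xx xy)).
  exact/(regular_map_in rpi)/stable_locus_repr.
have preQ : quotient_preimage X pi Q = X.
  apply/seteqP; split=> x; first by case.
  move=> Xx; split=> //; exists (pi x); last exact: peq_refl.
  exact: regular_map_in rpi Xx.
split.
- move=> g Gg.
  have stX v : X v -> X (act g v) := @stable_locus_repr g v Gg.
  (* The map [pi \o act g] is constant on orbits up to scalars, and the map it induces on the
     quotient is [quotient_act g]. *)
  apply: (@invariant_map_descends _ _ _ _ _ _ _ _ _ _ cQ hpi Q _ Q (pi \o act g)) => //.
  + exact: zopen_full.
  + rewrite preQ; apply: (regular_map_comp cX (gr_act_regular stX cX) rpi).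
  + rewrite preQ => t x Tt Xx /=; apply/(quotient_orbit hpi).
    * exact/stX/stable_locus_subgroup.
    * exact: stX.
    * apply: orbit_normalize => //; apply/(quotient_orbit hpi) => //.
        exact: stable_locus_subgroup.
      apply: peq_sym; apply/(quotient_orbit hpi) => //; first exact: stable_locus_subgroup.
      by exists t => //; exact: peq_refl.
  + rewrite preQ => x y Xx Qy xy; exact: quotient_actE.
- move=> y /lift[x Xx xy]; apply: peq_trans (quotient_actE (group1 G) Xx xy) _.
  by rewrite repr_map1 GrV_act1 //; case: Xx.
- move=> g h y Gg Gh /lift[x Xx xy].
  apply: peq_trans (quotient_actE (groupM Gg Gh) Xx xy) _.
  have Xgx := stable_locus_repr Gg Xx.
  apply: peq_sym; apply: peq_trans (quotient_actE Gh Xgx (peq_sym (quotient_actE Gg Xx xy))) _.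
  by rewrite /= repr_mapM // gr_actM; exact: peq_refl.
Qed.

End QuotientAction.

End NormalizingAction.

Theorem theorem13 (F : fieldType) (K : closedFieldType)
    (iota : {rmorphism F -> K}) (algK : forall a : K, algebraicOver iota a)
    (p m n : nat) (hp : (0 < p)%N) (hm : (0 < m)%N) (hn : n = (p * m).+1)
    (T : set 'M[K]_n) (hT : maximal_torus_SL iota T)
    (W : 'M[F]_n) (hW : \rank W = ((p - 1) * m).+1)
    (htr : transverse p iota T (map_mx iota W))
    (M : nat) (Q : set 'rV[K]_M) (hQ : quasi_projective iota Q)
    (pi : 'rV[K]_#|incr p n| -> 'rV[K]_M)
    (hpi : geometric_quotient iota T (stable_locus p iota T) Q pi) :
  [/\ rational_section iota (stable_locus p iota T) (Gr p (map_mx iota W)) Q pi,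
      rational iota (Gr p (map_mx iota W)) -> rational iota Q
    & forall (gT : finGroupType) (G : {group gT})
        (rG : mx_representation F G n),
        (forall g t, g \in G -> T t ->
           T (invmx (map_mx iota (rG g)) *m t *m map_mx iota (rG g))) ->
        mxmodule rG W ->
        let act (g : gT) v := gr_act p (map_mx iota (rG g)) v in
        exists actQ : gT -> 'rV[K]_M -> 'rV[K]_M,
          [/\ variety_action iota G Q actQ,
              (forall g x, g \in G -> stable_locus p iota T x ->
                 stable_locus p iota T (act g x) /\
                 peq (pi (act g x)) (actQ g (pi x))),
              linearizable iota G (Gr p (map_mx iota W)) act ->
                linearizable iota G Q actQ
            & stably_linearizable iota G (Gr p (map_mx iota W)) act ->
                stably_linearizable iota G Q actQ]].

Proof.
subst n.
have [P uP TE] := maximal_torus_diag hT.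
have [closedT _ defT _] := hT.
rewrite TE in defT.
have [e [fe eP]] := diag_torus_rational_basis uP defT.
have nE : (p * m).+1 = (((p - 1) * m).+1 + m)%N.
  by rewrite addSn -[m in (_ + m)%N]mul1n -mulnDl subnK.
have [C CP] := annihilator_exists hW nE.
have {}CP q (X : 'M[K]_(q, (p * m).+1)) := CP K iota q X.
have cQ := quasi_projective_cone hQ.
have cW : cone (Gr p (map_mx iota W)) := cone_Gr _ hp.
rewrite TE in htr hpi.
have cX : cone (stable_locus p iota (diag_torus P))  by exact: stable_locus_cone.
have [U [U' [g [UX bir]]]] := section_birational hp uP fe eP CP cQ hpi htr.
rewrite -TE in hpi UX cX.
have [[dU dU'] rf rg gf fg] := bir.
split.
- exists U; split=> //; exists U, U', g; split=> //.
  by split=> //; exact: dense_open_full.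
(* The birational map from Gr(p, W) to projective space is precomposed with the inverse [g] of the
   section. *)
- move=> [d [f [V [V' [h bir']]]]].
  exists d, (f \o g); do 3 eexists.
  exact: birational_between_trans cQ cW (@cone_proj_space K d.+1)
    (birational_between_sym bir) bir'.
move=> gT G rG normT modW act.
have stX := stable_locus_repr hp closedT normT.
have vQ := quotient_variety_action hp closedT normT cX cQ hpi.
have vW : variety_action iota G (Gr p (map_mx iota W)) act.
  have inW h v : h \in G -> Gr p (map_mx iota W) v -> Gr p (map_mx iota W) (act h v).
    move=> Gh [A [rA AW ->]]; exists (A *m repr_map iota rG h); split.
    - by rewrite row_free_unitmul // repr_map_unit.
    - apply: submx_trans (submxMr _ AW) _; rewrite /repr_map -map_mxM map_submx.
      exact: (mxmoduleP modW).
    - by rewrite /act gr_act_plucker.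
  split=> [h Gh|x [A [rA _ ->]]|h k x Gh Gk _].
  - by apply: gr_act_regular => // v; exact: inW.
  - by rewrite /act repr_mx1 map_mx1 gr_act_plucker mulmx1; exact: peq_refl.
  - by rewrite /act -gr_actM repr_mxM // map_mxM; exact: peq_refl.
have eqb : equivariantly_birational iota G (Gr p (map_mx iota W)) act Q
    (quotient_act iota T rG pi).
  (* The birational map is [pi] itself: [U] lies in the stable locus, where [quotient_actE] makes
     [pi] equivariant. *)
  exists U, U', pi, g; split=> // h x Gh Ux Uhx.
  by apply/peq_sym/(quotient_actE hp closedT normT hpi Gh (UX _ Ux))/peq_refl.
exists (quotient_act iota T rG pi); split=> //.
- move=> h x Gh Xx; split; first exact: stX.
  by apply/peq_sym/(quotient_actE hp closedT normT hpi Gh Xx)/peq_refl.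
- exact: linearizable_transfer cW cQ vQ eqb.
- move=> [r lin]; exists r.
  exact: (segre_linearizable_transfer cW cQ vW vQ eqb lin).
Qed.
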